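(* Let $T>0$, $H\in(0,1)$, and let $B^{(1)},B^{(2)}$ be two independent fractional Brownian motions with Hurst index $H$. For $\varepsilon>0$ set \[ \widehat G_\varepsilon=\int_0^T\frac{B^{(1)}_{u+\varepsilon}-B^{(1)}_u}{\varepsilon}\times\frac{B^{(2)}_{u+\varepsilon}-B^{(2)}_u}{\varepsilon}\,\mathrm du . \] (a) If $H<\tfrac34$, then as $\varepsilon\to0$, \[ \Big(\big(B^{(1)}_t,B^{(2)}_t\big)_{t\in[0,T]},\ \varepsilon^{3/2-2H}\widehat G_\varepsilon\Big)\xrightarrow{\ \mathrm{Law}\ }\Big(\big(B^{(1)}_t,B^{(2)}_t\big)_{t\in[0,T]},\ N\Big), \] where $N\sim\mathscr N(0,T\widehat\sigma_H^2)$ is independent of $(B^{(1)},B^{(2)})$ and $\widehat\sigma_H^2=\frac14\int_{\mathbb R}\big(|x+1|^{2H}+|x-1|^{2H}-2|x|^{2H}\big)^2\,\mathrm dx$. (b) If $H=\tfrac34$, then as $\varepsilon\to0$, \[ \Big(\big(B^{(1)}_t,B^{(2)}_t\big)_{t\in[0,T]},\ \frac{\widehat G_\varepsilon}{\sqrt{\log(1/\varepsilon)}}\Big)\xrightarrow{\ \mathrm{Law}\ }\Big(\big(B^{(1)}_t,B^{(2)}_t\big)_{t\in[0,T]},\ N\Big), \] where $N\sim\mathscr N(0,9T/32)$ is independent of $(B^{(1)},B^{(2)})$.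
   Context: A fractional Brownian motion with Hurst index $H\in(0,1)$ is a centered Gaussian process $(B_t)_{t\ge0}$ with covariance $E(B_tB_s)=\tfrac12(t^{2H}+s^{2H}-|t-s|^{2H})$ (taken with continuous paths). Convergence in law is of random elements of $C([0,T];\mathbb R^2)\times\mathbb R$. *)

(* Defs.v *)
From HB Require Import structures.
From mathcomp Require Import all_boot all_order all_algebra.
From mathcomp Require Import all_classical all_reals all_analysis.
Set Implicit Arguments. Unset Strict Implicit. Unset Printing Implicit Defensive.
Import Order.TTheory GRing.Theory Num.Theory.
Import numFieldNormedType.Exports.
Local Open Scope classical_set_scope.
Local Open Scope ring_scope.

Section Defs.
Context {d : measure_display} {Omega : measurableType d} {R : realType}.

Definition gauss0 (v : R) (A : set R) : \bar R :=
  if v == 0 then dirac (0 : R) A else normal_prob 0 (Num.sqrt v) A.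

Definition fBm_cov (H s t : R) : R :=
  (s `^ (2 * H) + t `^ (2 * H) - `|t - s| `^ (2 * H)) / 2.

Definition is_fBm (P : probability Omega R) (H : R) (B : R -> Omega -> R) : Prop :=
  [/\ (forall t, 0 <= t -> measurable_fun setT (B t)),
      (forall w, {within `[0, +oo[, continuous (fun t => B t w)}) &
      (forall (n : nat) (t a : 'I_n -> R), (forall i, 0 <= t i) ->
        forall A : set R, measurable A ->
          P ((fun w => \sum_(i < n) a i * B (t i) w) @^-1` A) =
          gauss0 (\sum_(i < n) \sum_(j < n) a i * a j * fBm_cov H (t i) (t j)) A)].

Definition indep_proc (P : probability Omega R) (X Y : R -> Omega -> R) : Prop :=
  forall (n : nat) (s t : 'I_n -> R) (A C : 'I_n -> set R),
    (forall i, 0 <= s i) -> (forall i, 0 <= t i) ->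
    (forall i, measurable (A i)) -> (forall i, measurable (C i)) ->
    P ([set w | forall i, A i (X (s i) w)] `&` [set w | forall i, C i (Y (t i) w)])
    = (P [set w | forall i, A i (X (s i) w)] * P [set w | forall i, C i (Y (t i) w)])%E.

Definition path2 (X1 X2 : R -> Omega -> R) (w : Omega) : R -> R * R :=
  fun t => (X1 t w, X2 t w).

Definition Ghat (B1 B2 : R -> Omega -> R) (T eps : R) (w : Omega) : R :=
  Rintegral lebesgue_measure `[0, T]%classic
    (fun u => (B1 (u + eps) w - B1 u w) / eps * ((B2 (u + eps) w - B2 u w) / eps)).

Definition sigmaH2 (H : R) : R :=
  4^-1 * Rintegral lebesgue_measure setT
    (fun x : R => (`|x + 1| `^ (2 * H) + `|x - 1| `^ (2 * H) - 2 * `|x| `^ (2 * H)) ^+ 2).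

End Defs.

Section Law.
Context {R : realType}.

(** Bounded continuous test functionals on C([0,T]; R^2) x R.  A functional
    is represented by F : (R -> R*R) -> R -> R that only depends on the
    restriction of the path to [0,T], is bounded, and is continuous at every
    (f, x) with f continuous on [0,T], for the uniform distance on [0,T]
    (paths) and the usual distance on R. *)
Definition Cb_test (T : R) (F : (R -> R * R) -> R -> R) : Prop :=
  [/\ (exists M : R, forall f x, `|F f x| <= M),
      (forall f g x, {in `[0, T], f =1 g} -> F f x = F g x) &
      (forall f x, {within `[0, T], continuous f} ->
         forall e : R, 0 < e -> exists2 del : R, 0 < del &
           forall g y, {within `[0, T], continuous g} ->
             (forall t, t \in `[0, T] ->
                `|(f t).1 - (g t).1| < del /\ `|(f t).2 - (g t).2| < del) ->
             `|x - y| < del -> `|F f x - F g y| < e)].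
End Law.

(** Convergence in law, as eps -> 0+, of (Y, Z eps) in C([0,T];R^2) x R
    towards (Y, N) with N ~ N(0, v) independent of Y: for every bounded
    continuous functional F,  E[F(Y, Z eps)] -> E[ int F(Y, x) N(0,v)(dx) ]
    (the right-hand side is E[F(Y,N)] for N independent of Y). *)
Definition cvg_law_indep_normal {d : measure_display} {Omega : measurableType d}
    {R : realType} (P : probability Omega R) (T : R)
    (Y : Omega -> R -> R * R) (Z : R -> Omega -> R) (v : R) : Prop :=
  forall F, Cb_test T F ->
    (fun eps : R => Rintegral P setT (fun w => F (Y w) (Z eps w)))
      @ 0^'+ -->
    Rintegral P setT (fun w =>
      Rintegral (normal_prob (0 : R) (Num.sqrt v)) setT (fun x => F (Y w) x)).

(* Main.v *)
Require Import Defs.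
From HB Require Import structures.
From mathcomp Require Import all_boot all_order all_algebra.
From mathcomp Require Import all_classical all_reals all_analysis.
From mathcomp Require Import measurable_realfun.
From mathcomp Require Import ring lra zify.
Import Order.TTheory GRing.Theory Num.Theory.
Import numFieldNormedType.Exports.
Set Implicit Arguments.
Unset Strict Implicit.
Unset Printing Implicit Defensive.
Local Open Scope classical_set_scope.
Local Open Scope ring_scope.

(** Let [Z_n] be a Riemann sum of the rescaled integral and [l1], [l2] linear
    forms in the values of the two processes. Given [B1], both [l2(B2)] and [Z_n]
    are jointly Gaussian, so [E cos(l1(B1) + l2(B2) + lam Z_n)] is computed from
    the conditional variance of [Z_n] and its conditional covariance with [l2(B2)].
    The second moments of these two (Isserlis) show that the former concentrates
    at [v] and the latter vanishes as soon as [E Z_n^2 -> v] and the contraction of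
    the covariance kernel with itself tends to [0]. By stationarity and scaling,
    with [N = T / eps] and [rho] the correlation of fractional Gaussian noise,
    [E Z_n^2] tends to [w 2 \int_0^N (N - x) rho(x)^2 dx] and the contraction is at most
    [w (2 \int_0^N |rho|)^2 E Z_n^2], where [w] is [eps] if [H < 3/4] and
    [eps / ln(1/eps)] if [H = 3/4]; the asymptotics [rho(x) ~ H (2 H - 1) x^(2 H - 2)]
    give both limits. Convergence of these trigonometric moments, together with
    tightness, extends to all bounded continuous functionals: paths are replaced
    by their Bernstein polynomials, and functions of finitely many
    coordinates are approximated by trigonometric polynomials. *)

(** * Bernstein approximation *)

(** The first component of the pair is the same process for every [eps]. Hence tightness concerns
    the real component alone, and the approximation of path functionals has an error that does not
    depend on [eps]: convergence along each path and dominated convergence suffice, with no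
    compactness in the space of paths. The conditional factor tends to the deterministic
    [expR (- (lam ^+ 2 * v / 2))], and this is what makes the limit variable independent of both
    processes. Riemann sums keep every object a bilinear form in finitely many Gaussian variables,
    so that moments of order four take the place of stochastic integrals. The bounds see a Riemann
    sum only through [zvar] and [zcontr]; the mesh tends to 0 at fixed [eps], and [eps] tends to 0
    afterwards. The threshold 3/4 is where rho^2, at most of order x^(4H-4), ceases to be
    integrable; there rho(x)^2 is equivalent to (9/64)/x, and the logarithmic divergence yields the
    variance 2 T (9/64) = 9T/32. *)

Section Bernstein.
Context {R : realType}.
Implicit Types (g : nat -> R) (u : R).

(** The Bernstein sum [\sum_k 'C(n, k) u ^+ k (1 - u) ^+ (n - k) g k]. *)
Fixpoint bern (n : nat) g u : R :=
  if n is n'.+1 then u * bern n' (fun j => g j.+1) u + (1 - u) * bern n' g u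
  else g 0%N.

Lemma bernD n g1 g2 u :
  bern n (fun j => g1 j + g2 j) u = bern n g1 u + bern n g2 u.
Proof.
elim: n g1 g2 => [//|n IH] g1 g2 /=.
by rewrite (IH (fun j => g1 j.+1) (fun j => g2 j.+1)) IH; ring.
Qed.

Lemma bernZ n c g u : bern n (fun j => c * g j) u = c * bern n g u.
Proof. by elim: n g => [//|n IH] g /=; rewrite (IH (fun j => g j.+1)) IH; ring. Qed.

Lemma bern_cst n c u : bern n (fun=> c) u = c.
Proof. by elim: n => [//|n IH] /=; rewrite IH; ring. Qed.

Lemma bern_id n u : bern n (fun j => j%:R) u = n%:R * u.
Proof.
elim: n => [|n IH] /=; first by rewrite mul0r.
rewrite (_ : (fun j => j.+1%:R) = (fun j => 1 + j%:R) :> (nat -> R)); last first.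
  by apply/funext => j; rewrite -natr1 addrC.
by rewrite (bernD n (fun=> 1)) bern_cst IH -natr1; ring.
Qed.

Lemma bern_sqr n u :
  bern n (fun j => j%:R ^+ 2) u = n%:R * u * (1 - u) + (n%:R * u) ^+ 2.
Proof.
elim: n => [|n IH] /=; first by rewrite !mul0r expr0n addr0.
rewrite (_ : (fun j => j.+1%:R ^+ 2) =
    (fun j => (1 + 2 * j%:R) + j%:R ^+ 2) :> (nat -> R)); last first.
  by apply/funext => j; rewrite -natr1; ring.
rewrite (bernD n (fun j => 1 + 2 * j%:R)) (bernD n (fun=> 1)) bern_cst bernZ.
by rewrite bern_id IH -natr1; ring.
Qed.

Lemma eq_bern n g1 g2 u : (forall j, (j <= n)%N -> g1 j = g2 j) ->
  bern n g1 u = bern n g2 u.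
Proof.
elim: n g1 g2 => [|n IH] g1 g2 h /=; first exact: h.
congr (_ * _ + _ * _); first by apply: IH => j jn; exact: h.
by apply: IH => j jn; apply: h; exact: leqW.
Qed.

Lemma le_bern n g1 g2 u : 0 <= u <= 1 ->
  (forall j, (j <= n)%N -> g1 j <= g2 j) -> bern n g1 u <= bern n g2 u.
Proof.
move=> /andP[u0 u1]; elim: n g1 g2 => [|n IH] g1 g2 h /=; first exact: h.
apply: lerD; apply: ler_wpM2l; rewrite ?subr_ge0//.
  by apply: IH => j jn; exact: h.
by apply: IH => j jn; apply: h; exact: leqW.
Qed.

Lemma bern_norm n g u M : 0 <= u <= 1 ->
  (forall j, (j <= n)%N -> `|g j| <= M) -> `|bern n g u| <= M.
Proof.
move=> u01 gM; rewrite ler_norml; apply/andP; split.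
  rewrite -(bern_cst n (- M) u); apply: le_bern => // j jn.
  by have := gM j jn; rewrite ler_norml => /andP[].
rewrite -(bern_cst n M u); apply: le_bern => // j jn.
by have := gM j jn; rewrite ler_norml => /andP[].
Qed.

(** Variance of S/n for S binomial with parameters n and u. *)
Lemma bern_var n u : (0 < n)%N ->
  bern n (fun j => (j%:R / n%:R - u) ^+ 2) u = u * (1 - u) / n%:R.
Proof.
move=> n0; have n0R : n%:R != 0 :> R by rewrite pnatr_eq0 -lt0n.
rewrite (_ : (fun _ => _) = (fun j => (n%:R^-1 ^+ 2 * j%:R ^+ 2 +
   (- 2 * u / n%:R) * j%:R) + u ^+ 2)); last first.
  by apply/funext => j; field.
rewrite bernD (bernD n (fun j => n%:R^-1 ^+ 2 * j%:R ^+ 2)) bern_cst !bernZ.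
by rewrite bern_sqr bern_id; field.
Qed.

(* Chebyshev's argument for the binomial law. *)
Lemma bern_dev n g u c e K : (0 < n)%N -> 0 <= u <= 1 -> 0 <= K ->
  (forall j, (j <= n)%N -> `|g j - c| <= e + K * (j%:R / n%:R - u) ^+ 2) ->
  `|bern n g u - c| <= e + K / n%:R.
Proof.
move=> n0 u01 K0 h.
have n0R : 0 < n%:R :> R by rewrite ltr0n.
have -> : bern n g u - c = bern n (fun j => g j - c) u.
  by rewrite (bernD n g (fun=> - c)) bern_cst.
have B : bern n (fun j => e + K * (j%:R / n%:R - u) ^+ 2) u <= e + K / n%:R.
  rewrite (bernD n (fun=> e)) bern_cst bernZ bern_var// lerD2l mulrA.
  rewrite ler_pM2r ?invr_gt0// -[leRHS]mulr1 ler_wpM2l//.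
  by case/andP: u01 => u0 u1; nra.
rewrite ler_norml; apply/andP; split; last first.
  apply: le_trans B; apply: le_bern => // j jn.
  by have := h j jn; rewrite ler_norml => /andP[].
rewrite lerNl; apply: le_trans B.
rewrite -mulN1r -bernZ; apply: le_bern => // j jn.
by have := h j jn; rewrite ler_norml mulN1r lerNl => /andP[].
Qed.

End Bernstein.

(** * Bernstein sums at arcsine nodes *)

Section SineNodes.
Context {R : realType}.

(** The sine is flat near the ends of [-pi/2, pi/2], where [a] may lie. But [b] and [b + d] stay in
    [-1, 1], where the derivative is at least [cos 1], and monotonicity carries the gap from [b + d]
    on to [a]. *)
Lemma sin_incr_gap (a b d : R) : `|b| <= 1 / 2 -> 0 <= d -> d <= 1 / 2 ->
  - (pi / 2) <= a <= pi / 2 -> d <= a - b -> cos 1 * d <= sin a - sin b.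
Proof.
move=> b2 d0 d2 a2 dab.
have pi1 := pihalf_ge1 R; have pi2 := pi_ge2 R.
move: b2; rewrite ler_norml => /andP[b1 b2].
have bd : sin (b + d) <= sin a.
  have : b + d <= a by lra.
  rewrite le_eqVlt => /predU1P[->//|bda].
  rewrite ltW// ltr_sin// in_itv/=; apply/andP; split; lra.
apply: (@le_trans _ _ (sin (b + d) - sin b)); last by rewrite lerD2r.
have [c cbd ->] := @MVT_segment _ sin cos b (b + d) ltac:(lra)
  (fun x _ => is_derive_sin x) ltac:(exact: continuous_subspaceT (@continuous_sin R)).
rewrite addrAC subrr add0r ler_wpM2r//.
move: cbd; rewrite in_itv/= => /andP[bc cb].
rewrite -(cos_norm c).
have c1 : `|c| <= 1 by rewrite ler_norml; apply/andP; split; lra.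
move: c1; rewrite le_eqVlt => /predU1P[->//|c1].
rewrite ltW// ltr_cos// in_itv/= ?normr_ge0/=; lra.
Qed.

Lemma sin_gap (a b d : R) : `|b| <= 1 / 2 -> 0 <= d -> d <= 1 / 2 ->
  - (pi / 2) <= a <= pi / 2 -> d <= `|a - b| -> cos 1 * d <= `|sin a - sin b|.
Proof.
move=> b2 d0 d2 /andP[a1 a2]; rewrite ler_normr => /orP[dab|dab].
  by rewrite ler_normr (sin_incr_gap b2)// a1 a2.
rewrite ler_normr; apply/orP; right.
have := @sin_incr_gap (- a) (- b) d; rewrite normrN !sinN.
rewrite (_ : - sin a - - sin b = - (sin a - sin b)); last by ring.
rewrite (_ : - a - - b = - (a - b)); last by ring.
by apply => //; apply/andP; split; lra.
Qed.

Definition node (s : R) (n j : nat) : R := s * asin (2 * (j%:R / n%:R) - 1).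

Definition sinu (s y : R) : R := (1 + sin (y / s)) / 2.

Lemma sinu01 s y : 0 <= sinu s y <= 1.
Proof.
rewrite /sinu; have := sin_max (y / s); rewrite ler_norml => /andP[a b].
by apply/andP; split; lra.
Qed.

Lemma node_range (n j : nat) : (0 < n)%N -> (j <= n)%N ->
  -1 <= (2 * (j%:R / n%:R) - 1 : R) <= 1.
Proof.
move=> n0 jn; have n0R : 0 < n%:R :> R by rewrite ltr0n.
have h1 : j%:R / n%:R <= 1 :> R by rewrite ler_pdivrMr// mul1r ler_nat.
have h0 : 0 <= j%:R / n%:R :> R by rewrite divr_ge0.
by apply/andP; split; lra.
Qed.

Lemma sinu_node (s : R) n j : s != 0 -> (0 < n)%N -> (j <= n)%N ->
  sinu s (node s n j) = j%:R / n%:R.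
Proof.
move=> s0 n0 jn; rewrite /sinu /node mulrAC divff// mul1r asinK; first by field; rewrite pnatr_eq0 -lt0n.
by rewrite in_itv/=; exact: node_range.
Qed.

(** A node at distance at least [d] from [y] has [|j / n - sinu s y|] at least [cos 1 * d / (2 * s)]
    by [sin_gap], so the trivial bound [2 * M] is at most [8 * M * s ^+ 2 / (cos 1 * d) ^+ 2] times
    the squared deviation, as [bern_dev] wants. All nodes lie within one half-period of the sine, so
    its periodicity does no harm. *)
Lemma node_bern_dev (g : R -> R) (M s : R) n (y d e : R) :
  0 < s -> (0 < n)%N -> `|y| <= s / 2 -> 0 < d -> d <= s / 2 -> 0 <= e ->
  (forall x, `|g x| <= M) ->
  (forall x, `|x - y| < d -> `|g x - g y| <= e) ->
  `|bern n (fun j => g (node s n j)) (sinu s y) - g y| <=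
     e + (8 * M * s ^+ 2 / (cos 1 * d) ^+ 2) / n%:R.
Proof.
move=> s0 n0 ys d0 ds e0 gM gd.
have c0 := cos1_gt0 R.
have M0 : 0 <= M by exact: le_trans (gM 0).
have sd : 0 < s ^+ 2 by rewrite exprn_gt0.
have cd : 0 < (cos 1 * d) ^+ 2 by rewrite exprn_gt0// mulr_gt0.
have K0 : 0 <= 8 * M * s ^+ 2 / (cos 1 * d) ^+ 2 by rewrite divr_ge0 ?(ltW cd)// mulr_ge0 ?(ltW sd)// mulr_ge0.
apply: bern_dev => //; first exact: sinu01.
move=> j jn.
have [lt|ge] := ltP `|node s n j - y| d.
  by rewrite (le_trans (gd _ lt))// lerDl mulr_ge0// sqr_ge0.
have h2M : `|g (node s n j) - g y| <= 2 * M.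
  by rewrite (le_trans (ler_normB _ _))// mulr_natl mulr2n lerD.
apply: le_trans h2M _; apply: ler_wpDl => //.
suff h : cos 1 * (d / s) <= 2 * `|j%:R / n%:R - sinu s y|.
  have h' : (cos 1 * (d / s)) ^+ 2 <= 4 * (j%:R / n%:R - sinu s y) ^+ 2.
    rewrite -(real_normK (num_real (_ - _))).
    have -> : 4 * `|j%:R / n%:R - sinu s y| ^+ 2 = (2 * `|j%:R / n%:R - sinu s y|) ^+ 2 by ring.
    have cds : 0 <= cos 1 * (d / s) by rewrite ltW// mulr_gt0// divr_gt0.
    by rewrite lerXn2r// nnegrE// (le_trans cds).
  have -> : 2 * M = (8 * M * s ^+ 2 / (cos 1 * d) ^+ 2) * ((cos 1 * (d / s)) ^+ 2 / 4).
    by field; rewrite !gt_eqF.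
  by apply: ler_wpM2l => //; lra.
rewrite -(@sinu_node s n j) ?gt_eqF// /sinu.
rewrite -mulrBl opprD addrACA subrr add0r normrM (@ger0_norm _ 2^-1)//.
rewrite [leRHS]mulrC divfK//.
have ns : node s n j / s = asin (2 * (j%:R / n%:R) - 1).
  by rewrite /node mulrAC divff ?gt_eqF// mul1r.
apply: sin_gap.
- by rewrite normrM normfV (gtr0_norm s0) ler_pdivrMr// mulrC mulrA mulr1.
- by rewrite divr_ge0// ltW.
- by rewrite ler_pdivrMr// mulrC mulrA mulr1.
- by rewrite ns asin_geNpi2 ?asin_lepi2// node_range.
- by rewrite -mulrBl normrM normfV (gtr0_norm s0) ler_pM2r// invr_gt0.
Qed.

End SineNodes.
(** Heine's theorem, from the near-covering form of compactness: each point supplies a radius, and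
    half of it serves its neighbours. *)
Lemma segment_unif_continuous {R : realType} (g : R -> R) (a b e : R) :
  {within `[a, b], continuous g} -> 0 < e ->
  exists2 d : R, 0 < d & forall x y, a <= x <= b -> a <= y <= b ->
    `|x - y| < d -> `|g x - g y| <= e.
Proof.
move=> cg e0.
have /compact_near_coveringP ncov : compact `[a, b] by exact: segment_compact.
pose Q (d y : R) : Prop := a <= y <= b -> forall x, a <= x <= b -> `|x - y| < d -> `|g x - g y| <= e.
have : \forall d \near (0 : R)^'+, `[a, b] `<=` Q d.
  apply: ncov => y0 y0ab.
  have /subspace_continuousP/(_ _ y0ab)/cvgrPdist_le/(_ (e / 2)) := cg.
  rewrite divr_gt0// => /(_ isT).
  rewrite nearE /within/= => /nbhs_ballP[r /= r0 hr].
  exists (ball y0 (r / 2), [set d | 0 < d < r / 2]) => /=.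
    split; first by apply: nbhsx_ballx; rewrite divr_gt0.
    near=> d; apply/andP; split; first by near: d; exact: nbhs_right_gt.
    by near: d; apply: nbhs_right_lt; rewrite divr_gt0.
  move=> -[y d] /= [yb /andP[d0 dr]] yab x xab xy.
  have hy : `|g y0 - g y| <= e / 2.
    apply: (hr y); last by rewrite in_itv.
    by apply: lt_trans yb _; lra.
  have hx : `|g y0 - g x| <= e / 2.
    apply: (hr x); last by rewrite in_itv.
    rewrite /ball/= (_ : y0 - x = (y0 - y) - (x - y)); last by ring.
    apply: (le_lt_trans (ler_normB _ _)).
    by rewrite /ball/= in yb; lra.
  rewrite (_ : g x - g y = (g y0 - g y) - (g y0 - g x)); last by ring.
  by apply: (le_trans (ler_normB _ _)); lra.
move=> h.
have : \forall d \near (0 : R)^'+, 0 < d /\ `[a, b] `<=` Q d.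
  by near=> d; split; near: d => //; exact: nbhs_right_gt.
move=> /filter_ex[d [d0 hQ]].
exists d => // x y xab yab xy; exact: (hQ y).
Unshelve. all: by end_near. Qed.

Section TrigApprox.
Context {R : realType}.
Implicit Types g : R -> R.

(* [sinu s] maps [node s n j] to [j / n], so this Bernstein sum in [sinu s y] is a
   trigonometric polynomial in [y] sampling [g]; as [s] grows the nodes fill the line. *)
Definition trigapx (n : nat) g (y : R) : R :=
  bern (n.+1 ^ 3) (fun j => g (node n.+1%:R (n.+1 ^ 3) j)) (sinu n.+1%:R y).

(** Why the degree is a cube: the error of [node_bern_dev] is a constant times s^2 over the degree,
    which is 1/(n+1) for s = n+1 and degree (n+1)^3. *)
Lemma trigapx_unif g (M K e : R) : (forall x, `|g x| <= M) -> continuous g ->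
  0 < e ->
  \forall n \near \oo, forall y, `|y| <= K -> `|trigapx n g y - g y| <= e.
Proof.
move=> gM cg e0.
have e20 : 0 < e / 2 by rewrite divr_gt0.
(* The interval is enlarged by 1 and the modulus capped at 1, so that points close to [-K, K] remain
   inside. *)
have [d0 d00 hd0] := @segment_unif_continuous R g (- (K + 1)) (K + 1) (e / 2)
   ltac:(exact: continuous_subspaceT) e20.
pose d := Num.min d0 1.
have dgt0 : 0 < d by rewrite lt_min d00/=.
have c0 := cos1_gt0 R.
have cd0 : 0 < (cos 1 * d) ^+ 2 by rewrite exprn_gt0// mulr_gt0.
near=> n => y yK.
have s0 : 0 < n.+1%:R :> R by rewrite ltr0n.
have lbn (x : R) : x <= n%:R -> x <= n.+1%:R by move=> h; rewrite (le_trans h)// ler_nat.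
have h := @node_bern_dev R g M n.+1%:R (n.+1 ^ 3) y d (e / 2) s0.
apply: le_trans (h _ _ dgt0 _ _ gM _) _.
- by rewrite expn_gt0.
- rewrite (le_trans yK)// ler_pdivlMr// lbn//.
  by near: n; exact: nbhs_infty_ger.
- rewrite ler_pdivlMr// lbn//.
  by near: n; exact: nbhs_infty_ger.
- exact: ltW.
- move=> x; rewrite lt_min => /andP[xd0 xd1].
  move: yK; rewrite ler_norml => /andP[y1 y2].
  move: (xd1); rewrite ltr_norml => /andP[x1 x2].
  by apply: hd0 => //; apply/andP; split; lra.
rewrite natrX (_ : _ / _ / _ = (8 * M / (cos 1 * d) ^+ 2) / n.+1%:R); last first.
  by field; rewrite ?gt_eqF.
rewrite [leRHS]splitr lerD2l ler_pdivrMr// [leRHS]mulrC -ler_pdivrMr// lbn//.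
by near: n; exact: nbhs_infty_ger.
Unshelve. all: by end_near. Qed.

Lemma trigapx_cvg g (M : R) y : (forall x, `|g x| <= M) -> continuous g ->
  trigapx n g y @[n --> \oo] --> g y.
Proof.
move=> gM cg; apply/cvgrPdist_le => e e0.
move: (@trigapx_unif g M `|y| e gM cg e0); apply: filterS => n /(_ y (lexx _)).
by rewrite distrC.
Qed.

Lemma trigapx_norm n g (M y : R) : (forall x, `|g x| <= M) -> `|trigapx n g y| <= M.
Proof. by move=> gM; apply: bern_norm => //; exact: sinu01. Qed.

(** Bernstein's proof of the Weierstrass theorem: at a node with [|T * (j / n) - t|] at least [d],
    the bound [2 * M] is absorbed by [2 * M / (d / T) ^+ 2] times the squared deviation of [j / n]
    from [t / T]. *)
Lemma bern_segment_unif g (T e : R) : 0 < T -> {within `[0, T], continuous g} ->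
  0 < e -> \forall n \near \oo, forall t, 0 <= t <= T ->
    `|bern n (fun j => g (T * (j%:R / n%:R))) (t / T) - g t| <= e.
Proof.
move=> T0 cg e0; have e20 : 0 < e / 2 by rewrite divr_gt0.
have [d d0 hd] := segment_unif_continuous cg e20.
have [M M0 gM] : exists2 M : R, 0 <= M & forall t : R, 0 <= t <= T -> `|g t| <= M.
  have [M [_ hM]] := compact_bounded (continuous_compact cg (@segment_compact R 0 T)).
  exists `|M + 1| => // t tT.
  apply: le_trans (ler_norm _); apply: (hM (M + 1)); first by rewrite ltrDl.
  by exists t => //=; rewrite in_itv.
have dT : 0 < d / T by rewrite divr_gt0.
near=> n => t /andP[t0 tT].
have n0 : (0 < n)%N by near: n; exact: nbhs_infty_gt.
have n0R : 0 < n%:R :> R by rewrite ltr0n.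
have u01 : 0 <= t / T <= 1 by rewrite divr_ge0 ?(ltW T0)//= ler_pdivrMr// mul1r.
have K0 : 0 <= 2 * M / (d / T) ^+ 2 
  by apply: divr_ge0; [exact: mulr_ge0|exact: sqr_ge0].
apply: (@le_trans _ _ (e / 2 + (2 * M / (d / T) ^+ 2) / n%:R)).
  apply: bern_dev => // j jn.
  have jn01 : 0 <= (j%:R / n%:R : R) <= 1.
    by rewrite divr_ge0//= ler_pdivrMr// mul1r ler_nat.
  have jT : 0 <= T * (j%:R / n%:R) <= T.
    by case/andP: jn01 => a b; apply/andP; split; nra.
  have [lt|ge] := ltP `|T * (j%:R / n%:R) - t| d.
    rewrite (le_trans (hd _ _ jT _ lt)) ?t0//.
    by rewrite lerDl mulr_ge0// sqr_ge0.
  have h2M : `|g (T * (j%:R / n%:R)) - g t| <= 2 * M.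
    have g1 := gM _ jT; have g2 := gM t ltac:(by rewrite t0).
    by apply: (le_trans (ler_normB _ _)); lra.
  apply: le_trans h2M _; apply: ler_wpDl; first exact: ltW.
  rewrite mulrAC ler_pdivlMr ?exprn_gt0// ler_wpM2l ?mulr_ge0//.
  rewrite -[leRHS]real_normK ?num_real// lerXn2r ?nnegrE ?(ltW dT) ?normr_ge0//.
  rewrite ler_pdivrMr//; apply: le_trans ge _.
  rewrite [leRHS](_ : _ = `|(j%:R / n%:R - t / T) * T|); last first.
    by rewrite normrM (gtr0_norm T0).
  by rewrite mulrBl divfK ?gt_eqF// [X in _ <= `|X - _|]mulrC.
rewrite [leRHS]splitr lerD2l ler_pdivrMr// [leRHS]mulrC -ler_pdivrMr//.
by near: n; exact: nbhs_infty_ger.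
Unshelve. all: by end_near. Qed.

Lemma continuous_bern n (g : nat -> R -> R) (u : R -> R) :
  (forall j, continuous (g j)) -> continuous u ->
  continuous (fun x => bern n (fun j => g j x) (u x)).
Proof.
move=> + cu; elim: n g => [|n IH] g cg x /=; first exact: cg.
apply: cvgD; apply: cvgM.
- exact: cu.
- by apply: (IH (fun j => g j.+1)) => j; exact: cg.
- by apply: cvgB; [exact: cvg_cst|exact: cu].
- exact: IH.
Qed.

End TrigApprox.

(** * Gaussian integrals *)

Section RintegralTools.
Context d (T : measurableType d) (R : realType) (mu : {measure set T -> \bar R}).
Variable D : set T.
Hypothesis mD : measurable D.

Lemma integrable_le (f g : T -> R) : measurable_fun D f ->
  mu.-integrable D (EFin \o g) -> (forall x, D x -> `|f x| <= g x) ->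
  mu.-integrable D (EFin \o f).
Proof.
move=> mf ig fg; apply: (le_integrable mD _ _ ig).
  exact/measurable_EFinP.
by move=> x Dx /=; rewrite lee_fin (le_trans (fg x Dx))// ler_norm.
Qed.

Lemma Rintegral_dct (f_ : nat -> T -> R) (f g : T -> R) :
  (forall n, measurable_fun D (f_ n)) ->
  (forall x, D x -> f_ n x @[n --> \oo] --> f x) ->
  mu.-integrable D (EFin \o g) ->
  (forall n x, D x -> `|f_ n x| <= g x) ->
  mu.-integrable D (EFin \o f) /\
  Rintegral mu D (f_ n) @[n --> \oo] --> Rintegral mu D f.
Proof.
move=> mf cf ig fg.
have mf' : measurable_fun D f.
  by apply: measurable_fun_cvg cf => n.
have cfE x : D x -> (f_ n x)%:E @[n --> \oo] --> (f x)%:E.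
  by move=> Dx; apply: cvg_EFin; [exact: nearW|exact: cf].
have [i_f _ cvg_f] := @dominated_convergence _ _ _ mu D mD
  (fun n x => (f_ n x)%:E) (EFin \o f) (EFin \o g)
  (fun n => iffRL (measurable_EFinP _ _) (mf n))
  (iffRL (measurable_EFinP _ _) mf')
  (aeW _ cfE) ig (aeW _ (fun x n Dx => fg n x Dx)).
split => //; rewrite /Rintegral.
apply: (@fine_cvg _ _ _ _ (fun n => \int[mu]_(x in D) (f_ n x)%:E)%E).
by rewrite fineK//; exact: integrable_fin_num.
Qed.

Lemma le_Rintegral_abs (f g : T -> R) :
  mu.-integrable D (EFin \o f) -> mu.-integrable D (EFin \o g) ->
  (forall x, D x -> `|f x| <= g x) ->
  `|Rintegral mu D f| <= Rintegral mu D g.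
Proof.
move=> i_f ig fg; apply: (le_trans (le_normr_Rintegral mD i_f)).
by apply: le_Rintegral => //; exact: integrable_norm.
Qed.

End RintegralTools.

Section ProbabilityTools.
Context d (T : measurableType d) (R : realType) (P : probability T R).

Lemma integrable_bounded (f : T -> R) (M : R) : measurable_fun setT f ->
  (forall x, `|f x| <= M) -> P.-integrable setT (EFin \o f).
Proof.
move=> mf fM; apply: (@integrable_le _ _ _ P setT measurableT _ (cst M)) => //.
exact: finite_measure_integrable_cst.
Qed.

Lemma Rintegral_prob_cst (c : R) : Rintegral P setT (fun=> c) = c.
Proof. by rewrite Rintegral_cst//= -[fine _]/(fine (P setT)) probability_setT mulr1. Qed.

Lemma Rintegral_bdct (f_ : nat -> T -> R) (f : T -> R) (M : R) :
  (forall n, measurable_fun setT (f_ n)) ->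
  (forall x, f_ n x @[n --> \oo] --> f x) ->
  (forall n x, `|f_ n x| <= M) ->
  Rintegral P setT (f_ n) @[n --> \oo] --> Rintegral P setT f.
Proof.
move=> mf cf fM.
have [] := @Rintegral_dct _ _ _ P setT measurableT f_ f (cst M) mf
  (fun x _ => cf x) (finite_measure_integrable_cst _ _ measurableT) (fun n x _ => fM n x).
by [].
Qed.

End ProbabilityTools.

Section GaussianIntegrals.
Context {R : realType}.
Variable s : R.
Hypothesis s0 : 0 < s.
Local Notation N := (normal_prob 0 s).
Local Notation leb := (@lebesgue_measure R).
Local Notation pdf := (normal_pdf 0 s).

Let sn0 : s != 0. Proof. by rewrite gt_eqF. Qed.

(** The Radon-Nikodym derivative of the law and its explicit density have the same integral over
    every measurable set, hence agree almost everywhere. *)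
Lemma ge0_integral_normal (f : measurableTypeR R -> \bar R) : (forall x, 0 <= f x)%E ->
  measurable_fun setT f ->
  (\int[N]_x f x = \int[leb]_x (f x * (pdf x)%:E))%E.
Proof.
move=> f0 mf.
have dom := @normal_prob_dominates R 0 s.
rewrite -(Radon_Nikodym_SigmaFinite.change_of_variables dom f0)//.
have mrn : measurable_fun setT (Radon_Nikodym_SigmaFinite.f N leb).
  by have /integrableP[] := Radon_Nikodym_SigmaFinite.f_integrable dom.
have mpdf : measurable_fun setT (fun x => (pdf x)%:E).
  by apply/measurable_EFinP; exact: measurable_normal_pdf.
apply: ge0_ae_eq_integral => //.
- by apply: emeasurable_funM => //; exact: mrn.
- exact: emeasurable_funM.
- by move=> x _; rewrite mule_ge0// Radon_Nikodym_SigmaFinite.f_ge0.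
- by move=> x _; rewrite mule_ge0// lee_fin normal_pdf_ge0.
apply: ae_eqe_mul2l; apply: integral_ae_eq => //.
- exact: Radon_Nikodym_SigmaFinite.f_integrable.
- by move=> E _ mE; rewrite -Radon_Nikodym_SigmaFinite.f_integral.
Qed.

Lemma integrable_normal (f : R -> R) : measurable_fun setT f ->
  leb.-integrable setT (fun x => (f x * pdf x)%:E) ->
  N.-integrable setT (EFin \o f).
Proof.
move=> mf /integrableP[_ h]; apply/integrableP; split; first exact/measurable_EFinP.
rewrite ge0_integral_normal//; last first.
  by apply: measurableT_comp => //; exact/measurable_EFinP.
apply: le_lt_trans h; rewrite le_eqVlt; apply/orP; left; apply/eqP.
apply: eq_integral => x _ /=.
by rewrite normrM (ger0_norm (normal_pdf_ge0 _ _ _)) EFinM.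
Qed.

Lemma Rintegral_normal (f : R -> R) : measurable_fun setT f ->
  leb.-integrable setT (fun x => (f x * pdf x)%:E) ->
  Rintegral N setT f = Rintegral leb setT (fun x => f x * pdf x).
Proof.
move=> mf i_f.
have iN := integrable_normal mf i_f.
rewrite /Rintegral; congr fine.
rewrite [LHS]integralE [RHS]integralE; congr (_ - _)%E.
  rewrite ge0_integral_normal//; last first.
    by apply: measurable_funepos; exact/measurable_EFinP.
  apply: eq_integral => x _.
  rewrite !funeposE/= -!EFin_max -EFinM maxr_pMl ?normal_pdf_ge0// mul0r.
  by [].
rewrite ge0_integral_normal//; last first.
  by apply: measurable_funeneg; exact/measurable_EFinP.
apply: eq_integral => x _.
rewrite !funenegE/= -!EFin_max -EFinM maxr_pMl ?normal_pdf_ge0// mul0r.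
by rewrite mulNr.
Qed.

End GaussianIntegrals.

Section NormalDensity.
Context {R : realType}.
Variable s : R.
Hypothesis s0 : 0 < s.
Local Notation N := (normal_prob 0 s).
Local Notation leb := (@lebesgue_measure R).
Local Notation pdf := (normal_pdf 0 s).

Let sn0 : s != 0. Proof. by rewrite gt_eqF. Qed.

Lemma normal_pdf_expR x : pdf x = normal_peak s * expR (- (x ^+ 2 / (s ^+ 2 *+ 2))).
Proof. by rewrite normal_pdfE// /normal_fun subr0 mulNr. Qed.

(** From t <= exp t at t = x^2 / (2 s^2). It makes the boundary terms vanish in the integration by
    parts behind Stein's identity. *)
Lemma normal_pdf_le_inv (x : R) : pdf x * x ^+ 2 <= normal_peak s * (2 * s ^+ 2).
Proof.
rewrite normal_pdf_expR -mulrA ler_wpM2l ?normal_peak_ge0//.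
rewrite expRN mulrC ler_pdivrMr ?expR_gt0//.
have -> : x ^+ 2 / (s ^+ 2 *+ 2) = x ^+ 2 / (2 * s ^+ 2) by rewrite -[s ^+ 2 *+ 2]mulr_natl.
have h := expR_ge1Dx (x ^+ 2 / (2 * s ^+ 2)).
have c0 : 0 < 2 * s ^+ 2 by rewrite mulr_gt0// exprn_gt0.
rewrite mulrC -ler_pdivrMr//; lra.
Qed.

End NormalDensity.

(** * Stein's identity, moments and cosine transform of the normal law *)

Section GaussianMoments.
Context {R : realType}.
Variable s : R.
Hypothesis s0 : 0 < s.
Local Notation N := (normal_prob 0 s).
Local Notation leb := (@lebesgue_measure R).
Local Notation pdf := (normal_pdf 0 s).

Let sn0 : s != 0. Proof. by rewrite gt_eqF. Qed.

Lemma is_derive_normal_pdf (x : R) : is_derive x 1 (pdf : R -> R) (- (x / s ^+ 2) * pdf x).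
Proof.
have h : is_derive x 1 (fun x : R => - (x ^+ 2 / (s ^+ 2 *+ 2))) (- (x / s ^+ 2)).
  rewrite (_ : (fun x : R => _) = (- (s ^+ 2 *+ 2)^-1) *: (@GRing.exp R ^~ 2%N)); last first.
    by apply/funext => y; rewrite /= fctE/= /GRing.scale/= mulNr mulrC.
  apply: is_derive_eq; rewrite /GRing.scale/= mulr1.
  by rewrite -[s ^+ 2 *+ 2]mulr_natr; field.
have h2 := @is_derive1_comp _ expR _ x _ _ (is_derive_expR _) h.
have := @is_deriveZ _ _ _ _ (normal_peak s) x 1 _ h2.
rewrite (_ : normal_peak s \*: _ = pdf); last first.
  by apply/funext => y; rewrite (normal_pdf_expR s0).
move=> h3; apply: is_derive_eq; rewrite /GRing.scale/= (normal_pdf_expR s0); ring.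
Qed.

Let s2 := Num.sqrt 2 * s.

Let s20 : 0 < s2. Proof. by rewrite mulr_gt0// sqrtr_gt0. Qed.

(** With y = x^2 / (4 s^2) the density is proportional to exp(-y) exp(-y). One factor absorbs the
    polynomial, since x^4 = 16 s^4 y^2 and y^2 <= 2 exp y; the other is, up to its peak, the density
    of standard deviation [s2]. *)
Lemma normal_pdf_poly4 : exists2 K : R, 0 <= K &
  forall x, (1 + x ^+ 4) * pdf x <= K * normal_pdf 0 s2 x.
Proof.
exists (normal_peak s * (1 + 32 * s ^+ 4) / normal_peak s2).
  rewrite divr_ge0 ?normal_peak_ge0// mulr_ge0 ?normal_peak_ge0//.
  by rewrite addr_ge0// mulr_ge0// exprn_even_ge0.
move=> x; rewrite (normal_pdf_expR s0) normal_pdfE ?gt_eqF// /normal_fun subr0.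
rewrite [leRHS]mulrA divfK ?gt_eqF ?normal_peak_gt0 ?gt_eqF//.
have -> : s2 ^+ 2 *+ 2 = 4 * s ^+ 2.
  by rewrite /s2 exprMn sqr_sqrtr// -mulr_natr; ring.
set y := x ^+ 2 / (4 * s ^+ 2).
have y0 : 0 <= y.
  by apply: divr_ge0; [exact: sqr_ge0|apply: mulr_ge0 => //; exact: sqr_ge0].
have -> : - x ^+ 2 / (4 * s ^+ 2) = - y by rewrite mulNr.
have -> : x ^+ 2 / (s ^+ 2 *+ 2) = y + y.
  by rewrite /y -mulr_natr; field.
have -> : x ^+ 4 = 16 * s ^+ 4 * y ^+ 2 by rewrite /y; field.
rewrite opprD expRD.
rewrite [leLHS](_ : _ = normal_peak s * ((1 + 16 * s ^+ 4 * y ^+ 2) * expR (- y) * expR (- y))); last by ring.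
rewrite -[leRHS]mulrA ler_wpM2l ?normal_peak_ge0// ler_wpM2r ?expR_ge0//.
rewrite expRN ler_pdivrMr ?expR_gt0//.
have := expR_ge1Dx y => e1.
have := expR_ge1Dxn 1 y0; rewrite (_ : (2`!)%:R = 2)// => e2.
have s4 : 0 <= s ^+ 4 by rewrite exprn_even_ge0.
have : 0 <= s ^+ 4 * (2 * expR y - y ^+ 2) by rewrite mulr_ge0//; lra.
lra.
Qed.

Lemma normal_poly4_leb (f : R -> R) (C : R) : measurable_fun setT f ->
  (forall x, `|f x| <= C * (1 + x ^+ 4)) ->
  leb.-integrable setT (fun x => (f x * pdf x)%:E).
Proof.
move=> mf fC.
have [K K0 hK] := normal_pdf_poly4.
have C0 : 0 <= C.
  by have := le_trans (normr_ge0 _) (fC 0); rewrite expr0n/= addr0 mulr1.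
have iK : leb.-integrable setT (EFin \o (fun x => C * K * normal_pdf 0 s2 x)).
  have := integrableZl measurableT (C * K) (integrable_normal_pdf 0 s2).
  by apply: eq_integrable.
apply: (@integrable_le _ _ _ leb setT measurableT (fun x => f x * pdf x) _ _ iK).
  by apply: measurable_funM => //; exact: measurable_normal_pdf.
move=> x _; rewrite normrM (ger0_norm (normal_pdf_ge0 _ _ _)).
apply: (le_trans (ler_wpM2r (normal_pdf_ge0 _ _ _) (fC x))).
by rewrite -!mulrA ler_wpM2l.
Qed.

Lemma normal_poly4_integrable (f : R -> R) (C : R) : measurable_fun setT f ->
  (forall x, `|f x| <= C * (1 + x ^+ 4)) -> N.-integrable setT (EFin \o f).
Proof.
by move=> mf fC; apply: integrable_normal => //; exact: normal_poly4_leb fC.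
Qed.

(* Stein's identity: [x g - s^2 g'] times the density is the derivative of [- s^2 g] times the density. *)
Lemma normal_stein (g g' : R -> R) (C : R) :
  (forall x : R, is_derive x 1 g (g' x)) -> continuous g' ->
  (forall x, `|g x| <= C * (1 + x ^+ 4)) ->
  (forall x, `|g' x| <= C * (1 + x ^+ 4)) ->
  (forall x, `|x * g x| <= C * (1 + x ^+ 4)) ->
  Rintegral N setT (fun x => x * g x) = s ^+ 2 * Rintegral N setT g'.
Proof.
move=> dg cg' gC g'C xgC.
have cg : continuous g.
  by move=> x; apply: differentiable_continuous; apply/derivable1_diffP; case: (dg x).
have mg : measurable_fun setT g by exact: continuous_measurable_fun.
have mg' : measurable_fun setT g' by exact: continuous_measurable_fun.
have mxg : measurable_fun setT (fun x : R => x * g x) by exact: measurable_funM.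
have i1 := normal_poly4_leb mxg xgC; have i2 := normal_poly4_leb mg' g'C.
rewrite !Rintegral_normal//.
pose f x := x * g x * pdf x - s ^+ 2 * (g' x * pdf x).
have i2' : leb.-integrable setT (EFin \o (fun x => s ^+ 2 * (g' x * pdf x))).
  have := integrableZl measurableT (s ^+ 2) i2.
  by apply: eq_integrable.
suff : Rintegral leb setT f = 0.
  rewrite /f RintegralB// RintegralZl// => /eqP; rewrite subr_eq0 => /eqP; exact.
have i_f : leb.-integrable setT (EFin \o f).
  have := integrableB measurableT i1 i2'.
  by apply: eq_integrable.
pose F := (fun x => - s ^+ 2 * (g x * pdf x)).
have dF (x : R) : is_derive x 1 F (f x).
  have h := @is_deriveM _ _ _ _ x 1 _ _ (dg x) (is_derive_normal_pdf x).
  have := @is_deriveZ _ _ _ _ (- s ^+ 2) x 1 _ h.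
  move=> h3; apply: is_derive_eq; rewrite /f /GRing.scale/=; field.
  exact: sn0.
have cpdf : continuous (pdf : R -> R) by exact: continuous_normal_pdf.
have cf : continuous f.
  move=> x; apply: cvgB; apply: cvgM.
  - by apply: cvgM; [exact: cvg_id|exact: cg].
  - exact: cpdf.
  - exact: cvg_cst.
  - by apply: cvgM; [exact: cg'|exact: cpdf].
have cF : continuous F.
  move=> x; apply: cvgM; first exact: cvg_cst.
  by apply: cvgM; [exact: cg|exact: cpdf].
(* On growing symmetric segments the integral of [f] is an increment of [F], which is O(1/n), while
   it also tends to the integral over the line. *)
have fin n : Rintegral leb `[- n.+1%:R, n.+1%:R] f = F n.+1%:R - F (- n.+1%:R).
  rewrite /Rintegral (@continuous_FTC2 _ f F)//.
  - by rewrite (@lt_trans _ _ 0)// oppr_lt0.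
  - exact: continuous_subspaceT.
  - split.
    + by move=> x _; case: (dF x).
    + exact: cvg_at_right_filter (cF _).
    + exact: cvg_at_left_filter (cF _).
  - by move=> x _; rewrite derive1E; case: (dF x).
have [K K0 hK] := normal_pdf_poly4.
have C0 : 0 <= C.
  by have := le_trans (normr_ge0 _) (gC 0); rewrite expr0n/= addr0 mulr1.
have [||||_ h1] := @Rintegral_dct _ _ _ leb setT measurableT
  (fun n => f \_ `[- n.+1%:R, n.+1%:R]) f (fun x => `|f x|) _ _ _ _.
- move=> n; apply: (iffLR (measurable_restrictT _ _)) => //.
  by apply: measurable_funTS; exact: continuous_measurable_fun.
- move=> x _; apply: cvg_near_cst; near=> n; rewrite patchE ifT//.
  have xn : `|x| <= n%:R by near: n; exact: nbhs_infty_ger.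
  rewrite inE/= in_itv/= -ler_norml (le_trans xn)// ler_nat//.
- exact: integrable_norm.
- by move=> n x _; rewrite patchE; case: ifP => // _; rewrite normr0.
have [q qE] : exists q, q = normal_peak s2 * (2 * s2 ^+ 2) by eexists.
pose A := C * (K * q).
have Fb n (x : R) : x ^+ 2 = n.+1%:R ^+ 2 -> `|F x| <= s ^+ 2 * (A / n.+1%:R).
  move=> xn; rewrite /F normrM normrN (ger0_norm (sqr_ge0 s)) ler_wpM2l ?sqr_ge0//.
  rewrite normrM (ger0_norm (normal_pdf_ge0 _ _ _)).
  apply: (le_trans (ler_wpM2r (normal_pdf_ge0 _ _ _) (gC x))).
  rewrite /A -!mulrA ler_wpM2l//; apply: (le_trans (hK x)).
  rewrite ler_wpM2l// ler_pdivlMr// qE (le_trans _ (normal_pdf_le_inv s20 x))// ler_wpM2l ?normal_pdf_ge0//.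
  by rewrite xn expr2 ler_peMl// ler1n.
have cF0 n : `|F n.+1%:R - F (- n.+1%:R)| <= (2 * (s ^+ 2 * A)) / n.+1%:R.
  rewrite (le_trans (ler_normB _ _))//.
  rewrite [leRHS](_ : _ = s ^+ 2 * (A / n.+1%:R) + s ^+ 2 * (A / n.+1%:R)); last by ring.
  by apply: lerD; apply: Fb; rewrite ?sqrrN.
have h2 : F n.+1%:R - F (- n.+1%:R) @[n --> \oo] --> 0.
  apply/cvgrPdist_le => e e0; near=> n; rewrite sub0r normrN (le_trans (cF0 n))//.
  rewrite ler_pdivrMr// [leRHS]mulrC -ler_pdivrMr// (@le_trans _ _ n%:R)// ?ler_nat//.
  by near: n; exact: nbhs_infty_ger.
apply: (cvg_unique _ h1) => //; apply: cvg_trans h2.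
apply: near_eq_cvg; near=> n; rewrite -fin -Rintegral_mkcond//.
Unshelve. all: by end_near. Qed.

Let x4ge0 (x : R) : 0 <= x ^+ 4. Proof. exact: exprn_even_ge0. Qed.

Lemma norm_le_poly4 (x : R) k : (k <= 4)%N -> `|x| ^+ k <= 1 + x ^+ 4.
Proof.
move=> k4; have x4 : x ^+ 4 = `|x| ^+ 4 by rewrite -normrX ger0_norm// exprn_even_ge0.
have [x1|x1] := leP `|x| 1.
  by rewrite (le_trans (exprn_ile1 k (normr_ge0 x) x1))// lerDl exprn_even_ge0.
by rewrite x4 (le_trans (ler_weXn2l (ltW x1) k4))// lerDr.
Qed.

Lemma normal_moment2 : Rintegral N setT (fun x => x ^+ 2) = s ^+ 2.
Proof.
rewrite (_ : (fun x => x ^+ 2) = (fun x : R => x * id x)); last by apply/funext => x; rewrite expr2.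
rewrite (@normal_stein id (cst 1) 2)//.
- by rewrite Rintegral_prob_cst mulr1.
- exact: cst_continuous.
- by move=> x; have := @norm_le_poly4 x 1 isT; have := @norm_le_poly4 x 0 isT; rewrite /= expr1; lra.
- by move=> x; have := @norm_le_poly4 x 0 isT; rewrite /= normr1; lra.
- by move=> x; have := @norm_le_poly4 x 2 isT; have := @norm_le_poly4 x 0 isT; rewrite -expr2 normrX; lra.
Qed.

Lemma normal_moment4 : Rintegral N setT (fun x => x ^+ 4) = 3 * s ^+ 4.
Proof.
rewrite (_ : (fun x => x ^+ 4) = (fun x : R => x * x ^+ 3)); last by apply/funext => x; rewrite exprS.
have d3 (x : R) : is_derive x 1 (fun x : R => x ^+ 3) (3 * x ^+ 2).
  by apply: is_derive_eq; rewrite /GRing.scale/=; ring.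
rewrite (@normal_stein (fun x => x ^+ 3) (fun x => 3 * x ^+ 2) 3 d3)//.
- rewrite RintegralZl//; first by rewrite normal_moment2; ring.
  apply: (@normal_poly4_integrable _ 1).
    exact: measurable_funX.
  by move=> x; rewrite normrX mul1r norm_le_poly4.
- by move=> x; apply: cvgM; [exact: cvg_cst|exact: exprn_continuous].
- by move=> x; have := @norm_le_poly4 x 3 isT; have := @norm_le_poly4 x 0 isT; rewrite normrX; lra.
- move=> x; rewrite normrM (@ger0_norm _ 3)// normrX; have := @norm_le_poly4 x 2 isT; lra.
- by move=> x; have := @norm_le_poly4 x 4 isT; have := @norm_le_poly4 x 0 isT; rewrite -exprS normrX; lra.
Qed.

(** Differentiation under the integral and Stein's identity give [h' = - s ^+ 2 * t * h], so
    [h t * expR (s ^+ 2 / 2 * t ^+ 2)] is constant; it is [cos b] at 0. *)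
Lemma normal_cos (r b : R) :
  Rintegral N setT (fun x => cos (r * x + b)) = cos b * expR (- (s ^+ 2 * r ^+ 2 / 2)).
Proof.
pose h (t : R) := Rintegral N setT (fun x => cos (t * x + b)).
have mlin (t : R) : measurable_fun setT (fun x : R => t * x + b).
  by apply: measurable_funD => //; exact: measurable_funM.
have ccos (t : R) : continuous (fun x : R => cos (t * x + b)).
  move=> x; apply: (@continuous_comp _ _ _ (fun x => t * x + b) cos); last exact: continuous_cos.
  by apply: cvgD; [apply: cvgM; [exact: cvg_cst|exact: cvg_id]|exact: cvg_cst].
have csin (t : R) : continuous (fun x : R => sin (t * x + b)).
  move=> x; apply: (@continuous_comp _ _ _ (fun x => t * x + b) sin); last exact: continuous_sin.
  by apply: cvgD; [apply: cvgM; [exact: cvg_cst|exact: cvg_id]|exact: cvg_cst].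
have dlin (t x : R) : is_derive x 1 (fun x : R => t * x + b) t.
  by apply: is_derive_eq; rewrite /GRing.scale/=; ring.
have dsin (t x : R) : is_derive x 1 (fun x : R => sin (t * x + b)) (t * cos (t * x + b)).
  have := @is_derive1_comp _ sin _ x _ _ (is_derive_sin _) (dlin t x).
  by move=> ?; apply: is_derive_eq; rewrite mulrC.
have dcos (x t : R) : is_derive t 1 (fun t : R => cos (t * x + b)) (- (x * sin (t * x + b))).
  have h1 : is_derive t 1 (fun t : R => t * x + b) x.
    by apply: is_derive_eq; rewrite /GRing.scale/=; ring.
  have := @is_derive1_comp _ cos _ t _ _ (is_derive_cos _) h1.
  by move=> ?; apply: is_derive_eq; rewrite mulNr mulrC.
have stein t : Rintegral N setT (fun x => x * sin (t * x + b)) = s ^+ 2 * (t * h t).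
  rewrite (@normal_stein _ (fun x => t * cos (t * x + b)) (2 + `|t|))//.
  - rewrite /h RintegralZl//; apply: integrable_bounded => [|x]; last exact: cos_max.
    exact: continuous_measurable_fun.
  - by move=> x; apply: cvgM; [exact: cvg_cst|exact: ccos].
  - move=> x; have := sin_max (t * x + b); have := normr_ge0 t.
    have : 0 <= x ^+ 4 := x4ge0 x; nra.
  - move=> x; rewrite normrM; have := cos_max (t * x + b); have := normr_ge0 t; have := normr_ge0 (cos (t * x + b)).
    have : 0 <= x ^+ 4 := x4ge0 x; nra.
  - move=> x; rewrite normrM; have := sin_max (t * x + b); have := normr_ge0 t; have := normr_ge0 (sin (t * x + b)).
    have := @norm_le_poly4 x 1 isT; rewrite /= expr1.
    have : 0 <= x ^+ 4 := x4ge0 x; have := normr_ge0 x; nra.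
have dh (t : R) : is_derive t 1 h (- (s ^+ 2 * (t * h t))).
  have p1 x y : partial1of2 (fun t x => cos (t * x + b)) x y = - (y * sin (x * y + b)).
    by rewrite /partial1of2 derive1E; case: (dcos y x).
  have i1 (x : R) : `]t - 1, t + 1[%classic x -> N.-integrable setT (EFin \o (fun y => cos (x * y + b))).
    move=> _; apply: integrable_bounded => [|y]; last exact: cos_max.
    exact: continuous_measurable_fun.
  have i2 : N.-integrable setT (EFin \o (fun x : R => `|x|)).
    apply: (@normal_poly4_integrable _ 1); first exact: measurableT_comp.
    by move=> x; rewrite normr_id mul1r; exact: (@norm_le_poly4 x 1).
  have tin : `]t - 1, t + 1[%classic t by rewrite /= in_itv/=; apply/andP; split; lra.
  have d1 (x y : R) : `]t - 1, t + 1[%classic x -> [set: measurableTypeR R] y -> derivable (fun t : R => cos (t * y + b)) x 1.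
    by move=> _ _; case: (dcos y x).
  have d2 (x y : R) : `]t - 1, t + 1[%classic x -> [set: measurableTypeR R] y -> `|partial1of2 (fun t x => cos (t * x + b)) x y| <= `|y|.
    by move=> _ _; rewrite p1 normrN normrM ler_piMr// sin_max.
  have D := @derivable_under_integral R _ _ N (fun t x => cos (t * x + b)) setT measurableT t _ _ tin i1 d1 _ (@normr_ge0 _ _) i2 d2.
  have E := @differentiation_under_integral R _ _ N (fun t x => cos (t * x + b)) setT measurableT t _ _ tin i1 d1 _ (@normr_ge0 _ _) i2 d2.
  apply: DeriveDef => //; rewrite -derive1E E.
  under eq_Rintegral do rewrite p1.
  rewrite -stein -[RHS]mulN1r -RintegralZl//.
    by apply: eq_Rintegral => x _; rewrite mulN1r.
  apply: (integrable_le _ _ i2) => //.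
    by apply: measurable_funM => //; exact: continuous_measurable_fun.
  by move=> x _; rewrite normrM ler_piMr// sin_max.
have dE (t0 : R) : is_derive t0 1 (fun t => h t * expR (s ^+ 2 / 2 * t ^+ 2)) 0.
  have h1 : is_derive t0 1 (fun t : R => s ^+ 2 / 2 * t ^+ 2) (s ^+ 2 * t0).
    by apply: is_derive_eq; rewrite /GRing.scale/= mulr1; field.
  have h2 := @is_derive1_comp _ expR _ t0 _ _ (is_derive_expR _) h1.
  have h3 := @is_deriveM _ _ _ _ t0 1 _ _ (dh t0) h2.
  by apply: is_derive_eq; rewrite /GRing.scale/=; ring.
have := is_derive_0_is_cst r 0 dE.
rewrite expr0n/= mulr0 expR0 mulr1 {2}/h.
under eq_Rintegral do rewrite mul0r add0r.
rewrite Rintegral_prob_cst => <-.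
by rewrite -[RHS]mulrA -expRD (_ : _ + _ = 0) ?expR0 ?mulr1//; ring.
Qed.

End GaussianMoments.

(** * Random variables with law [gauss0] *)

Section GaussianVariables.
Context d (T : measurableType d) (R : realType) (P : probability T R).
Variables (X : T -> measurableTypeR R) (v : R).
Hypotheses (mX : measurable_fun setT X) (v0 : 0 <= v).
Hypothesis gX : forall A : set R, measurable A -> P (X @^-1` A) = gauss0 v A.

Let PX : {measure set (measurableTypeR R) -> \bar R} :=
  measure_function_pushforward__canonical__measure_function_Measure P mX.

(* [0 <= v] excludes the junk branch [normal_prob 0 0] of [gauss0]. *)
Lemma integral_law_gauss0 (f : measurableTypeR R -> \bar R) : measurable_fun setT f ->
  (\int[PX]_x f x = if v == 0%R then f 0%R else \int[normal_prob 0 (Num.sqrt v)]_x f x)%E.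
Proof.
move=> mf; case: ifPn => v00.
  rewrite (@eq_measure_integral _ (measurableTypeR R) R setT (dirac (0 : measurableTypeR R)) PX f).
    by rewrite integral_dirac// diracT mul1e.
  by move=> A mA _; rewrite -[LHS]/(P (X @^-1` A)) gX// /gauss0 v00.
apply: eq_measure_integral => A mA _.
by rewrite -[LHS]/(P (X @^-1` A)) gX// /gauss0 (negbTE v00).
Qed.

Let sv : v != 0 -> 0 < Num.sqrt v.
Proof. by move=> vn0; rewrite sqrtr_gt0 lt_def vn0. Qed.

Lemma gauss0_integrable (f : R -> R) (C : R) : measurable_fun setT f ->
  (forall x, `|f x| <= C * (1 + x ^+ 4)) -> P.-integrable setT (EFin \o (f \o X)).
Proof.
move=> mf fC.
apply/integrableP; split.
  by apply/measurable_EFinP; exact: (@measurableT_comp _ _ _ _ (measurableTypeR R)).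
have mg : measurable_fun setT (fun x : measurableTypeR R => `|f x|%:E).
  by apply/measurable_EFinP; exact: measurableT_comp.
have := @ge0_integral_pushforward _ _ _ (measurableTypeR R) _ _ mX P setT _ measurableT mg.
rewrite preimage_setT => <-//.
rewrite (integral_law_gauss0 mg).
have [v00|vn0] := eqVneq v 0; first by rewrite ltry.
by have /integrableP[] := normal_poly4_integrable (sv vn0) mf fC.
Qed.

Lemma gauss0_Rintegral (f : R -> R) (C : R) : measurable_fun setT f ->
  (forall x, `|f x| <= C * (1 + x ^+ 4)) ->
  Rintegral P setT (fun w => f (X w)) =
  if v == 0 then f 0 else Rintegral (normal_prob 0 (Num.sqrt v)) setT f.
Proof.
move=> mf fC; rewrite /Rintegral.
have mfE : measurable_fun setT (fun x : measurableTypeR R => (f x)%:E).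
  exact/measurable_EFinP.
have := @integral_pushforward _ _ _ (measurableTypeR R) _ _ mX P setT _ mfE.
rewrite preimage_setT => /(_ (gauss0_integrable mf fC) measurableT) => h.
rewrite -[integral P _ _]/(\int[P]_w ((fun x => (f x)%:E) \o X) w)%E -h.
by rewrite (integral_law_gauss0 mfE); case: ifP.
Qed.

Lemma gauss0_cos (b : R) :
  Rintegral P setT (fun w => cos (X w + b)) = cos b * expR (- (v / 2)).
Proof.
rewrite (@gauss0_Rintegral (fun x => cos (x + b)) 1).
- have [->|vn0] := eqVneq v 0; first by rewrite mul0r oppr0 expR0 mulr1 add0r.
  have := normal_cos (sv vn0) 1 b.
  under eq_Rintegral do rewrite mul1r.
  by move=> ->; rewrite sqr_sqrtr// expr1n mulr1.
- apply: measurableT_comp; first exact: continuous_measurable_fun (@continuous_cos R).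
  exact: measurable_funD.
- by move=> x; rewrite mul1r (le_trans (cos_max _))// lerDl exprn_even_ge0.
Qed.

Lemma gauss0_moment2 : Rintegral P setT (fun w => X w ^+ 2) = v.
Proof.
rewrite (@gauss0_Rintegral (fun x => x ^+ 2) 1).
- have [->|vn0] := eqVneq v 0; first by rewrite expr0n.
  by rewrite normal_moment2 ?sv// sqr_sqrtr.
- exact: measurable_funX.
- by move=> x; rewrite mul1r normrX norm_le_poly4.
Qed.

Lemma gauss0_moment4 : Rintegral P setT (fun w => X w ^+ 4) = 3 * v ^+ 2.
Proof.
rewrite (@gauss0_Rintegral (fun x => x ^+ 4) 1).
- have [->|vn0] := eqVneq v 0; first by rewrite !expr0n mulr0.
  by rewrite normal_moment4 ?sv// (_ : 4 = 2 * 2)%N// exprM sqr_sqrtr.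
- exact: measurable_funX.
- by move=> x; rewrite mul1r normrX norm_le_poly4.
Qed.

Lemma gauss0_integrable4 : P.-integrable setT (EFin \o (fun w => X w ^+ 4)).
Proof.
apply: (@gauss0_integrable (fun x => x ^+ 4) 1); first exact: measurable_funX.
by move=> x; rewrite mul1r normrX norm_le_poly4.
Qed.

End GaussianVariables.

(** * Independence of generated sigma-algebras *)

Section IndependentPiSystems.
Context d (T : measurableType d) (R : realType) (P : probability T R).

Section Trace.
Variable C : set (set T).
Hypothesis Cm : C `<=` d.-measurable.

Lemma sub_sigma_measurable (A : set (g_sigma_algebraType C)) :
  measurable A -> d.-measurable (A : set T).
Proof. by apply: smallest_sub => //; exact: sigma_algebra_measurable. Qed.

Definition id_sigma (w : T) : g_sigma_algebraType C := w.

Lemma measurable_id_sigma : measurable_fun setT id_sigma.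
Proof. by move=> _ A mA; rewrite setTI; exact: sub_sigma_measurable. Qed.

Definition mfun_id_sigma : {mfun T >-> g_sigma_algebraType C} :=
  mfun_Sub (mem_set measurable_id_sigma).

(** The restriction of [P] to the sigma-algebra generated by [C], realised as an image under the
    identity so that product measures and Fubini's theorem apply to it. *)
Definition trace : probability (g_sigma_algebraType C) R := distribution P mfun_id_sigma.

Lemma measurable_fun_of_sigma d' (T' : measurableType d') (f : g_sigma_algebraType C -> T') :
  measurable_fun setT f -> measurable_fun setT (f : T -> T').
Proof. by move=> mf; exact: (measurableT_comp mf measurable_id_sigma). Qed.

Lemma integrable_trace (f : g_sigma_algebraType C -> R) : measurable_fun setT f ->
  trace.-integrable setT (EFin \o f) <-> P.-integrable setT (EFin \o f).
Proof.
move=> mf.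
have mf' : measurable_fun setT (f : T -> R) := measurable_fun_of_sigma mf.
have h : (\int[trace]_x `|(EFin \o f) x| = \int[P]_x `|(EFin \o f) x|)%E.
  apply: (@ge0_integral_distribution _ _ _ _ _ P mfun_id_sigma (fun x => `|f x|%:E)) => //.
  by apply/measurable_EFinP; exact: measurableT_comp.
split=> /integrableP[_ fin]; apply/integrableP; split.
- exact/measurable_EFinP.
- by rewrite -h.
- exact/measurable_EFinP.
- by rewrite h.
Qed.

Lemma Rintegral_trace (f : g_sigma_algebraType C -> R) :
  measurable_fun setT f -> P.-integrable setT (EFin \o f) ->
  Rintegral trace setT f = Rintegral P setT f.
Proof.
move=> mf i_f; rewrite /Rintegral; congr fine.
apply: (@integral_distribution _ _ _ _ _ P mfun_id_sigma (EFin \o f)) => //.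
exact/measurable_EFinP.
Qed.

Hypotheses (CI : setI_closed C) (CT : C setT).

(** Both sides are finite measures in [A] that agree on the pi-system [C]. *)
Lemma indep_sigma_l (B : set T) : measurable B ->
  (forall A, C A -> P (A `&` B) = (P A * P B)%E) ->
  forall A : set (g_sigma_algebraType C), measurable A -> P (A `&` B) = (P A * P B)%E.
Proof.
move=> mB h A mA.
have PB0 : 0 <= fine (P B) by rewrite fine_ge0.
pose m1 : {measure set (g_sigma_algebraType C) -> \bar R} :=
  measure_function_pushforward__canonical__measure_function_Measure (mrestr P mB) measurable_id_sigma.
pose m2 : {measure set (g_sigma_algebraType C) -> \bar R} := mscale (NngNum PB0) trace.
have PBE : (fine (P B))%:E = P B by rewrite fineK// fin_num_measure.
have := @measure_unique _ R (g_sigma_algebraType C) C (fun=> setT) erefl CI (fun=> CT) _ m1 m2 _ _ A mA.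
rewrite -[m1 A]/(P (A `&` B)) -[m2 A]/((fine (P B))%:E * P A)%E PBE muleC; apply.
- by rewrite bigcup_const//; exists 0%N.
- by move=> E CE; rewrite -[LHS]/(P (E `&` B)) -[RHS]/((fine (P B))%:E * P E)%E PBE muleC; exact: h.
- by move=> _; rewrite -[m1 setT]/(P (setT `&` B)) setTI (le_lt_trans (probability_le1 _ _))// ltry.
Qed.

End Trace.

Variables C1 C2 : set (set T).
Hypotheses (C1m : C1 `<=` d.-measurable) (C2m : C2 `<=` d.-measurable).
Hypotheses (C1I : setI_closed C1) (C2I : setI_closed C2).
Hypotheses (C1T : C1 setT) (C2T : C2 setT).
Hypothesis C12 : forall A B, C1 A -> C2 B -> P (A `&` B) = (P A * P B)%E.

Local Notation T1 := (g_sigma_algebraType C1).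
Local Notation T2 := (g_sigma_algebraType C2).
Local Notation P1 := (trace C1m).
Local Notation P2 := (trace C2m).

Lemma indep_sigma (A : set T1) (B : set T2) : measurable A -> measurable B ->
  P ((A : set T) `&` (B : set T)) = (P A * P B)%E.
Proof.
move=> mA mB.
apply: (@indep_sigma_l C1 C1m C1I C1T) => //; first exact: (sub_sigma_measurable C2m).
move=> E CE; rewrite setIC muleC.
apply: (@indep_sigma_l C2 C2m C2I C2T) => //; first exact: C1m.
by move=> F CF; rewrite setIC C12// muleC.
Qed.

Definition diag (w : T) : T1 * T2 := (w, w).

Lemma measurable_diag : measurable_fun setT diag.
Proof. by apply: measurable_fun_pair; exact: measurable_id_sigma. Qed.

(** By independence the image of [P] under [diag] and the product of the two restrictions agree on
    rectangles, hence everywhere. *)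
Lemma integral_diag (f : T1 * T2 -> R) : measurable_fun setT f ->
  (P1 \x P2)%E.-integrable setT (EFin \o f) ->
  P.-integrable setT (EFin \o (fun w => f (w, w))) /\
  Rintegral P setT (fun w => f (w, w)) = Rintegral (P1 \x P2)%E setT f.
Proof.
move=> mf i_f.
pose m : {measure set (T1 * T2) -> \bar R} :=
  measure_function_pushforward__canonical__measure_function_Measure P measurable_diag.
have mE A : measurable A -> A `<=` setT -> m A = (P1 \x P2)%E A.
  move=> mA _; apply/esym; apply: product_measure_unique mA => A1 A2 mA1 mA2.
  by rewrite -[LHS]/(P (diag @^-1` (A1 `*` A2))) -indep_sigma.
have mfE : measurable_fun setT (fun x => (f x)%:E) by exact/measurable_EFinP.
have i_P : P.-integrable setT (EFin \o (fun w => f (w, w))).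
  apply/integrableP; split.
    apply/measurable_EFinP.
    exact: (measurableT_comp mf measurable_diag).
  have mg : measurable_fun setT (fun x => `|f x|%:E).
    by apply/measurable_EFinP; exact: measurableT_comp.
  have := @ge0_integral_pushforward _ _ _ _ _ _ measurable_diag P setT _ measurableT mg.
  rewrite preimage_setT => <-//.
  have /integrableP[_] := i_f; apply: le_lt_trans; rewrite le_eqVlt; apply/orP; left; apply/eqP.
  exact: (@eq_measure_integral _ _ _ setT (P1 \x P2)%E m).
split => //.
have := @integral_pushforward _ _ _ _ _ _ measurable_diag P setT _ mfE.
rewrite preimage_setT => /(_ i_P measurableT) => h; rewrite /Rintegral; congr fine.
rewrite -[LHS]/(\int[P]_w ((fun x => (f x)%:E) \o diag) w)%E -h.
exact: (@eq_measure_integral _ _ _ setT (P1 \x P2)%E m).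
Qed.

(** Fubini's theorem on the diagonal; it plays the role of conditioning on the first sigma-algebra.
    Integrability on every fibre makes the inner integral finite everywhere and not merely almost
    everywhere. *)
Lemma decouple_integrable (f : T1 * T2 -> R) : measurable_fun setT f ->
  (P1 \x P2)%E.-integrable setT (EFin \o f) ->
  (forall w1, P.-integrable setT (EFin \o (fun w2 : T2 => f (w1, w2)))) ->
  Rintegral P setT (fun w => f (w, w)) =
  Rintegral P setT (fun w1 => Rintegral P setT (fun w2 => f (w1, w2))).
Proof.
move=> mf i_f if2.
have mf2 w1 : measurable_fun setT (fun w2 : T2 => f (w1, w2)).
  by apply: (measurableT_comp mf); exact: measurable_fun_pair.
pose G w1 := Rintegral P2 setT (fun w2 => f (w1, w2)).
have GE : fubini_F P2 (EFin \o f) = EFin \o G.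
  apply/funext => w1; rewrite /fubini_F /G /Rintegral /= fineK//.
  by apply: integrable_fin_num => //; apply/integrable_trace.
have mG : measurable_fun setT G.
  by have := measurable_fubini_F i_f; rewrite GE => /measurable_EFinP.
have iG : P1.-integrable setT (EFin \o G).
  by have := integrable_fubini_F i_f; rewrite GE.
rewrite (integral_diag mf i_f).2.
transitivity (Rintegral P1 setT G).
  by rewrite /Rintegral -(integral12_prod_meas1 i_f) GE.
rewrite Rintegral_trace//; last exact/integrable_trace.
by apply: eq_Rintegral => w1 _; rewrite /G Rintegral_trace.
Qed.

Lemma decouple_bounded (f : T1 * T2 -> R) (M : R) : measurable_fun setT f ->
  (forall x, `|f x| <= M) ->
  Rintegral P setT (fun w => f (w, w)) =
  Rintegral P setT (fun w1 => Rintegral P setT (fun w2 => f (w1, w2))).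
Proof.
move=> mf fM; apply: decouple_integrable => //.
  exact: (integrable_bounded (P1 \x P2)%E mf fM).
move=> w1; apply: (@integrable_bounded _ _ _ P _ M) => // .
apply: (measurable_fun_of_sigma C2m).
by apply: (measurableT_comp mf); exact: measurable_fun_pair.
Qed.

Lemma decouple_mul (X : T1 -> R) (Y : T2 -> R) :
  measurable_fun setT X -> measurable_fun setT Y ->
  P.-integrable setT (EFin \o X) -> P.-integrable setT (EFin \o Y) ->
  P.-integrable setT (EFin \o (fun w => X w * Y w)) /\
  Rintegral P setT (fun w => X w * Y w) = Rintegral P setT X * Rintegral P setT Y.
Proof.
move=> mX mY iX iY.
pose f (x : T1 * T2) := X x.1 * Y x.2.
have mf : measurable_fun setT f.
  apply: measurable_funM; first exact: (measurableT_comp mX measurable_fst).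
  exact: (measurableT_comp mY measurable_snd).
have i_f : (P1 \x P2)%E.-integrable setT (EFin \o f).
  apply/integrable12ltyP; first exact/measurable_EFinP.
  under eq_integral.
    move=> w1 _.
    under eq_integral do rewrite /f /= normrM EFinM.
    rewrite ge0_integralZl//; last by apply/measurable_EFinP; exact: measurableT_comp.
    over.
  have iX1 := (integrable_trace C1m mX).2 iX; have iY2 := (integrable_trace C2m mY).2 iY.
  have Yfin : (\int[P2]_x `|Y x|%:E)%E \is a fin_num.
    by apply: integrable_fin_num => //; exact: integrable_norm.
  rewrite -(fineK Yfin) ge0_integralZr//.
  - rewrite muleC lte_mul_pinfty//; first by rewrite lee_fin fine_ge0// integral_ge0.
    by have /integrableP[] := iX1.
  - by apply/measurable_EFinP; exact: measurableT_comp.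
  - by rewrite lee_fin fine_ge0// integral_ge0.
split; first exact: (integral_diag mf i_f).1.
have /= := decouple_integrable mf i_f; rewrite /f/= => ->.
  under eq_Rintegral do rewrite RintegralZl//.
  by rewrite RintegralZr.
move=> w1; have := integrableZl measurableT (X w1) iY.
by apply: eq_integrable.
Qed.

End IndependentPiSystems.

(** * Cylinder events of a process *)

Section Cylinders.
Context d (T : measurableType d) (R : realType).

(** Rectangles over finitely many times, restricted to nonnegative times like [is_fBm] and
    [indep_proc]. Repeated times are allowed, so that an intersection is a mere concatenation. *)
Definition cylinder (B : R -> T -> R) : set (set T) :=
  [set S | exists (n : nat) (s : 'I_n -> R) (A : 'I_n -> set R),
    [/\ forall i, 0 <= s i, forall i, measurable (A i) &
        S = [set w | forall i, A i (B (s i) w)]]].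

Variable B : R -> T -> R.
Hypothesis mB : forall t, 0 <= t -> measurable_fun setT (B t).

Lemma cylinder_measurable : cylinder B `<=` d.-measurable.
Proof.
move=> _ [n [s [A [s0 mA ->]]]].
rewrite (_ : [set w | _] = \bigcap_(i in [set: 'I_n]) (B (s i) @^-1` A i)); last first.
  by apply/seteqP; split => w /= h i => [_|]; exact: h.
apply: fin_bigcap_measurable => // i _.
by rewrite -[X in measurable X]setTI; exact: mB.
Qed.

Lemma cylinderT : cylinder B setT.
Proof.
exists 0%N, (fun=> 0), (fun=> setT); split => //.
by apply/seteqP; split => // w _ [].
Qed.

Lemma cylinderI : setI_closed (cylinder B).
Proof.
move=> _ _ [n [s [A [s0 mA ->]]]] [m [t [C [t0 mC ->]]]].
exists (n + m)%N, (fun i : 'I_(n + m) => match fintype.split i with inl j => s j | inr j => t j end),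
  (fun i : 'I_(n + m) => match fintype.split i with inl j => A j | inr j => C j end); split.
- by move=> i; case: fintype.split.
- by move=> i; case: fintype.split.
- apply/seteqP; split => w /=.
    by move=> [h1 h2] i; case: fintype.split.
  move=> h; split => i.
    by have := h (lshift m i); rewrite (unsplitK (inl i)).
  by have := h (rshift n i); rewrite (unsplitK (inr i)).
Qed.

Lemma cylinder_measurable_fun t : 0 <= t ->
  measurable_fun setT (B t : g_sigma_algebraType (cylinder B) -> R).
Proof.
move=> t0 _ A mA; rewrite setTI; apply: sub_sigma_algebra.
exists 1%N, (fun=> t), (fun=> A); split => //.
by apply/seteqP; split => w /= => [h _|]; [|apply; exact: ord0].
Qed.

End Cylinders.

Section IndependentProcesses.
Context d (T : measurableType d) (R : realType) (P : probability T R).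
Variables B1 B2 : R -> T -> R.
Hypothesis B12 : indep_proc P B1 B2.

(** [indep_proc] uses one number of times for both processes. Cylinders of lengths [n] and [m] are
    padded to length [n + m] by the empty condition [setT] at time 0. *)
Lemma indep_cylinder S1 S2 : cylinder B1 S1 -> cylinder B2 S2 ->
  P (S1 `&` S2) = (P S1 * P S2)%E.
Proof.
move=> [n [s [A [s0 mA ->]]]] [m [t [C [t0 mC ->]]]].
pose s' (i : 'I_(n + m)) := match fintype.split i with inl j => s j | inr j => 0 end.
pose A' (i : 'I_(n + m)) := match fintype.split i with inl j => A j | inr j => setT end.
pose t' (i : 'I_(n + m)) := match fintype.split i with inl j => 0 | inr j => t j end.
pose C' (i : 'I_(n + m)) := match fintype.split i with inl j => setT | inr j => C j end.
have -> : [set w | forall i, A i (B1 (s i) w)] = [set w | forall i : 'I_(n + m), A' i (B1 (s' i) w)].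
  apply/seteqP; split => w /= h i.
    by rewrite /A' /s'; case: fintype.split.
  by have := h (lshift m i); rewrite /A' /s' (unsplitK (inl i)).
have -> : [set w | forall i, C i (B2 (t i) w)] = [set w | forall i : 'I_(n + m), C' i (B2 (t' i) w)].
  apply/seteqP; split => w /= h i.
    by rewrite /C' /t'; case: fintype.split.
  by have := h (rshift n i); rewrite /C' /t' (unsplitK (inr i)).
by apply: B12 => i; rewrite /s' /t' /A' /C'; case: fintype.split.
Qed.

End IndependentProcesses.

(** * Linear forms of fractional Brownian motion and conditional Gaussianity *)

Section IntegralSums.
Context d (T : measurableType d) (R : realType) (mu : {measure set T -> \bar R}).

Lemma integrable_lin_comb (I : Type) (s : seq I) (c : I -> R) (f : I -> T -> R) :
  (forall i, mu.-integrable setT (EFin \o f i)) ->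
  mu.-integrable setT (EFin \o (fun w => \sum_(i <- s) c i * f i w)) /\
  Rintegral mu setT (fun w => \sum_(i <- s) c i * f i w) =
  \sum_(i <- s) c i * Rintegral mu setT (f i).
Proof.
move=> i_f; elim: s => [|i s [IH1 IH2]].
  rewrite big_nil; under eq_Rintegral do rewrite big_nil.
  split; last by rewrite /Rintegral integral0.
  apply: (eq_integrable _ (cst 0%E)) => //; last exact: integrable0.
  by move=> w _ /=; rewrite big_nil.
have i_c : mu.-integrable setT (EFin \o (fun w => c i * f i w)).
  have := integrableZl measurableT (c i) (i_f i); exact: eq_integrable.
split.
  have := integrableD measurableT i_c IH1.
  by apply: eq_integrable => // w _ /=; rewrite big_cons.
under eq_Rintegral do rewrite big_cons.
by rewrite RintegralD// big_cons IH2 RintegralZl.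
Qed.

End IntegralSums.

Section LinearForms.
Context (R : realType).
Implicit Types l : seq (R * R).

(** The list consists of pairs (coefficient, time). Adding forms is then concatenation, with no
    common set of times to maintain. *)
Definition lf (T : Type) (B : R -> T -> R) l (w : T) : R := \sum_(p <- l) p.1 * B p.2 w.

Definition lcov (H : R) l l' : R :=
  \sum_(p <- l) \sum_(q <- l') p.1 * q.1 * fBm_cov H p.2 q.2.

Definition lvalid l := all (fun p => 0 <= p.2) l.

Definition lscale (c : R) l := [seq (c * p.1, p.2) | p <- l].

Definition lcomb (n : nat) (c : nat -> R) (delta : nat -> seq (R * R)) :=
  flatten [seq lscale (c k) (delta k) | k <- iota 0 n].

Lemma lvalid_cat l l' : lvalid (l ++ l') = lvalid l && lvalid l'.
Proof. exact: all_cat. Qed.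

Lemma lvalid_scale c l : lvalid (lscale c l) = lvalid l.
Proof. by rewrite /lvalid all_map; apply: eq_all => p. Qed.

Lemma lvalid_comb n c delta : (forall k, lvalid (delta k)) -> lvalid (lcomb n c delta).
Proof.
move=> vd; rewrite /lcomb; elim: (iota 0 n) => //= k s IH.
by rewrite lvalid_cat lvalid_scale vd.
Qed.

Section Lf.
Context (T : Type) (B : R -> T -> R).

Lemma lf_cat l l' w : lf B (l ++ l') w = lf B l w + lf B l' w.
Proof. exact: big_cat. Qed.

Lemma lf_scale c l w : lf B (lscale c l) w = c * lf B l w.
Proof. by rewrite /lf big_map mulr_sumr; apply: eq_bigr => p _; rewrite mulrA. Qed.

Lemma lf_comb n c delta w : lf B (lcomb n c delta) w = \sum_(k < n) c k * lf B (delta k) w.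
Proof.
rewrite -(big_mkord xpredT (fun k => c k * lf B (delta k) w)) /index_iota subn0 /lcomb.
elim: (iota 0 n) => [|k s IH] /=; first by rewrite big_nil /lf big_nil.
by rewrite lf_cat lf_scale IH big_cons.
Qed.

End Lf.

Variable H : R.

Lemma fBm_covC s t : fBm_cov H s t = fBm_cov H t s.
Proof. by rewrite /fBm_cov distrC [X in X - _]addrC. Qed.

Lemma lcovC l l' : lcov H l l' = lcov H l' l.
Proof.
rewrite /lcov exchange_big/=; apply: eq_bigr => p _; apply: eq_bigr => q _.
by rewrite fBm_covC [q.1 * _]mulrC.
Qed.

Lemma lcov_catl l l' l2 : lcov H (l ++ l') l2 = lcov H l l2 + lcov H l' l2.
Proof. exact: big_cat. Qed.

Lemma lcov_scalel c l l2 : lcov H (lscale c l) l2 = c * lcov H l l2.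
Proof.
rewrite /lcov big_map mulr_sumr; apply: eq_bigr => p _; rewrite mulr_sumr.
by apply: eq_bigr => q _ /=; rewrite !mulrA.
Qed.

Lemma lcov_combl n c delta l : lcov H (lcomb n c delta) l = \sum_(k < n) c k * lcov H (delta k) l.
Proof.
rewrite -(big_mkord xpredT (fun k => c k * lcov H (delta k) l)) /index_iota subn0 /lcomb.
elim: (iota 0 n) => [|k s IH] /=; first by rewrite big_nil /lcov big_nil.
by rewrite lcov_catl lcov_scalel IH big_cons.
Qed.

Lemma lcov_catr l l' l2 : lcov H l2 (l ++ l') = lcov H l2 l + lcov H l2 l'.
Proof. by rewrite !(lcovC l2) lcov_catl. Qed.

Lemma lcov_scaler c l l2 : lcov H l2 (lscale c l) = c * lcov H l2 l.
Proof. by rewrite !(lcovC l2) lcov_scalel. Qed.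

Lemma lcov_combr n c delta l : lcov H l (lcomb n c delta) = \sum_(k < n) c k * lcov H l (delta k).
Proof. by rewrite lcovC lcov_combl; apply: eq_bigr => k _; rewrite lcovC. Qed.

End LinearForms.

(** * Law and moments of linear forms of fractional Brownian motion *)

Section FBmMoments.
Context d (T : measurableType d) (R : realType) (P : probability T R) (H : R) (B : R -> T -> R).
Hypothesis fB : is_fBm P H B.
Implicit Types l a b : seq (R * R).

Lemma fBm_measurable t : 0 <= t -> measurable_fun setT (B t).
Proof. by have [mB _ _] := fB; exact: mB. Qed.

Lemma lf_measurable_sigma l : lvalid l ->
  measurable_fun setT (lf B l : g_sigma_algebraType (cylinder B) -> R).
Proof.
move=> vl; rewrite /lf.
have -> : (fun w => \sum_(p <- l) p.1 * B p.2 w) =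
  (fun w => \sum_(p <- [seq p <- l | 0 <= p.2]) p.1 * B p.2 w).
  by apply/funext => w; rewrite (all_filterP vl).
elim: l {vl} => [|p l IH] /=; first by under eq_fun do rewrite big_nil; exact: measurable_cst.
case: ifP => // p0; under eq_fun do rewrite big_cons.
apply: measurable_funD => //; apply: measurable_funM; first exact: measurable_cst.
exact: cylinder_measurable_fun.
Qed.

Lemma lf_measurable l : lvalid l -> measurable_fun setT (lf B l).
Proof.
move=> vl; apply: (@measurable_fun_of_sigma _ _ (cylinder B)); last exact: lf_measurable_sigma.
by apply: cylinder_measurable => t; exact: fBm_measurable.
Qed.

Lemma lf_law l (A : set R) : lvalid l -> measurable A ->
  P (lf B l @^-1` A) = gauss0 (lcov H l l) A.
Proof.
move=> /allP vl mA; have [_ _ law] := fB.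
pose nl (i : 'I_(size l)) := nth (0, 0) l i.
have := law _ (fun i => (nl i).2) (fun i => (nl i).1) _ A mA.
rewrite (_ : (fun w => _) = lf B l); last first.
  by apply/funext => w; rewrite /lf (big_nth (0, 0)) big_mkord.
move=> ->; last by move=> i; apply: vl; exact: mem_nth.
congr gauss0; rewrite /lcov (big_nth (0, 0)) big_mkord; apply: eq_bigr => i _.
by rewrite (big_nth (0, 0)) big_mkord.
Qed.

(* If the variance were negative, [l] and [- l] would both be uniform on [[0, 1]]. *)
Lemma lcov_ge0 l : lvalid l -> 0 <= lcov H l l.
Proof.
move=> vl; rewrite leNgt; apply/negP => c0.
have sc : Num.sqrt (lcov H l l) = 0 by rewrite ler0_sqrtr// ltW.
have cn0 : lcov H l l == 0 = false by rewrite lt_eqF.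
have U (A : set R) : measurable A -> P (lf B l @^-1` A) = normal_prob 0 0 A.
  by move=> mA; rewrite lf_law// /gauss0 cn0 sc.
have UN (A : set R) : measurable A -> P ((fun w => - lf B l w) @^-1` A) = normal_prob 0 0 A.
  move=> mA.
  have := @lf_law (lscale (-1) l) A; rewrite lvalid_scale => /(_ vl mA).
  rewrite lcov_scalel lcov_scaler mulrA mulrNN !mul1r /gauss0 cn0 sc => <-.
  congr (P _); apply/seteqP; split => w /=; rewrite lf_scale mulN1r//.
(* At standard deviation 0, which is also the square root of a negative number, [normal_pdf] is the
   indicator of [[0, 1]]. *)
have N0 (A : set R) : measurable A -> normal_prob 0 0 A = lebesgue_measure (A `&` `[0, 1]).
  move=> mA; rewrite /normal_prob.
  under eq_integral do rewrite /normal_pdf eqxx.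
  by rewrite integral_indic// setIC.
pose I1 : set R := `]0, +oo[%classic; pose I2 : set R := `[0, +oo[%classic.
have mI1 : measurable I1 by exact: measurable_itv.
have mI2 : measurable I2 by exact: measurable_itv.
have e1 : normal_prob 0 0 I1 = 1%E.
  rewrite N0// (_ : _ `&` _ = `]0, 1]%classic).
    by rewrite lebesgue_measure_itv/= lte01 oppr0 adde0.
  apply/seteqP; split => x /=; rewrite /I1/= !in_itv/= ?andbT; first by move=> [-> /andP[_ ->]].
  by move=> /andP[x0 ->]; rewrite x0 ltW.
have e2 : normal_prob 0 0 I2 = 1%E.
  rewrite N0// (_ : _ `&` _ = `[0, 1]%classic).
    by rewrite lebesgue_measure_itv/= lte01 oppr0 adde0.
  apply/seteqP; split => x /=; rewrite /I2/= !in_itv/= ?andbT; first by move=> [-> /andP[_ ->]].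
  by move=> /andP[x0 ->]; rewrite x0.
have mlf := lf_measurable vl.
have mA1 : d.-measurable (lf B l @^-1` I1) by rewrite -[X in measurable X]setTI; exact: mlf.
have mA2 : d.-measurable ((fun w => - lf B l w) @^-1` I2).
  by rewrite -[X in measurable X]setTI; exact: measurableT_comp.
(* Two disjoint events, each of which would have probability 1. *)
have D : (lf B l @^-1` I1) `&` ((fun w => - lf B l w) @^-1` I2) = set0.
  apply/seteqP; split => w //=; rewrite /I1 /I2/= !in_itv/= !andbT oppr_ge0 => -[h1 h2].
  by have := lt_le_trans h1 h2; rewrite ltxx.
pose p1 := P (lf B l @^-1` I1); pose p2 := P ((fun w => - lf B l w) @^-1` I2).
have : (p1 + p2 <= 1)%E.
  by rewrite /p1 /p2 -measureU//; apply: probability_le1; exact: measurableU.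
rewrite /p1 /p2 U// UN// e1 e2 -EFinD lee_fin; lra.
Qed.

Lemma lf_cos l (b : R) : lvalid l ->
  Rintegral P setT (fun w => cos (lf B l w + b)) = cos b * expR (- (lcov H l l / 2)).
Proof.
move=> vl; apply: (@gauss0_cos _ _ _ P (lf B l)); [exact: lf_measurable|exact: lcov_ge0|].
by move=> A mA; exact: lf_law.
Qed.

Lemma lf_int4 l : lvalid l -> P.-integrable setT (EFin \o (fun w => lf B l w ^+ 4)).
Proof.
move=> vl; apply: (@gauss0_integrable4 _ _ _ P (lf B l) (lcov H l l)); [exact: lf_measurable|exact: lcov_ge0|].
by move=> A mA; exact: lf_law.
Qed.

Lemma lf_moment4 l : lvalid l ->
  Rintegral P setT (fun w => lf B l w ^+ 4) = 3 * lcov H l l ^+ 2.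
Proof.
move=> vl; apply: (@gauss0_moment4 _ _ _ P (lf B l)); [exact: lf_measurable|exact: lcov_ge0|].
by move=> A mA; exact: lf_law.
Qed.

Lemma lf_moment2 l : lvalid l -> Rintegral P setT (fun w => lf B l w ^+ 2) = lcov H l l.
Proof.
move=> vl; apply: (@gauss0_moment2 _ _ _ P (lf B l)); [exact: lf_measurable|exact: lcov_ge0|].
by move=> A mA; exact: lf_law.
Qed.

Lemma lf_int2 l : lvalid l -> P.-integrable setT (EFin \o (fun w => lf B l w ^+ 2)).
Proof.
move=> vl; apply: (@gauss0_integrable _ _ _ P (lf B l) (lcov H l l) _ _ _ (fun x => x ^+ 2) 1).
- exact: lf_measurable.
- exact: lcov_ge0.
- by move=> A mA; exact: lf_law.
- exact: measurable_funX.
- by move=> x; rewrite mul1r normrX norm_le_poly4.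
Qed.

Lemma lf_isserlis2 a b : lvalid a -> lvalid b ->
  P.-integrable setT (EFin \o (fun w => lf B a w * lf B b w)) /\
  Rintegral P setT (fun w => lf B a w * lf B b w) = lcov H a b.
Proof.
move=> va vb.
pose s : seq R := [:: 1; -1].
pose L e := a ++ lscale e b.
have vL e : lvalid (L e) by rewrite lvalid_cat lvalid_scale va.
have [h1 h2] := integrable_lin_comb s (fun e => e / 4) (fun e => lf_int2 (vL e)).
have E : (fun w => lf B a w * lf B b w) = (fun w => \sum_(e <- s) e / 4 * lf B (L e) w ^+ 2).
  by apply/funext => w; rewrite !big_cons big_nil !lf_cat !lf_scale; field.
rewrite E; split=> //; rewrite h2 !big_cons big_nil !lf_moment2//.
by rewrite !(lcov_catl, lcov_catr, lcov_scalel, lcov_scaler) (lcovC _ b a); field.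
Qed.

(* Polarization of the fourth moment. *)
Lemma lf_isserlis4 a b c e : lvalid a -> lvalid b -> lvalid c -> lvalid e ->
  P.-integrable setT (EFin \o (fun w => lf B a w * lf B b w * (lf B c w * lf B e w))) /\
  Rintegral P setT (fun w => lf B a w * lf B b w * (lf B c w * lf B e w)) =
  lcov H a b * lcov H c e + lcov H a c * lcov H b e + lcov H a e * lcov H b c.
Proof.
move=> va vb vc ve.
(* Summing the signed fourth powers over the eight choices of signs leaves only the monomial a b c
   e, with coefficient 8 * 24 = 192. *)
pose s : seq (R * R * R) := [:: (1, 1, 1); (1, 1, -1); (1, -1, 1); (1, -1, -1);
  (-1, 1, 1); (-1, 1, -1); (-1, -1, 1); (-1, -1, -1)].
pose L (p : R * R * R) := a ++ (lscale p.1.1 b ++ (lscale p.1.2 c ++ lscale p.2 e)).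
have vL p : lvalid (L p) by rewrite !lvalid_cat !lvalid_scale va vb vc.
have [h1 h2] := integrable_lin_comb s (fun p => p.1.1 * p.1.2 * p.2 / 192) (fun p => lf_int4 (vL p)).
have E : (fun w => lf B a w * lf B b w * (lf B c w * lf B e w)) =
    (fun w => \sum_(p <- s) p.1.1 * p.1.2 * p.2 / 192 * lf B (L p) w ^+ 4).
  by apply/funext => w; rewrite !big_cons big_nil !lf_cat !lf_scale /=; field.
rewrite E; split=> //; rewrite h2 !big_cons big_nil !lf_moment4//.
rewrite !(lcov_catl, lcov_catr, lcov_scalel, lcov_scaler)/= (lcovC _ b a) (lcovC _ c a).
rewrite (lcovC _ e a) (lcovC _ c b) (lcovC _ e b) (lcovC _ e c).
by field.
Qed.

End FBmMoments.

(** * Freezing the first process *)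

Section ConditionalGaussian.
Context d (T : measurableType d) (R : realType) (P : probability T R) (H : R) (B1 B2 : R -> T -> R).
Hypotheses (fB1 : is_fBm P H B1) (fB2 : is_fBm P H B2) (B12 : indep_proc P B1 B2).
Implicit Types a b l : seq (R * R).

Let C1m : cylinder B1 `<=` d.-measurable.
Proof. by apply: cylinder_measurable => t; exact: (fBm_measurable fB1). Qed.
Let C2m : cylinder B2 `<=` d.-measurable.
Proof. by apply: cylinder_measurable => t; exact: (fBm_measurable fB2). Qed.

Local Notation T1 := (g_sigma_algebraType (cylinder B1)).
Local Notation T2 := (g_sigma_algebraType (cylinder B2)).

Lemma lf_indep_mul (X Y : T -> R) :
  measurable_fun setT (X : T1 -> R) -> measurable_fun setT (Y : T2 -> R) ->
  P.-integrable setT (EFin \o X) -> P.-integrable setT (EFin \o Y) ->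
  P.-integrable setT (EFin \o (fun w => X w * Y w)) /\
  Rintegral P setT (fun w => X w * Y w) = Rintegral P setT X * Rintegral P setT Y.
Proof.
move=> mX mY iX iY.
apply: (decouple_mul C1m C2m (@cylinderI _ _ _ B1) (@cylinderI _ _ _ B2)
  (@cylinderT _ _ _ B1) (@cylinderT _ _ _ B2) _ mX mY iX iY).
by move=> A C; exact: indep_cylinder.
Qed.

Lemma lf_indep_mul4 a b l l' : lvalid a -> lvalid b -> lvalid l -> lvalid l' ->
  P.-integrable setT (EFin \o (fun w => (lf B1 a w * lf B1 b w) * (lf B2 l w * lf B2 l' w))) /\
  Rintegral P setT (fun w => (lf B1 a w * lf B1 b w) * (lf B2 l w * lf B2 l' w)) =
  lcov H a b * lcov H l l'.
Proof.
move=> va vb vl vl'.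
have [i1 <-] := lf_isserlis2 fB1 va vb; have [i2 <-] := lf_isserlis2 fB2 vl vl'.
apply: lf_indep_mul => //; apply: measurable_funM; exact: lf_measurable_sigma.
Qed.

Variables (delta : nat -> seq (R * R)) (n : nat) (s : R).
Hypothesis vdelta : forall k, lvalid (delta k).
Local Notation r k l := (lcov H (delta k) (delta l)).
Local Notation D1 k w := (lf B1 (delta k) w).
Local Notation D2 k w := (lf B2 (delta k) w).

Definition zsum (w : T) : R := \sum_(k < n) s * (D1 k w * D2 k w).

(** Variance of [zsum] when [B1] is frozen at [w]; [condcov b] is its covariance with [lf B2 b].
    Below, [zvar] turns out to be the mean of both [condvar] and the square of [zsum]. *)
Definition condvar (w : T) : R := \sum_(k < n) \sum_(l < n) (s ^+ 2 * r k l) * (D1 k w * D1 l w).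

Definition condcov b (w : T) : R := \sum_(k < n) (s * lcov H b (delta k)) * D1 k w.

Definition zvar : R := s ^+ 2 * \sum_(k < n) \sum_(l < n) r k l ^+ 2.

(** The indices close up into the cycle k, l, q, p: this is the trace of the fourth power of the
    matrix [s * r], or the squared Hilbert-Schmidt norm of its contraction with itself. *)
Definition zcontr : R := s ^+ 4 * \sum_(k < n) \sum_(l < n) \sum_(p < n) \sum_(q < n)
  (r k l * r p q * (r k p * r l q)).

(** Once [B1] is frozen at [w], the sum of [lf B2 b] and [lam * zsum] is a single linear form in
    [B2], whose coefficients depend on [w]. *)
Definition condlin (b : seq (R * R)) (lam : R) (w : T) : seq (R * R) :=
  b ++ lcomb n (fun k => lam * s * D1 k w) delta.

Lemma condlin_valid b lam w : lvalid b -> lvalid (condlin b lam w).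
Proof. by move=> vb; rewrite lvalid_cat vb lvalid_comb. Qed.

Lemma lf_condlin b lam w w' : lf B2 (condlin b lam w) w' =
  lf B2 b w' + lam * \sum_(k < n) s * (D1 k w * D2 k w').
Proof.
rewrite lf_cat lf_comb mulr_sumr; congr (_ + _).
by apply: eq_bigr => k _; rewrite !mulrA.
Qed.

Lemma lcov_condlin b lam w : lcov H (condlin b lam w) (condlin b lam w) =
  lcov H b b + 2 * lam * condcov b w + lam ^+ 2 * condvar w.
Proof.
rewrite lcov_catl !lcov_catr lcov_combl lcov_combr.
have -> : \sum_(k < n) lam * s * D1 k w * lcov H b (delta k) = lam * condcov b w.
  by rewrite mulr_sumr; apply: eq_bigr => k _; ring.
have -> : \sum_(k < n) lam * s * D1 k w * lcov H (delta k) b = lam * condcov b w.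
  by rewrite mulr_sumr; apply: eq_bigr => k _; rewrite (lcovC _ _ b); ring.
have -> : lcov H (lcomb n (fun k => lam * s * D1 k w) delta)
    (lcomb n (fun k => lam * s * D1 k w) delta) = lam ^+ 2 * condvar w.
  rewrite lcov_combl mulr_sumr; apply: eq_bigr => k _.
  rewrite lcov_combr [LHS]mulr_sumr [RHS]mulr_sumr; apply: eq_bigr => l _; ring.
ring.
Qed.

(* Integrate [B2] out for a frozen path of [B1]. *)
Lemma cond_cos a b lam beta : lvalid a -> lvalid b ->
  Rintegral P setT (fun w => cos (lf B1 a w + lf B2 b w + lam * zsum w + beta)) =
  Rintegral P setT (fun w => cos (lf B1 a w + beta) *
    expR (- ((lcov H b b + 2 * lam * condcov b w + lam ^+ 2 * condvar w) / 2))).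
Proof.
move=> va vb.
pose f (x : T1 * T2) := cos (lf B2 (condlin b lam x.1) x.2 + (lf B1 a x.1 + beta)).
have mf : measurable_fun setT f.
  apply: measurableT_comp; first exact: continuous_measurable_fun (@continuous_cos R).
  have m1 l : lvalid l -> measurable_fun setT (fun x : T1 * T2 => lf B1 l x.1).
    by move=> vl; have h := @lf_measurable_sigma _ _ _ B1 l vl; exact: (measurableT_comp h measurable_fst).
  have m2 l : lvalid l -> measurable_fun setT (fun x : T1 * T2 => lf B2 l x.2).
    by move=> vl; have h := @lf_measurable_sigma _ _ _ B2 l vl; exact: (measurableT_comp h measurable_snd).
  apply: measurable_funD; last by apply: measurable_funD => //; exact: m1.
  under eq_fun do rewrite lf_condlin.
  apply: measurable_funD; first exact: m2.
  apply: measurable_funM => //; apply: measurable_sum => k.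
  by apply: measurable_funM => //; apply: measurable_funM; [exact: m1|exact: m2].
have := decouple_bounded C1m C2m (@cylinderI _ _ _ B1) (@cylinderI _ _ _ B2)
  (@cylinderT _ _ _ B1) (@cylinderT _ _ _ B2) (fun A C => @indep_cylinder _ _ _ P _ _ B12 A C)
  mf (fun x => cos_max _).
rewrite /f/= => h.
transitivity (Rintegral P setT (fun w => cos (lf B2 (condlin b lam w) w + (lf B1 a w + beta)))).
  by apply: eq_Rintegral => w _; rewrite lf_condlin /zsum; congr cos; ring.
rewrite h; apply: eq_Rintegral => w _.
by rewrite (lf_cos fB2) ?condlin_valid// lcov_condlin.
Qed.

End ConditionalGaussian.

Lemma expRN_half_lipschitz (R : realType) (x y : R) : 0 <= x -> 0 <= y ->
  `|expR (- (x / 2)) - expR (- (y / 2))| <= `|x - y| / 2.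
Proof.
wlog xy : x y / x <= y => [hw|] x0 y0.
  have [xy|/ltW yx] := leP x y; first exact: hw.
  by rewrite distrC [X in _ <= X / _]distrC hw.
rewrite ger0_norm; last by rewrite subr_ge0 ler_expR lerN2 ler_pM2r.
rewrite distrC ger0_norm ?subr_ge0//.
have -> : expR (- (y / 2)) = expR (- (x / 2)) * expR (- ((y - x) / 2)).
  by rewrite -expRD; congr expR; field.
have e1 : expR (- (x / 2)) <= 1 by rewrite -expR0 ler_expR oppr_le0 divr_ge0.
have e0 : 0 < expR (- (x / 2)) by exact: expR_gt0.
have := expR_ge1Dx (- ((y - x) / 2)).
set E := expR (- ((y - x) / 2)) => h.
have : expR (- (x / 2)) * (1 - E) <= 1 * ((y - x) / 2).
  have [E1|E1] := leP E 1; first by apply: ler_pM; lra.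
  apply: (@le_trans _ _ 0); last lra.
  by rewrite nmulr_lle0 ?subr_lt0 ?ltW//; rewrite ltW.
lra.
Qed.

(** * Second moments of the conditional variance and covariance *)

Section ConditionalBound.
Context d (T : measurableType d) (R : realType) (P : probability T R) (H : R) (B1 B2 : R -> T -> R).
Hypotheses (fB1 : is_fBm P H B1) (fB2 : is_fBm P H B2) (B12 : indep_proc P B1 B2).
Variables (delta : nat -> seq (R * R)) (n : nat) (s : R).
Hypothesis vdelta : forall k, lvalid (delta k).
Local Notation r k l := (lcov H (delta k) (delta l)).
Local Notation D1 k w := (lf B1 (delta k) w).
Local Notation D2 k w := (lf B2 (delta k) w).
Local Notation Z := (zsum B1 B2 delta n s).
Local Notation V := (condvar H B1 delta n s).
Local Notation C := (condcov H B1 delta n s).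
Local Notation E_ := (Rintegral P setT).
Local Notation intP f := (P.-integrable setT (EFin \o f)).
Local Notation I2 := ('I_n * 'I_n)%type.

Let pairs (F : 'I_n -> 'I_n -> R) : \sum_(k < n) \sum_(l < n) F k l = \sum_(x : I2) F x.1 x.2.
Proof. exact: pair_bigA. Qed.

Let pairsM (F G : I2 -> R) : (\sum_x F x) * (\sum_x G x) = \sum_(z : I2 * I2) F z.1 * G z.2.
Proof.
rewrite mulr_suml -(pair_bigA _ (fun x y => F x * G y))/=.
by apply: eq_bigr => x _; rewrite mulr_sumr.
Qed.

Lemma condvar_int : intP V /\ E_ V = zvar H delta n s.
Proof.
have E : V = (fun w => \sum_(x : I2) (s ^+ 2 * r x.1 x.2) * (D1 x.1 w * D1 x.2 w)).
  by apply/funext => w; rewrite /condvar pairs.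
have [i1 e1] := integrable_lin_comb (index_enum I2) (fun x => s ^+ 2 * r x.1 x.2)
  (fun x => (lf_isserlis2 fB1 (vdelta x.1) (vdelta x.2)).1).
rewrite E; split=> //; rewrite e1 /zvar pairs mulr_sumr; apply: eq_bigr => x _.
by rewrite (lf_isserlis2 fB1 (vdelta x.1) (vdelta x.2)).2 -mulrA -expr2.
Qed.

Lemma zsum_moment2 : intP (fun w => Z w ^+ 2) /\ E_ (fun w => Z w ^+ 2) = zvar H delta n s.
Proof.
have E : (fun w => Z w ^+ 2) = (fun w => \sum_(x : I2) s ^+ 2 *
   ((D1 x.1 w * D1 x.2 w) * (D2 x.1 w * D2 x.2 w))).
  apply/funext => w; rewrite expr2 /zsum mulr_suml -(pair_bigA _ (fun k l : 'I_n => s ^+ 2 *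
    ((D1 k w * D1 l w) * (D2 k w * D2 l w))))/=.
  by apply: eq_bigr => k _; rewrite mulr_sumr; apply: eq_bigr => l _; ring.
have F (x : I2) := lf_indep_mul4 fB1 fB2 B12 (vdelta x.1) (vdelta x.2) (vdelta x.1) (vdelta x.2).
have [i1 e1] := integrable_lin_comb (index_enum I2) (fun x => s ^+ 2) (fun x => (F x).1).
rewrite E; split=> //; rewrite e1 /zvar pairs mulr_sumr; apply: eq_bigr => x _.
by rewrite (F x).2 -expr2.
Qed.

Let quads (F : 'I_n -> 'I_n -> 'I_n -> 'I_n -> R) :
  \sum_(k < n) \sum_(l < n) \sum_(p < n) \sum_(q < n) F k l p q =
  \sum_(z : I2 * I2) F z.1.1 z.1.2 z.2.1 z.2.2.
Proof.
rewrite (pairs (fun k l => \sum_(p < n) \sum_(q < n) F k l p q)).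
rewrite -(pair_bigA _ (fun x y : I2 => F x.1 x.2 y.1 y.2))/=.
by apply: eq_bigr => x _; rewrite pairs.
Qed.

(** Of the three pairings in Isserlis' formula, one factorises into [zvar ^+ 2], and each of the
    other two closes the four kernels into the cycle of [zcontr]. *)
Lemma condvar_moment2 (v : R) : intP (fun w => (V w - v) ^+ 2) /\
  E_ (fun w => (V w - v) ^+ 2) = (zvar H delta n s - v) ^+ 2 + 2 * zcontr H delta n s.
Proof.
have E : (fun w => V w ^+ 2) = (fun w => \sum_(z : I2 * I2)
    ((s ^+ 2 * r z.1.1 z.1.2) * (s ^+ 2 * r z.2.1 z.2.2)) *
     ((D1 z.1.1 w * D1 z.1.2 w) * (D1 z.2.1 w * D1 z.2.2 w))).
  apply/funext => w; rewrite expr2 /condvar pairs pairsM.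
  by apply: eq_bigr => z _; ring.
have F (z : I2 * I2) := lf_isserlis4 fB1 (vdelta z.1.1) (vdelta z.1.2) (vdelta z.2.1) (vdelta z.2.2).
have [i1 e1] := integrable_lin_comb (index_enum (I2 * I2)%type)
  (fun z => (s ^+ 2 * r z.1.1 z.1.2) * (s ^+ 2 * r z.2.1 z.2.2)) (fun z => (F z).1).
rewrite -E in i1 e1.
have e2 : E_ (fun w => V w ^+ 2) = zvar H delta n s ^+ 2 + 2 * zcontr H delta n s.
  rewrite e1; under eq_bigr do rewrite (F _).2 !mulrDr.
  rewrite !big_split/= -addrA; congr (_ + _).
    rewrite /zvar pairs exprMn [X in _ * X]expr2 pairsM mulr_sumr.
    by apply: eq_bigr => z _; ring.
  rewrite mulr_natl mulr2n; congr (_ + _).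
    rewrite /zcontr quads mulr_sumr; apply: eq_bigr => z _; ring.
  rewrite /zcontr quads mulr_sumr.
  (* Exchanging the indices of the second pair turns the last pairing into the previous one. *)
  pose h (z : I2 * I2) : I2 * I2 := (z.1, (z.2.2, z.2.1)).
  rewrite (reindex_inj (h := h)); last by move=> [a [b c]] [a' [b' c']] [-> -> ->].
  apply: eq_bigr => z _ /=.
  by rewrite (lcovC _ (delta z.2.2) (delta z.2.1)); ring.
have [iV eV] := condvar_int.
have i3 : intP (fun w => - 2 * v * V w).
  have := integrableZl measurableT (- 2 * v) iV; exact: eq_integrable.
have i4 : intP (fun w => - 2 * v * V w + v ^+ 2).
  have := integrableD measurableT i3 (finite_measure_integrable_cst P (v ^+ 2) measurableT).
  exact: eq_integrable.
have E2 : (fun w => (V w - v) ^+ 2) = (fun w => V w ^+ 2 + (- 2 * v * V w + v ^+ 2)).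
  by apply/funext => w; ring.
rewrite E2; split.
  have := integrableD measurableT i1 i4; exact: eq_integrable.
rewrite RintegralD// RintegralD//; last exact: finite_measure_integrable_cst.
by rewrite RintegralZl// eV Rintegral_prob_cst e2; ring.
Qed.

(* [E C^2 = E (W U1 U2)] with [W] the contraction of the kernel with itself and
   [U1], [U2] independent copies of [lf b]; no estimate on [lcov b delta] is needed. *)
Lemma condcov_moment2 b (t : R) : lvalid b -> 0 < t ->
  intP (fun w => C b w ^+ 2) /\
  E_ (fun w => C b w ^+ 2) <= (t * lcov H b b ^+ 2 + zcontr H delta n s / t) / 2.
Proof.
move=> vb t0.
have E : (fun w => C b w ^+ 2) = (fun w => \sum_(x : I2)
    ((s * lcov H b (delta x.1)) * (s * lcov H b (delta x.2))) * (D1 x.1 w * D1 x.2 w)).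
  apply/funext => w; rewrite expr2 /condcov mulr_suml -(pair_bigA _ (fun k l : 'I_n =>
   ((s * lcov H b (delta k)) * (s * lcov H b (delta l))) * (D1 k w * D1 l w)))/=.
  by apply: eq_bigr => k _; rewrite mulr_sumr; apply: eq_bigr => l _; ring.
have [i1 e1] := integrable_lin_comb (index_enum I2)
  (fun x => (s * lcov H b (delta x.1)) * (s * lcov H b (delta x.2)))
  (fun x => (lf_isserlis2 fB1 (vdelta x.1) (vdelta x.2)).1).
rewrite E; split=> //; rewrite e1.
(* The independent copies are supplied by [B1] and [B2] themselves. *)
pose W w := \sum_(x : I2) (s ^+ 2 * r x.1 x.2) * (D1 x.1 w * D2 x.2 w).
pose U w := lf B1 b w * lf B2 b w.
have [iW2 eW2] : intP (fun w => W w ^+ 2) /\ E_ (fun w => W w ^+ 2) = zcontr H delta n s.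
  have F (z : I2 * I2) := lf_indep_mul4 fB1 fB2 B12 (vdelta z.1.1) (vdelta z.2.1) (vdelta z.1.2) (vdelta z.2.2).
  have [i2 e2] := integrable_lin_comb (index_enum (I2 * I2)%type)
    (fun z => (s ^+ 2 * r z.1.1 z.1.2) * (s ^+ 2 * r z.2.1 z.2.2)) (fun z => (F z).1).
  have EW : (fun w => W w ^+ 2) = (fun w => \sum_(z : I2 * I2)
    ((s ^+ 2 * r z.1.1 z.1.2) * (s ^+ 2 * r z.2.1 z.2.2)) *
     ((D1 z.1.1 w * D1 z.2.1 w) * (D2 z.1.2 w * D2 z.2.2 w))).
    by apply/funext => w; rewrite expr2 /W pairsM; apply: eq_bigr => z _; ring.
  rewrite EW; split=> //; rewrite e2 /zcontr quads mulr_sumr.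
  by apply: eq_bigr => z _; rewrite (F z).2; ring.
have [iU2 eU2] : intP (fun w => U w ^+ 2) /\ E_ (fun w => U w ^+ 2) = lcov H b b ^+ 2.
  have [] := lf_indep_mul4 fB1 fB2 B12 vb vb vb vb.
  have -> : (fun w => lf B1 b w * lf B1 b w * (lf B2 b w * lf B2 b w)) = (fun w => U w ^+ 2).
    by apply/funext => w; rewrite /U; ring.
  by move=> ? ->; rewrite expr2.
have [iWU eWU] : intP (fun w => W w * U w) /\ E_ (fun w => W w * U w) =
   \sum_(x : I2) (s ^+ 2 * r x.1 x.2) * (lcov H (delta x.1) b * lcov H (delta x.2) b).
  have F (x : I2) := lf_indep_mul4 fB1 fB2 B12 (vdelta x.1) vb (vdelta x.2) vb.
  have [i2 e2] := integrable_lin_comb (index_enum I2) (fun x => s ^+ 2 * r x.1 x.2) (fun x => (F x).1).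
  have EW : (fun w => W w * U w) = (fun w => \sum_(x : I2) (s ^+ 2 * r x.1 x.2) *
     ((D1 x.1 w * lf B1 b w) * (D2 x.2 w * lf B2 b w))).
    by apply/funext => w; rewrite /W /U mulr_suml; apply: eq_bigr => x _; ring.
  by rewrite EW; split=> //; rewrite e2; apply: eq_bigr => x _; rewrite (F x).2.
have -> : \sum_(x : I2) (s * lcov H b (delta x.1)) * (s * lcov H b (delta x.2)) *
    E_ (fun w => D1 x.1 w * D1 x.2 w) = E_ (fun w => W w * U w).
  rewrite eWU; apply: eq_bigr => x _.
  by rewrite (lf_isserlis2 fB1 (vdelta x.1) (vdelta x.2)).2 !(lcovC _ b); ring.
have iB1 : intP (fun w => t / 2 * U w ^+ 2).
  have := integrableZl measurableT (t / 2) iU2; exact: eq_integrable.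
have iB2 : intP (fun w => (2 * t)^-1 * W w ^+ 2).
  have := integrableZl measurableT (2 * t)^-1 iW2; exact: eq_integrable.
(* Young's inequality with weight [t]: the difference of the two sides is a square divided by
   [2 * t]. *)
apply: (@le_trans _ _ (E_ (fun w => t / 2 * U w ^+ 2 + (2 * t)^-1 * W w ^+ 2))).
  apply: le_Rintegral => //.
    have := integrableD measurableT iB1 iB2; exact: eq_integrable.
  move=> w _; rewrite -subr_ge0.
  have -> : t / 2 * U w ^+ 2 + (2 * t)^-1 * W w ^+ 2 - W w * U w = (2 * t)^-1 * (t * U w - W w) ^+ 2.
    by field; rewrite gt_eqF.
  by rewrite mulr_ge0 ?sqr_ge0// invr_ge0 mulr_ge0// ltW.
rewrite RintegralD// !RintegralZl// eU2 eW2 le_eqVlt; apply/orP; left; apply/eqP.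
by field; rewrite gt_eqF.
Qed.

End ConditionalBound.

(** * Error in the trigonometric moments *)

Section CharacteristicBound.
Context d (T : measurableType d) (R : realType) (P : probability T R) (H : R) (B1 B2 : R -> T -> R).
Hypotheses (fB1 : is_fBm P H B1) (fB2 : is_fBm P H B2) (B12 : indep_proc P B1 B2).
Local Notation E_ := (Rintegral P setT).
Local Notation intP f := (P.-integrable setT (EFin \o f)).

(** By [cond_cos] both terms are expectations of the same cosine times exponentials of nonnegative
    variances, and x -> exp(-x/2) is 1/2-Lipschitz there. Young's inequality with the free parameter
    [t] bounds the first absolute moments by second moments without square roots. *)
Lemma zsum_cos_bound (delta : nat -> seq (R * R)) n (s : R) (a b : seq (R * R)) (lam beta v t : R) :
  (forall k, lvalid (delta k)) -> lvalid a -> lvalid b -> 0 <= v -> 0 < t ->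
  `|E_ (fun w => cos (lf B1 a w + lf B2 b w + lam * zsum B1 B2 delta n s w + beta)) -
    E_ (fun w => cos (lf B1 a w + lf B2 b w + beta)) * expR (- (lam ^+ 2 * v / 2))| <=
  `|lam| * (t / 2 + E_ (fun w => condcov H B1 delta n s b w ^+ 2) / (2 * t)) +
  lam ^+ 2 / 2 * (t / 2 + E_ (fun w => (condvar H B1 delta n s w - v) ^+ 2) / (2 * t)).
Proof.
move=> vd va vb v0 t0.
rewrite (cond_cos fB1 fB2 B12)//.
have -> : E_ (fun w => cos (lf B1 a w + lf B2 b w + beta)) =
    E_ (fun w => cos (lf B1 a w + beta) * expR (- (lcov H b b / 2))).
  have := cond_cos fB1 fB2 B12 0 s vd 0 beta va vb.
  under eq_Rintegral do rewrite mul0r addr0.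
  move=> ->; apply: eq_Rintegral => w _.
  by rewrite mulr0 mul0r addr0 expr0n/= mul0r addr0.
set V := condvar H B1 delta n s; set C := condcov H B1 delta n s b.
have mlf l : lvalid l -> measurable_fun setT (lf B1 l).
  exact: (lf_measurable fB1).
have mC : measurable_fun setT C.
  by apply: measurable_sum => k; apply: measurable_funM => //; exact: mlf.
have mV : measurable_fun setT V.
  apply: measurable_sum => k; apply: measurable_sum => l; apply: measurable_funM => //.
  by apply: measurable_funM; exact: mlf.
have mcos : measurable_fun setT (fun w => cos (lf B1 a w + beta)).
  apply: measurableT_comp; first exact: continuous_measurable_fun (@continuous_cos R).
  by apply: measurable_funD => //; exact: mlf.
pose Q w := lcov H b b + 2 * lam * C w + lam ^+ 2 * V w.
(* The exponent is the variance of the linear form [condlin b lam w]. *)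
have Q0 w : 0 <= Q w.
  by rewrite /Q -(lcov_condlin) (lcov_ge0 fB2)// condlin_valid.
have mQ : measurable_fun setT Q.
  apply: measurable_funD; last exact: measurable_funM.
  by apply: measurable_funD => //; exact: measurable_funM.
have mX : measurable_fun setT (fun w => expR (- (Q w / 2))).
  apply: measurableT_comp => //; apply: measurableT_comp => //.
  exact: measurable_funM.
have eX1 (x : R) : 0 <= x -> `|expR (- (x / 2))| <= 1.
  by move=> x0; rewrite ger0_norm ?expR_ge0// -expR0 ler_expR oppr_le0 divr_ge0.
have q0 : 0 <= lcov H b b by exact: (lcov_ge0 fB2).
have q1 : 0 <= lcov H b b + lam ^+ 2 * v by rewrite addr_ge0// mulr_ge0// sqr_ge0.
have i1 : intP (fun w => cos (lf B1 a w + beta) * expR (- (Q w / 2))).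
  apply: (@integrable_bounded _ _ _ P _ 1); first exact: measurable_funM.
  by move=> w; rewrite normrM mulr_ile1 ?normr_ge0 ?cos_max ?eX1.
have i2 : intP (fun w => cos (lf B1 a w + beta) * expR (- (lcov H b b / 2))).
  apply: (@integrable_bounded _ _ _ P _ 1); first exact: measurable_funM.
  by move=> w; rewrite normrM mulr_ile1 ?normr_ge0 ?cos_max ?eX1.
rewrite [X in `|_ - X|]mulrC -RintegralZl//.
have i3 : intP (fun w => expR (- (lam ^+ 2 * v / 2)) *
    (cos (lf B1 a w + beta) * expR (- (lcov H b b / 2)))).
  have := integrableZl measurableT (expR (- (lam ^+ 2 * v / 2))) i2; exact: eq_integrable.
rewrite -RintegralB//.
have [iC _] := condcov_moment2 fB1 fB2 B12 n s vd vb t0; rewrite -/C in iC.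
have [iV _] := condvar_moment2 fB1 n s vd v; rewrite -/V in iV.
have Zl (c : R) f : intP f -> intP (fun w => c * f w).
  by move=> hf; have := integrableZl measurableT c hf; exact: eq_integrable.
have Dl f g : intP f -> intP g -> intP (fun w => f w + g w).
  by move=> hf hg; have := integrableD measurableT hf hg; exact: eq_integrable.
have ic (c : R) : intP (fun=> c) by exact: finite_measure_integrable_cst.
pose G w := `|lam| * (t / 2 + (2 * t)^-1 * C w ^+ 2) +
  lam ^+ 2 / 2 * (t / 2 + (2 * t)^-1 * (V w - v) ^+ 2).
have iG1 : intP (fun w => t / 2 + (2 * t)^-1 * C w ^+ 2) by apply: Dl => //; exact: Zl.
have iG2 : intP (fun w => t / 2 + (2 * t)^-1 * (V w - v) ^+ 2) by apply: Dl => //; exact: Zl.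
have EG : E_ G = `|lam| * (t / 2 + E_ (fun w => C w ^+ 2) / (2 * t)) +
  lam ^+ 2 / 2 * (t / 2 + E_ (fun w => (V w - v) ^+ 2) / (2 * t)).
  rewrite /G RintegralD//; [|exact: Zl|exact: Zl].
  rewrite !RintegralZl// !RintegralD//; [|exact: Zl|exact: Zl].
  by rewrite !RintegralZl// Rintegral_prob_cst !(mulrC (2 * t)^-1).
rewrite -EG; apply: le_Rintegral_abs => //.
- have := integrableB measurableT i1 i3; exact: eq_integrable.
- by apply: Dl; exact: Zl.
move=> w _.
have -> : cos (lf B1 a w + beta) * expR (- (Q w / 2)) - expR (- (lam ^+ 2 * v / 2)) *
    (cos (lf B1 a w + beta) * expR (- (lcov H b b / 2))) =
  cos (lf B1 a w + beta) * (expR (- (Q w / 2)) - expR (- ((lcov H b b + lam ^+ 2 * v) / 2))).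
  rewrite mulrBr; congr (_ - _); rewrite mulrCA -expRD; congr (_ * expR _); ring.
rewrite normrM; apply: (@le_trans _ _ (1 * (`|Q w - (lcov H b b + lam ^+ 2 * v)| / 2))).
  by apply: ler_pM => //; [exact: cos_max|exact: expRN_half_lipschitz].
rewrite mul1r.
have amgm (x : R) : `|x| <= t / 2 + (2 * t)^-1 * x ^+ 2.
  rewrite -(real_normK (num_real x)) -subr_ge0.
  have -> : t / 2 + (2 * t)^-1 * `|x| ^+ 2 - `|x| = (2 * t)^-1 * (`|x| - t) ^+ 2.
    by field; rewrite gt_eqF.
  by rewrite mulr_ge0 ?sqr_ge0// invr_ge0 mulr_ge0// ltW.
have -> : Q w - (lcov H b b + lam ^+ 2 * v) = 2 * lam * C w + lam ^+ 2 * (V w - v).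
  by rewrite /Q; ring.
apply: (@le_trans _ _ (`|lam| * `|C w| + lam ^+ 2 / 2 * `|V w - v|)).
  rewrite ler_pdivrMr//; apply: (le_trans (ler_normD _ _)).
  rewrite (normrM (lam ^+ 2)) (ger0_norm (sqr_ge0 lam)) (normrM (2 * lam)) (normrM 2).
  by rewrite (@ger0_norm _ 2)//; lra.
by apply: lerD; apply: ler_wpM2l => //; rewrite divr_ge0// sqr_ge0.
Qed.

(** The tolerance [tau] is chosen before the increments, their number and the step, so the bound
    survives the passage from Riemann sums to the integral. *)
Lemma zsum_cos_cvg (a b : seq (R * R)) (lam beta v e : R) :
  lvalid a -> lvalid b -> 0 <= v -> 0 < e ->
  exists2 tau : R, 0 < tau & forall (delta : nat -> seq (R * R)) n (s : R),
  (forall k, lvalid (delta k)) ->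
  `|zvar H delta n s - v| <= tau -> zcontr H delta n s <= tau ->
  `|E_ (fun w => cos (lf B1 a w + lf B2 b w + lam * zsum B1 B2 delta n s w + beta)) -
    E_ (fun w => cos (lf B1 a w + lf B2 b w + beta)) * expR (- (lam ^+ 2 * v / 2))| <= e.
Proof.
move=> va vb v0 e0.
pose q0 := lcov H b b.
pose K := `|lam| * (1 + q0 ^+ 2) + 2 * lam ^+ 2.
have K0 : 0 <= K by rewrite /K addr_ge0// mulr_ge0// ?addr_ge0 ?sqr_ge0.
pose t := Num.min 1 (e / (K + 1)).
have t0 : 0 < t by rewrite lt_min ltr01/= divr_gt0// ltr_wpDl.
have t1 : t <= 1 by rewrite ge_min lexx.
have tK : t * K <= e.
  apply: (@le_trans _ _ (t * (K + 1))); first by rewrite ler_wpM2l ?(ltW t0)// lerDl.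
  by rewrite -ler_pdivlMr ?ltr_wpDl// ge_min lexx orbT.
(* [condcov_moment2] is used with weight [t ^+ 3], where [tau / t ^+ 3 = t ^+ 3]; the final division
   by [2 * t] then leaves a positive power of [t] in both error terms. *)
exists (t ^+ 6); first exact: exprn_gt0.
move=> delta n s vd hm hc.
apply: (le_trans (zsum_cos_bound n s lam beta vd va vb v0 t0)).
have t3 : 0 < t ^+ 3 by exact: exprn_gt0.
have [_ hC] := condcov_moment2 fB1 fB2 B12 n s vd vb t3.
have [_ hV] := condvar_moment2 fB1 n s vd v.
have hV' : E_ (fun w => (condvar H B1 delta n s w - v) ^+ 2) / (2 * t) <= t * (3 / 2).
  rewrite hV ler_pdivrMr ?mulr_gt0//.
  have : (zvar H delta n s - v) ^+ 2 <= t ^+ 6 * t ^+ 6.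
    by rewrite -(real_normK (num_real _)) expr2 ler_pM.
  have : t ^+ 6 <= t ^+ 2 by apply: ler_wiXn2l => //; exact: ltW.
  have : t ^+ 6 <= 1 by apply: exprn_ile1 => //; exact: ltW.
  have : 0 <= t ^+ 6 by apply: exprn_ge0; exact: ltW.
  nra.
have hC' : E_ (fun w => condcov H B1 delta n s b w ^+ 2) / (2 * t) <= t * ((1 + q0 ^+ 2) / 4).
  rewrite ler_pdivrMr ?mulr_gt0//; apply: (le_trans hC).
  have : zcontr H delta n s / t ^+ 3 <= t ^+ 3 by rewrite ler_pdivrMr// -exprD.
  have : t ^+ 3 <= t ^+ 2 by apply: ler_wiXn2l => //; exact: ltW.
  have := sqr_ge0 q0; rewrite -/q0; nra.
apply: le_trans tK; rewrite /K.
have l0 := normr_ge0 lam; have l2 := sqr_ge0 lam; have q2 := sqr_ge0 q0.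
have h1 : `|lam| * (t / 2 + E_ (fun w => condcov H B1 delta n s b w ^+ 2) / (2 * t)) <=
  `|lam| * (t * (1 + q0 ^+ 2)).
  by apply: ler_wpM2l => //; apply: (le_trans (lerD (lexx _) hC')); nra.
have h2 : lam ^+ 2 / 2 * (t / 2 + E_ (fun w => (condvar H B1 delta n s w - v) ^+ 2) / (2 * t)) <=
  lam ^+ 2 / 2 * (2 * t).
  by apply: ler_wpM2l; [rewrite divr_ge0|apply: (le_trans (lerD (lexx _) hV')); lra].
by apply: (le_trans (lerD h1 h2)); nra.
Qed.

End CharacteristicBound.

(** * From characteristic functions and tightness to convergence in law *)

Section ProductIntegral.
Context d1 d2 (T1 : measurableType d1) (T2 : measurableType d2) (R : realType).
Context (P1 : probability T1 R) (P2 : probability T2 R).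

Lemma Rintegral_prod_bounded (f : T1 * T2 -> R) (M : R) : measurable_fun setT f ->
  (forall x, `|f x| <= M) ->
  Rintegral (P1 \x P2)%E setT f =
  Rintegral P1 setT (fun x => Rintegral P2 setT (fun y => f (x, y))).
Proof.
move=> mf fM.
have i_f := integrable_bounded (P1 \x P2)%E mf fM.
have mf2 x : measurable_fun setT (fun y => f (x, y)).
  by apply: (measurableT_comp mf); exact: measurable_fun_pair.
have GE : fubini_F P2 (EFin \o f) = (fun x => (Rintegral P2 setT (fun y => f (x, y)))%:E).
  apply/funext => x; rewrite /fubini_F /Rintegral /= fineK//.
  by apply: integrable_fin_num => //; exact: integrable_bounded.
by rewrite {1}/Rintegral -(integral12_prod_meas1 i_f) GE.
Qed.

Lemma Rintegral_prod_fst (f : T1 -> R) (M : R) : measurable_fun setT f ->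
  (forall x, `|f x| <= M) ->
  Rintegral (P1 \x P2)%E setT (fun x => f x.1) = Rintegral P1 setT f.
Proof.
move=> mf fM; rewrite (@Rintegral_prod_bounded _ M) => [|| x]; last exact: fM.
  by apply: eq_Rintegral => x _; rewrite /= Rintegral_prob_cst.
exact: (measurableT_comp mf measurable_fst).
Qed.

Lemma Rintegral_prod_snd (f : T2 -> R) (M : R) : measurable_fun setT f ->
  (forall x, `|f x| <= M) ->
  Rintegral (P1 \x P2)%E setT (fun x => f x.2) = Rintegral P2 setT f.
Proof.
move=> mf fM; rewrite (@Rintegral_prod_bounded _ M) => [|| x]; last exact: fM.
  by rewrite -[RHS](Rintegral_prob_cst P1); apply: eq_Rintegral.
exact: (measurableT_comp mf measurable_snd).
Qed.

End ProductIntegral.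

Section CharacteristicToLaw.
Context d (T : measurableType d) (R : realType) (P : probability T R) (B1 B2 : R -> T -> R).
Hypotheses (mB1 : forall t, 0 <= t -> measurable_fun setT (B1 t))
  (mB2 : forall t, 0 <= t -> measurable_fun setT (B2 t)).
Hypotheses (cB1 : forall w, {within `[0, +oo[, continuous (B1 ^~ w)})
  (cB2 : forall w, {within `[0, +oo[, continuous (B2 ^~ w)}).
Variables (Z : R -> T -> R) (v : R).
Hypotheses (v0 : 0 < v) (mZ : forall eps, 0 < eps -> measurable_fun setT (Z eps)).
Local Notation E_ := (Rintegral P setT).
Local Notation N := (normal_prob 0 (Num.sqrt v)).
Local Notation S := (T * measurableTypeR R)%type.
Local Notation PN := (P \x N)%E.

Hypothesis Zcos : forall (a b : seq (R * R)) (lam beta : R), lvalid a -> lvalid b ->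
  E_ (fun w => cos (lf B1 a w + lf B2 b w + lam * Z eps w + beta)) @[eps --> 0^'+] -->
  E_ (fun w => cos (lf B1 a w + lf B2 b w + beta)) * expR (- (lam ^+ 2 * v / 2)).

(** The truncated square is a bounded continuous substitute for the indicator of [|Z|] at least [K];
    it passes from Riemann sums to their limit by bounded convergence. *)
Hypothesis Ztight : forall e, 0 < e -> exists2 K, 0 < K &
  \forall eps \near 0^'+, E_ (fun w => Num.min 1 ((Z eps w / K) ^+ 2)) <= e.

Let sv : 0 < Num.sqrt v. Proof. by rewrite sqrtr_gt0. Qed.

(** The limit is an integral over the product space, which encodes that the normal variable is
    independent of the paths. *)
Definition test_cvg (phi : S -> R) := [/\ measurable_fun setT phi,
  exists M, forall x, `|phi x| <= M &
  E_ (fun w => phi (w, Z eps w)) @[eps --> 0^'+] --> Rintegral PN setT phi].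

Lemma measurable_graph (phi : S -> R) eps : 0 < eps -> measurable_fun setT phi ->
  measurable_fun setT (fun w => phi (w, Z eps w)).
Proof.
move=> e0 mphi; apply: (measurableT_comp mphi).
by apply: measurable_fun_pair => //; exact: mZ.
Qed.

Lemma eq_test_cvg phi psi : phi =1 psi -> test_cvg phi -> test_cvg psi.
Proof. by move=> /funext ->. Qed.

Lemma test_cvgD phi psi : test_cvg phi -> test_cvg psi ->
  test_cvg (fun x => phi x + psi x).
Proof.
move=> [m1 [M1 b1] c1] [m2 [M2 b2] c2]; split.
- exact: measurable_funD.
- by exists (M1 + M2) => x; rewrite (le_trans (ler_normD _ _))// lerD.
rewrite RintegralD//; [|exact: (integrable_bounded PN m1 b1)|exact: (integrable_bounded PN m2 b2)].
apply: cvg_trans (cvgD c1 c2); apply: near_eq_cvg; near=> eps.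
have e0 : 0 < eps by near: eps; exact: nbhs_right_gt.
rewrite /= RintegralD//.
- exact: (integrable_bounded P (measurable_graph e0 m1) (fun w => b1 _)).
- exact: (integrable_bounded P (measurable_graph e0 m2) (fun w => b2 _)).
Unshelve. all: by end_near. Qed.

Lemma test_cvgZ c phi : test_cvg phi -> test_cvg (fun x => c * phi x).
Proof.
move=> [m1 [M1 b1] c1]; split.
- exact: measurable_funM.
- by exists (`|c| * M1) => x; rewrite normrM ler_wpM2l.
rewrite RintegralZl//; last exact: (integrable_bounded PN m1 b1).
apply: cvg_trans (cvgM (cvg_cst c) c1); apply: near_eq_cvg; near=> eps.
have e0 : 0 < eps by near: eps; exact: nbhs_right_gt.
rewrite /= RintegralZl//.
exact: (integrable_bounded P (measurable_graph e0 m1) (fun w => b1 _)).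
Unshelve. all: by end_near. Qed.

(** Real trigonometric polynomials in finitely many coordinates and the last variable. The phase
    [beta] covers sines as well, and the product-to-sum formula makes the class an algebra. *)
Inductive trig : (S -> R) -> Prop :=
| trig_cos a b (lam beta : R) of lvalid a & lvalid b :
    trig (fun x => cos (lf B1 a x.1 + lf B2 b x.1 + lam * x.2 + beta))
| trigD p q of trig p & trig q : trig (fun x => p x + q x)
| trigZ c p of trig p : trig (fun x => c * p x).

Lemma eq_trig p q : p =1 q -> trig p -> trig q.
Proof. by move=> /funext ->. Qed.

Lemma trig_cst c : trig (fun=> c).
Proof.
apply: eq_trig (trigZ c (@trig_cos [::] [::] 0 0 isT isT)) => x.
by rewrite /lf !big_nil mul0r !addr0 cos0 mulr1.
Qed.

Lemma trigM p q : trig p -> trig q -> trig (fun x => p x * q x).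
Proof.
move=> tp; elim: tp q => [a b lam beta va vb q tq|p1 p2 _ IH1 _ IH2 q tq|c p1 _ IH q tq].
- elim: tq => [a' b' lam' beta' va' vb'|q1 q2 _ IH1 _ IH2|c q1 _ IH].
  + have vD : lvalid (a ++ a') && lvalid (b ++ b') by rewrite !lvalid_cat va va' vb vb'.
    have vB : lvalid (a ++ lscale (-1) a') && lvalid (b ++ lscale (-1) b').
      by rewrite !lvalid_cat !lvalid_scale va va' vb vb'.
    case/andP: vD => vD1 vD2; case/andP: vB => vB1 vB2.
    have := trigZ 2^-1 (trigD (trig_cos (lam + lam') (beta + beta') vD1 vD2)
      (trig_cos (lam - lam') (beta - beta') vB1 vB2)).
    apply: eq_trig => x; rewrite !lf_cat !lf_scale.
    set A := lf B1 a _ + lf B2 b _ + _ + beta; set A' := lf B1 a' _ + lf B2 b' _ + _ + beta'.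
    rewrite (_ : cos _ + cos _ = cos (A + A') + cos (A - A')); last first.
      by congr (cos _ + cos _); rewrite /A /A'; ring.
    by rewrite cosD cosB; field.
  + by apply: eq_trig (trigD IH1 IH2) => x; rewrite mulrDr.
  + by apply: eq_trig (trigZ c IH) => x; rewrite mulrCA.
- by apply: eq_trig (trigD (IH1 q tq) (IH2 q tq)) => x; rewrite mulrDl.
- by apply: eq_trig (trigZ c (IH q tq)) => x; rewrite mulrA.
Qed.

Lemma trig_sinu s a b (lam : R) : lvalid a -> lvalid b ->
  trig (fun x => sinu s (lf B1 a x.1 + lf B2 b x.1 + lam * x.2)).
Proof.
move=> va vb; have va' : lvalid (lscale s^-1 a) by rewrite lvalid_scale.
have vb' : lvalid (lscale s^-1 b) by rewrite lvalid_scale.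
have := trigZ 2^-1 (trigD (trig_cst 1) (trig_cos (s^-1 * lam) (- (pi / 2)) va' vb')).
apply: eq_trig => x; rewrite /sinu !lf_scale mulrC; congr ((_ + _) / _).
rewrite cosBpihalf; congr sin.
move: (lf B1 a x.1) (lf B2 b x.1) (x.2 : R) => A B C; ring.
Qed.

Lemma trig_test_cvg p : trig p -> test_cvg p.
Proof.
elim=> [a b lam beta va vb|p1 p2 _ h1 _ h2|c p1 _ h]; last 2 first.
- exact: test_cvgD.
- exact: test_cvgZ.
have ml1 a' : lvalid a' -> measurable_fun setT (lf B1 a').
  move=> va'; apply: (@measurable_fun_of_sigma _ _ (cylinder B1)); last exact: lf_measurable_sigma.
  exact: cylinder_measurable.
have ml2 a' : lvalid a' -> measurable_fun setT (lf B2 a').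
  move=> va'; apply: (@measurable_fun_of_sigma _ _ (cylinder B2)); last exact: lf_measurable_sigma.
  exact: cylinder_measurable.
have mcos d' (T' : measurableType d') (f : T' -> R) : measurable_fun setT f -> measurable_fun setT (fun x => cos (f x)).
  by move=> mf; apply: measurableT_comp; first exact: continuous_measurable_fun (@continuous_cos R).
have mphi : measurable_fun setT (fun x : S => cos (lf B1 a x.1 + lf B2 b x.1 + lam * x.2 + beta)).
  apply: mcos; apply: measurable_funD => //; apply: measurable_funD; last first.
    by apply: measurable_funM => //; exact: measurable_snd.
  apply: measurable_funD; apply: (measurableT_comp _ measurable_fst); [exact: ml1|exact: ml2].
split=> //; first by exists 1 => x; exact: cos_max.
rewrite (Rintegral_prod_bounded P N mphi (fun x => cos_max _))/=.
have -> : E_ (fun w => Rintegral N setT (fun x => cos (lf B1 a w + lf B2 b w + lam * x + beta))) =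
   E_ (fun w => cos (lf B1 a w + lf B2 b w + beta)) * expR (- (lam ^+ 2 * v / 2)); last exact: Zcos.
rewrite -RintegralZr//; last first.
  apply: (@integrable_bounded _ _ _ P _ 1); last by move=> w; exact: cos_max.
  by apply: mcos; apply: measurable_funD => //; apply: measurable_funD; [exact: ml1|exact: ml2].
apply: eq_Rintegral => w _.
have := normal_cos sv lam (lf B1 a w + lf B2 b w + beta).
rewrite sqr_sqrtr ?ltW// [v * _]mulrC => <-.
by apply: eq_Rintegral => x _; congr cos; ring.
Qed.

(** Stability under trigonometric multipliers is built in: the Bernstein sums below have powers of
    [sinu] as weights, and these must be carried along while their coefficients are approximated in
    turn. *)
Definition trig_test (phi : S -> R) := forall p, trig p -> test_cvg (fun x => p x * phi x).

Lemma trig_test_cst c : trig_test (fun=> c).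
Proof. by move=> p tp; apply: trig_test_cvg; apply: trigM => //; exact: trig_cst. Qed.

(** The recursion of [bern] moves the factors [u] and [1 - u] into the multiplier one at a time. *)
Lemma trig_test_bern n (xi : nat -> S -> R) (u : S -> R) :
  (forall j, trig_test (xi j)) -> trig u -> trig_test (fun x => bern n (xi ^~ x) (u x)).
Proof.
move=> + tu; elim: n xi => [|n IH] xi hxi p tp /=; first exact: hxi.
have tp1 : trig (fun x => p x * u x) by exact: trigM.
have tp2 : trig (fun x => p x * (1 + (-1) * u x)).
  by apply: trigM => //; apply: trigD; [exact: trig_cst|exact: trigZ].
have h1 := IH (fun j => xi j.+1) (fun j => hxi j.+1) _ tp1.
have h2 := IH xi hxi _ tp2.
by apply: eq_test_cvg (test_cvgD h1 h2) => x; ring.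
Qed.

Lemma trig_test_measurable phi : trig_test phi -> measurable_fun setT phi.
Proof.
move=> h; have [m _ _] := h _ (trig_cst 1).
by move: m; under eq_fun do rewrite mul1r.
Qed.

Lemma measurable_slice (xi : T -> R) : measurable_fun setT (fun x : S => xi x.1) ->
  measurable_fun setT xi.
Proof.
move=> m; have := measurableT_comp m (measurable_fun_pair (@measurable_id _ T setT) (measurable_cst (0 : measurableTypeR R))).
by [].
Qed.

(** The functions depend on the sample point alone, whose law does not involve [eps]. Replacing [xi]
    by [xi_ n] therefore costs at most [L * E |xi - xi_ n|], uniformly in [eps] and also under [PN],
    so pointwise bounded convergence is enough. *)
Lemma trig_test_lim (xi_ : nat -> T -> R) (xi : T -> R) (M : R) :
  (forall n, trig_test (fun x => xi_ n x.1)) -> (forall n w, `|xi_ n w| <= M) ->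
  (forall w, xi_ n w @[n --> \oo] --> xi w) -> trig_test (fun x => xi x.1).
Proof.
move=> h hM hc p tp.
have [mp [L pL] _] := trig_test_cvg tp.
have mxi_ n : measurable_fun setT (xi_ n) by exact: measurable_slice (trig_test_measurable (h n)).
have mxi : measurable_fun setT xi by apply: measurable_fun_cvg => // w _; exact: hc.
have xiM w : `|xi w| <= M.
  apply/ler_addgt0Pr => e e0.
  have /cvgrPdist_le/(_ e e0)[n _ /(_ n (leqnn n))/= hn] := hc w.
  by rewrite -(subrK (xi_ n w) (xi w)) addrC (le_trans (ler_normD _ _))// lerD.
have mxi1 : measurable_fun setT (fun x : S => xi x.1) by exact: (measurableT_comp mxi measurable_fst).
have mpx : measurable_fun setT (fun x => p x * xi x.1) by exact: measurable_funM.
have pxM (x : S) : `|p x * xi x.1| <= L * M by rewrite normrM ler_pM.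
split=> //; first by exists (L * M).
have L0 : 0 <= L by exact: le_trans (pL (point, 0)).
pose dn n := E_ (fun w => L * `|xi w - xi_ n w|).
have mdn n : measurable_fun setT (fun w => L * `|xi w - xi_ n w|).
  by apply: measurable_funM => //; apply: measurableT_comp => //; exact: measurable_funB.
have bdn n w : `|L * `|xi w - xi_ n w| | <= L * (M + M).
  by rewrite normrM normr_id (ger0_norm L0) ler_wpM2l// (le_trans (ler_normB _ _))// lerD.
have dn0 : dn n @[n --> \oo] --> 0.
  rewrite -[X in _ --> X](Rintegral_prob_cst P); apply: (@Rintegral_bdct _ _ _ P _ _ (L * (M + M))) => //.
  move=> w; rewrite -(mulr0 L); apply: cvgM; first exact: cvg_cst.
  rewrite -(normr0 R); apply: cvg_norm; rewrite -(subrr (xi w)).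
  by apply: cvgB; [exact: cvg_cst|exact: hc].
apply/cvgrPdist_le => e e0.
have [n hn] : exists n, dn n <= e / 3.
  have /cvgrPdist_le/(_ (e / 3)) := dn0; rewrite divr_gt0// => /(_ isT) [n _ hn].
  by exists n; have := hn n (leqnn n); rewrite /= sub0r normrN; exact: le_trans (ler_norm _).
have [_ _ /cvgrPdist_le/(_ (e / 3))] := h n p tp; rewrite divr_gt0// => /(_ isT) hn'.
near=> eps.
have e1 : 0 < eps by near: eps; exact: nbhs_right_gt.
have mpn : measurable_fun setT (fun x => p x * xi_ n x.1).
  by apply: measurable_funM => //; exact: (measurableT_comp (mxi_ n) measurable_fst).
have pnM (x : S) : `|p x * xi_ n x.1| <= L * M by rewrite normrM ler_pM.
have dd (x : S) : `|p x * xi x.1 - p x * xi_ n x.1| <= L * `|xi x.1 - xi_ n x.1|.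
  by rewrite -mulrBr normrM ler_wpM2r.
have D1 : `|Rintegral PN setT (fun x => p x * xi x.1) - Rintegral PN setT (fun x => p x * xi_ n x.1)| <= e / 3.
  rewrite -RintegralB//; [|exact: (integrable_bounded PN mpx pxM)|exact: (integrable_bounded PN mpn pnM)].
  apply: le_trans hn.
  rewrite /dn -(Rintegral_prod_fst P N (mdn n) (bdn n)).
  apply: le_Rintegral_abs => //.
  - apply: (@integrable_bounded _ _ _ PN _ (L * M + L * M)); first exact: measurable_funB.
    by move=> x; rewrite (le_trans (ler_normB _ _))// lerD.
  - apply: (@integrable_bounded _ _ _ PN _ (L * (M + M))) => [|x]; last exact: bdn.
    exact: (measurableT_comp (mdn n) measurable_fst).
have D2 : `|E_ (fun w => p (w, Z eps w) * xi_ n w) - E_ (fun w => p (w, Z eps w) * xi w)| <= e / 3.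
  have m1 := measurable_graph e1 mpx; have m2 := measurable_graph e1 mpn.
  have b1 w := pxM (w, Z eps w); have b2 w := pnM (w, Z eps w).
  rewrite distrC -RintegralB//; [|exact: (integrable_bounded P m1 b1)|exact: (integrable_bounded P m2 b2)].
  apply: le_trans hn; apply: le_Rintegral_abs => //.
  - apply: (@integrable_bounded _ _ _ P _ (L * M + L * M)); first exact: measurable_funB.
    by move=> x; rewrite (le_trans (ler_normB _ _))// lerD.
  - exact: (integrable_bounded P (mdn n) (bdn n)).
have D3 : `|Rintegral PN setT (fun x => p x * xi_ n x.1) - E_ (fun w => p (w, Z eps w) * xi_ n w)| <= e / 3.
  by near: eps.
rewrite (_ : _ - _ = (Rintegral PN setT (fun x => p x * xi x.1) - Rintegral PN setT (fun x => p x * xi_ n x.1)) +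
  (Rintegral PN setT (fun x => p x * xi_ n x.1) - E_ (fun w => p (w, Z eps w) * xi_ n w)) +
  (E_ (fun w => p (w, Z eps w) * xi_ n w) - E_ (fun w => p (w, Z eps w) * xi w))); last by ring.
by apply: (le_trans (ler_normD _ _)); apply: (le_trans (lerD (ler_normD _ _) (lexx _))); lra.
Unshelve. all: by end_near. Qed.

Definition coord (c : bool * R) : T -> R := if c.1 then B1 c.2 else B2 c.2.

Lemma trig_sinu_coord s c : 0 <= c.2 -> trig (fun x => sinu s (coord c x.1)).
Proof.
move=> c0; pose l := [:: (1 : R, c.2)]; have vl : lvalid l by rewrite /lvalid/= c0.
have := @trig_sinu s (if c.1 then l else [::]) (if c.1 then [::] else l) 0.
case: ifP => c1 /(_ _ _)/(eq_trig _) h; apply: h => // x;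
  by rewrite /coord c1 /lf /l !(big_cons, big_nil)/= mul0r !addr0 ?add0r mul1r.
Qed.

(* Separate continuity suffices since the coordinates are treated one at a time. *)
Lemma trig_test_coords (cs : seq (bool * R)) (f : seq R -> R) (M : R) :
  all (fun c => 0 <= c.2) cs -> (forall s, `|f s| <= M) ->
  (forall s1 s2, continuous (fun x => f (s1 ++ x :: s2))) ->
  trig_test (fun x => f [seq coord c x.1 | c <- cs]).
Proof.
elim: cs f => [|c cs IH] f /=; first by move=> _ _ _; exact: trig_test_cst.
move=> /andP[c0 cs0] fM fc.
pose rest w := [seq coord c w | c <- cs].
pose xi_ n w := trigapx n (fun y => f (y :: rest w)) (coord c w).
apply: (@trig_test_lim xi_ (fun w => f (coord c w :: rest w)) M).
- move=> n; apply: (@trig_test_bern _ (fun j x => f (node n.+1%:R (n.+1 ^ 3) j :: rest x.1))).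
    move=> j; apply: (IH (fun s => f (node n.+1%:R (n.+1 ^ 3) j :: s))) => // s1 s2.
    exact: (fc (_ :: s1)).
  exact: trig_sinu_coord.
- by move=> n w; apply: trigapx_norm => x; exact: fM.
- move=> w; apply: (@trigapx_cvg _ _ M) => [x|]; first exact: fM.
  exact: (fc [::]).
Qed.

(** * Functionals of the paths and of the last variable *)

Variables (Tm : R) (F : (R -> R * R) -> R -> R).
Hypotheses (Tm0 : 0 < Tm) (tF : Cb_test Tm F).
Local Notation Y := (path2 B1 B2).

(** One flat list carries the [m.+1] node values of the first path and then those of the second. The
    default 0 of [nth] gives a meaning to every list, as [trig_test_coords] requires. *)
Definition polypath (m : nat) (s : seq R) (t : R) : R * R :=
  (bern m (fun j => nth 0 s j) (t / Tm), bern m (fun j => nth 0 s (m.+1 + j)) (t / Tm)).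

Lemma continuous_polypath m s : {within `[0, Tm], continuous (polypath m s)}.
Proof.
apply: continuous_subspaceT => t.
have cb (g : nat -> R) : {for t, continuous (fun t : R => bern m g (t / Tm))}.
  apply: (@continuous_bern R m (fun j _ => g j) (fun t => t / Tm)) => [j y|y].
    exact: cvg_cst.
  by apply: cvgM; [exact: cvg_id|exact: cvg_cst].
exact: (@cvg_pair _ _ _ (nbhs t) (nbhs _) (nbhs _) _ _ _ _ _ (cb _) (cb _)).
Qed.

Let t01 t : t \in `[0, Tm] -> 0 <= t / Tm <= 1.
Proof.
by rewrite in_itv/= => /andP[t0 tT]; rewrite divr_ge0 ?(ltW Tm0)//= ler_pdivrMr// mul1r.
Qed.

(** A Bernstein sum is an average of its coefficients, so moving one entry from [y] to [z] moves the
    path by at most [|y - z|] in uniform norm. *)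
Lemma polypath_sepcont m x s1 s2 : continuous (fun y => F (polypath m (s1 ++ y :: s2)) x).
Proof.
have [_ _ cF] := tF.
move=> y; apply/cvgrPdist_lt => e e0.
have [del del0 hdel] := cF _ x (@continuous_polypath m (s1 ++ y :: s2)) e e0.
near=> z; apply: hdel; [exact: continuous_polypath| |by rewrite subrr normr0].
have zy : `|y - z| < del by near: z; apply/nbhs_ballP; exists del.
have nn i : `|nth 0 (s1 ++ y :: s2) i - nth 0 (s1 ++ z :: s2) i| <= `|y - z|.
  rewrite !nth_cat; case: ifP => _; first by rewrite subrr normr0.
  by case: (i - size s1)%N => [//|k] /=; rewrite subrr normr0.
have bb (h : nat -> nat) t : t \in `[0, Tm] ->
    `|bern m (fun j => nth 0 (s1 ++ y :: s2) (h j)) (t / Tm) - bern m (fun j => nth 0 (s1 ++ z :: s2) (h j)) (t / Tm)| < del.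
  move=> tT; apply: le_lt_trans zy.
  rewrite -mulN1r -bernZ -bernD; apply: bern_norm => [|j _]; first exact: t01.
  by rewrite mulN1r.
by move=> t tT; split; [exact: (bb id)|exact: (bb (fun j => (m.+1 + j)%N))].
Unshelve. all: by end_near. Qed.

Lemma path2_continuous w : {within `[0, Tm], continuous (Y w)}.
Proof.
have sub : `[0, Tm] `<=` (`[0, +oo[ : set R).
  by move=> x /=; rewrite !in_itv/= => /andP[->].
have c1 := continuous_subspaceW sub (cB1 (w := w)).
have c2 := continuous_subspaceW sub (cB2 (w := w)).
by move=> t; exact: (@cvg_pair _ _ _ (nbhs t) (nbhs _) (nbhs _) _ _ _ _ _ (c1 t) (c2 t)).
Qed.

Definition path_coords m : seq (bool * R) :=
  [seq (true, Tm * (j%:R / m%:R)) | j <- iota 0 m.+1] ++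
  [seq (false, Tm * (j%:R / m%:R)) | j <- iota 0 m.+1].

Lemma path_coords_ge0 m : all (fun c => 0 <= c.2) (path_coords m).
Proof.
rewrite all_cat !all_map; apply/andP; split; apply/allP => j _ /=;
  by rewrite mulr_ge0 ?divr_ge0// ltW.
Qed.

Lemma polypath_coords m w t : polypath m [seq coord c w | c <- path_coords m] t =
  (bern m (fun j => B1 (Tm * (j%:R / m%:R)) w) (t / Tm),
   bern m (fun j => B2 (Tm * (j%:R / m%:R)) w) (t / Tm)).
Proof.
rewrite /polypath /path_coords map_cat -!map_comp; congr pair; apply: eq_bern => j jm.
  by rewrite nth_cat size_map size_iota ltnS jm (nth_map 0%N) ?size_iota ?ltnS// nth_iota ?ltnS.
have mj : (m.+1 + j < m.+1)%N = false by rewrite ltnNge leq_addr.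
rewrite nth_cat size_map size_iota mj addKn.
by rewrite (nth_map 0%N) ?size_iota ?ltnS// nth_iota ?ltnS.
Qed.

Let FM : exists2 M, 0 <= M & forall f x, `|F f x| <= M.
Proof.
by have [[M hM] _ _] := tF; exists M => //; exact: le_trans (hM (fun=> 0) 0).
Qed.

Lemma trig_test_path x : trig_test (fun y => F (Y y.1) x).
Proof.
have [M M0 hM] := FM; have [_ _ cF] := tF.
apply: (@trig_test_lim (fun m w => F (polypath m [seq coord c w | c <- path_coords m]) x)
  (fun w => F (Y w) x) M) => [m|m w|w]; [|exact: hM|].
  apply: (@trig_test_coords (path_coords m) (fun s => F (polypath m s) x) M) => //.
  - exact: path_coords_ge0.
  - by move=> s1 s2; exact: polypath_sepcont.
apply/cvgrPdist_le => e e0.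
have [del del0 hdel] := cF _ x (@path2_continuous w) e e0.
have d20 : 0 < del / 2 by rewrite divr_gt0.
have sub : `[0, Tm] `<=` (`[0, +oo[ : set R).
  by move=> y /=; rewrite !in_itv/= => /andP[->].
have h1 := bern_segment_unif Tm0 (continuous_subspaceW sub (cB1 (w := w))) d20.
have h2 := bern_segment_unif Tm0 (continuous_subspaceW sub (cB2 (w := w))) d20.
near=> m; apply/ltW; apply: hdel; [exact: continuous_polypath| |by rewrite subrr normr0].
move=> t; rewrite in_itv => tT; rewrite polypath_coords /path2/= ![`|B1 _ _ - _|]distrC ![`|B2 _ _ - _|]distrC.
split; apply: (@le_lt_trans _ _ (del / 2)); try lra; move: t tT.
  by near: m.
by near: m.
Unshelve. all: by end_near. Qed.

(** Trigonometric in the last variable only; its coefficients are values of [F (Y w)] at fixed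
    nodes, which are bounded functionals of the paths covered by [trig_test_path]. *)
Definition Fapx n (x : S) : R := trigapx n (F (Y x.1)) x.2.

Lemma Fapx_test n : test_cvg (Fapx n).
Proof.
have : trig_test (Fapx n).
  apply: (@trig_test_bern _ (fun j x => F (Y x.1) (node n.+1%:R (n.+1 ^ 3) j))).
    by move=> j; exact: trig_test_path.
  have := @trig_sinu n.+1%:R [::] [::] 1 isT isT; apply: eq_trig => x.
  by rewrite /lf !big_nil !add0r mul1r.
move=> /(_ _ (trig_cst 1)); apply: eq_test_cvg => x; exact: mul1r.
Qed.

Let cFY w : continuous (F (Y w)).
Proof.
have [_ _ cF] := tF; move=> x; apply/cvgrPdist_lt => e e0.
have [del del0 hdel] := cF _ x (@path2_continuous w) e e0.
near=> z; apply: hdel; first exact: path2_continuous.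
- by move=> t _; rewrite !subrr !normr0.
- by near: z; apply/nbhs_ballP; exists del.
Unshelve. all: by end_near. Qed.

(** [Cb_test] speaks of continuity only; joint measurability comes from the pointwise approximation
    by [Fapx]. *)
Lemma FY_measurable : measurable_fun setT (fun x : S => F (Y x.1) x.2).
Proof.
have [M M0 hM] := FM.
apply: (@measurable_fun_cvg _ _ _ _ Fapx) => [n|x _]; first by case: (Fapx_test n).
exact: (@trigapx_cvg R (F (Y x.1)) M x.2 (hM _) (@cFY _)).
Qed.

Lemma min1_sqr (K x : R) : 0 <= Num.min 1 ((x / K) ^+ 2) <= 1.
Proof. by rewrite le_min ler01 sqr_ge0/= ge_min lexx. Qed.

Lemma min1_sqr_ge (K x : R) : 0 < K -> K <= `|x| -> Num.min 1 ((x / K) ^+ 2) = 1.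
Proof.
move=> K0 Kx; apply/min_idPl.
by rewrite -real_normK ?num_real// expr_ge1// normrM normfV (gtr0_norm K0) ler_pdivlMr// mul1r.
Qed.

(** Quantifying over rationals makes the set a countable intersection, hence measurable; continuity
    in the last variable recovers the real arguments. *)
Definition good n K e : set T := [set w | forall q : rat, `|ratr q : R| <= K ->
  `|Fapx n (w, ratr q) - F (Y w) (ratr q)| <= e].

Lemma good_measurable n K e : measurable (good n K e).
Proof.
have -> : good n K e = \bigcap_(k : nat) [set w | forall q : rat, choice.pickle q = k -> `|ratr q : R| <= K ->
  `|Fapx n (w, ratr q) - F (Y w) (ratr q)| <= e].
  by apply/seteqP; split => w /= h => [k _ q _|q]; [exact: h|exact: (h (choice.pickle q))].
apply: bigcapT_measurable => k.
have [[q qk]|nq] := pselect (exists q : rat, choice.pickle q = k); last first.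
  rewrite (_ : [set w | _] = setT)//; apply/seteqP; split => // w _ q qk; by case: nq; exists q.
have [qK|qK] := boolP (`|ratr q : R| <= K); last first.
  rewrite (_ : [set w | _] = setT)//; apply/seteqP; split => // w _ q' q'k h.
  case/negP: qK; have <- : q' = q by apply: (pcan_inj choice.pickleK); rewrite qk.
  by [].
rewrite (_ : [set w | _] = setT `&` [set w | `|Fapx n (w, ratr q) - F (Y w) (ratr q)| <= e]).
  have mpair : measurable_fun setT (fun w : T => (w, ratr q) : S) by exact: measurable_fun_pair.
  have [mS _ _] := Fapx_test n.
  apply: measurable_fun_le => //; apply: measurableT_comp => //; apply: measurable_funB.
    exact: (measurableT_comp mS mpair).
  exact: (measurableT_comp FY_measurable mpair).
apply/seteqP; split => w /=; first by move=> h; split=> //; exact: h.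
by move=> [_ h] q' q'k _; have -> : q' = q by apply: (pcan_inj choice.pickleK); rewrite qk.
Qed.

Lemma continuous_Fapx n w : continuous (fun x => Fapx n (w, x)).
Proof.
apply: (@continuous_bern R (n.+1 ^ 3) (fun j _ => F (Y w) (node n.+1%:R (n.+1 ^ 3) j)) (sinu n.+1%:R)) => [j y|y]; first exact: cvg_cst.
rewrite /sinu; apply: cvgM; last exact: cvg_cst.
apply: cvgD; first exact: cvg_cst.
apply: (@continuous_comp _ _ _ (fun y : R => y / n.+1%:R) sin); last exact: continuous_sin.
by apply: cvgM; [exact: cvg_id|exact: cvg_cst].
Qed.

(** A violation at [x] persists on a neighbourhood, which contains a rational still of absolute
    value below [K]; hence the strict inequality. *)
Lemma goodP n K e w : good n K e w -> forall x, `|x| < K -> `|Fapx n (w, x) - F (Y w) x| <= e.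
Proof.
move=> h x xK; rewrite leNgt; apply/negP => lt.
have c : {for x, continuous (fun x => `|Fapx n (w, x) - F (Y w) x|)}.
  by apply: cvg_norm; apply: cvgB; [exact: continuous_Fapx|exact: cFY].
have c' : {for x, continuous (fun x : R => `|x|)} by apply: cvg_norm; exact: cvg_id.
have : \forall y \near x, e < `|Fapx n (w, y) - F (Y w) y| /\ `|y| < K.
  near=> y; split; near: y.
    exact: (cvgr_gt _ c).
  exact: (cvgr_lt _ c').
move=> /nbhs_ballP[r /= r0 hr].
have [q] := @rat_in_itvoo R (x - r) (x + r) ltac:(lra).
rewrite in_itv/= => /andP[q1 q2].
have [|h1 h2] := hr (ratr q).
  by rewrite /ball/= ltr_norml; apply/andP; split; lra.
by have := h q (ltW h2); rewrite leNgt h1.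
Unshelve. all: by end_near. Qed.

Lemma good_cvg K e : 0 < e ->
  E_ (fun w => \1_(~` good n K e) w) @[n --> \oo] --> 0.
Proof.
move=> e0; have [M M0 hM] := FM.
rewrite -[X in _ --> X](Rintegral_prob_cst P); apply: (@Rintegral_bdct _ _ _ P _ _ 1).
- by move=> n; apply: measurable_indic; apply: measurableC; exact: good_measurable.
- move=> w; apply: cvg_near_cst.
  have := @trigapx_unif R (F (Y w)) M K e (hM (Y w)) (@cFY w) e0; apply: filterS => n hn.
  have gw : good n K e w by move=> q qK; exact: hn.
  by rewrite indicE memNset// => h; exact: h gw.
- by move=> n w; rewrite indicE; case: (_ \in _); rewrite ?normr0 ?normr1.
Qed.

(** The trivial bound [2 * M] is paid on bad paths and, through the truncated square, for values
    beyond [K]. *)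
Lemma Fapx_dev n K e M (x : S) : 0 < K -> 0 <= e -> (forall f x, `|F f x| <= M) ->
  `|Fapx n x - F (Y x.1) x.2| <=
  e + 2 * M * \1_(~` good n K e) x.1 + 2 * M * Num.min 1 ((x.2 / K) ^+ 2).
Proof.
move=> K0 e0 hM; have M0 : 0 <= M by exact: le_trans (hM (fun=> 0) 0).
have b2M : `|Fapx n x - F (Y x.1) x.2| <= 2 * M.
  have h1 := hM (Y x.1) x.2; have h2 := @trigapx_norm _ n (F (Y x.1)) M x.2 (hM _).
  by apply: (le_trans (ler_normB _ _)); rewrite /Fapx; lra.
have /andP[m0 m1] := min1_sqr K x.2.
rewrite indicE; have [gx|ngx] := pselect (good n K e x.1); last first.
  rewrite mem_set// mulr1; have : 0 <= 2 * M * Num.min 1 ((x.2 / K) ^+ 2) by rewrite !mulr_ge0.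
  lra.
rewrite memNset; last by move=> h; exact: h gx.
rewrite mulr0 addr0; have [xK|xK] := ltP `|x.2| K.
  have := goodP gx xK; case: x {gx b2M xK m0 m1} => w y /= h.
  by apply: (le_trans h); rewrite lerDl !mulr_ge0//; have /andP[] := min1_sqr K y.
by rewrite min1_sqr_ge// mulr1; lra.
Qed.

Lemma law_cvg : E_ (fun w => F (Y w) (Z eps w)) @[eps --> 0^'+] -->
  E_ (fun w => Rintegral N setT (F (Y w))).
Proof.
have [M M0 hM] := FM.
have mG := FY_measurable.
rewrite -(@Rintegral_prod_bounded _ _ _ _ _ P N _ M mG (fun x => hM _ _)).
apply/cvgrPdist_le => e0 e00.
(* Two replacements of [F] by [Fapx n] cost [(1 + 4 * M) * e] each, and the convergence for [Fapx n]
   costs [e]. *)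
pose e := e0 / (3 + 8 * M).
have M8 : 0 < 3 + 8 * M by lra.
have e1 : 0 < e by rewrite divr_gt0.
have [K1 K10 hK1] := Ztight e1.
(* [K1] serves the tightness of [Z]; [1] and [v / e] ensure [v / K ^+ 2 <= e] for the normal law. *)
pose K := Num.max K1 (Num.max 1 (v / e)).
have K0 : 0 < K by rewrite lt_max K10.
have K1K : K1 <= K by rewrite le_max lexx.
have minK (K' x : R) : 0 < K' -> K' <= K -> Num.min 1 ((x / K) ^+ 2) <= Num.min 1 ((x / K') ^+ 2).
  move=> K'0 K'K; rewrite le_min ge_min lexx/=; rewrite ge_min; apply/orP; right.
  rewrite !expr_div_n ler_wpM2l ?sqr_ge0// lef_pV2 ?posrE ?exprn_gt0//.
  by apply: lerXn2r => //; rewrite nnegrE ltW.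
have mmin d' (T' : measurableType d') (f : T' -> R) (K' : R) : measurable_fun setT f ->
    measurable_fun setT (fun x => Num.min 1 ((f x / K') ^+ 2)).
  move=> mf; apply: measurable_minr => //; apply: measurable_funX.
  exact: measurable_funM.
have bmin (K' x : R) : `|Num.min 1 ((x / K') ^+ 2)| <= 1.
  by have /andP[a b] := min1_sqr K' x; rewrite ger0_norm.
have NK : Rintegral N setT (fun x => Num.min 1 ((x / K) ^+ 2)) <= e.
  have i2 : N.-integrable setT (EFin \o (fun x => x ^+ 2)).
    apply: (@normal_poly4_integrable _ _ sv _ 1); first exact: measurable_funX.
    by move=> x; rewrite mul1r normrX norm_le_poly4.
  apply: (@le_trans _ _ (Rintegral N setT (fun x => (K ^+ 2)^-1 * x ^+ 2))).
    apply: le_Rintegral => //.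
    - apply: (@integrable_bounded _ _ _ N _ 1) => [|x]; last exact: bmin.
      exact: (mmin _ _ id).
    - have := integrableZl measurableT (K ^+ 2)^-1 i2; exact: eq_integrable.
    - by move=> x _; rewrite expr_div_n [_ / _]mulrC ge_min lexx orbT.
  have -> : Rintegral N setT (fun x => (K ^+ 2)^-1 * x ^+ 2) = v / K ^+ 2.
    by rewrite RintegralZl// normal_moment2// sqr_sqrtr ?(ltW v0)// mulrC.
  rewrite ler_pdivrMr ?exprn_gt0//.
  have K1' : 1 <= K by rewrite !le_max lexx orbT.
  have : v / e <= K by rewrite !le_max lexx !orbT.
  rewrite ler_pdivrMr// => h; apply: (le_trans h); rewrite mulrC ler_wpM2l ?(ltW e1)//.
  by rewrite expr2 ler_peMl// ltW.
have mA n : measurable_fun setT (fun w => \1_(~` good n K e) w : R).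
  by apply: measurable_indic; apply: measurableC; exact: good_measurable.
have bA n w : `|\1_(~` good n K e) w : R| <= 1.
  by rewrite indicE; case: (_ \in _); rewrite ?normr0 ?normr1.
(* The index is fixed before [eps]: the probability of the bad paths does not depend on [eps]. *)
have [n hn] : exists n, E_ (fun w => \1_(~` good n K e) w) <= e.
  have /cvgrPdist_le/(_ e e1)[n _ hn] := @good_cvg K e e1.
  by exists n; have := hn n (leqnn n); rewrite /= sub0r normrN; exact: le_trans (ler_norm _).
have [mS [M' bS] cS] := Fapx_test n.
pose D (x : S) := e + 2 * M * \1_(~` good n K e) x.1 + 2 * M * Num.min 1 ((x.2 / K) ^+ 2).
have mmS : measurable_fun setT (fun x : S => Num.min 1 ((x.2 / K) ^+ 2)).
  by apply: mmin; exact: measurable_snd.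
have mAS : measurable_fun setT (fun x : S => \1_(~` good n K e) x.1 : R).
  exact: (measurableT_comp (mA n) measurable_fst).
have Zl d' (T' : measurableType d') (Q : probability T' R) (c : R) f :
    Q.-integrable setT (EFin \o f) -> Q.-integrable setT (EFin \o (fun w => c * f w)).
  by move=> hf; have := integrableZl measurableT c hf; exact: eq_integrable.
have Dl d' (T' : measurableType d') (Q : probability T' R) f g : Q.-integrable setT (EFin \o f) ->
    Q.-integrable setT (EFin \o g) -> Q.-integrable setT (EFin \o (fun w => f w + g w)).
  by move=> hf hg; have := integrableD measurableT hf hg; exact: eq_integrable.
(* Stated for an arbitrary map into the product space, to serve both the limit law ([h] the
   identity) and the law of the pair at [eps] ([h] the graph of [Z eps]). *)
have key d' (T' : measurableType d') (Q : probability T' R) (h : T' -> S) : measurable_fun setT h ->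
    Rintegral Q setT (fun x => \1_(~` good n K e) (h x).1) <= e ->
    Rintegral Q setT (fun x => Num.min 1 (((h x).2 / K) ^+ 2)) <= e ->
    `|Rintegral Q setT (fun x => Fapx n (h x)) - Rintegral Q setT (fun x => F (Y (h x).1) (h x).2)|
      <= (1 + 4 * M) * e.
  move=> mh h1 h2.
  have mSh := measurableT_comp mS mh; have mGh := measurableT_comp mG mh.
  have i1 := integrable_bounded Q mSh (fun x => bS (h x)).
  have i2 := integrable_bounded Q mGh (fun x => hM _ _).
  have i3 := integrable_bounded Q (measurableT_comp mAS mh) (fun x => bA n (h x).1).
  have i4 := integrable_bounded Q (measurableT_comp mmS mh) (fun x => bmin K (h x).2).
  have ic : Q.-integrable setT (EFin \o (fun=> e)) by exact: finite_measure_integrable_cst.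
  rewrite -RintegralB//.
  apply: (@le_trans _ _ (Rintegral Q setT (fun x => D (h x)))).
    apply: le_Rintegral_abs => //.
    - have := integrableB measurableT i1 i2; exact: eq_integrable.
    - by apply: (Dl); [apply: (Dl) => //; exact: (Zl)|exact: (Zl)].
    - by move=> x _; apply: Fapx_dev => //; exact: ltW.
  rewrite /D RintegralD//; [|by apply: (Dl) => //; exact: (Zl)|exact: (Zl)].
  rewrite RintegralD//; last exact: Zl.
  rewrite (Rintegral_prob_cst Q e) !RintegralZl//.
  have : 2 * M * Rintegral Q setT (fun x => \1_(~` good n K e) (h x).1) <= 2 * M * e.
    by rewrite ler_wpM2l// mulr_ge0.
  have : 2 * M * Rintegral Q setT (fun x => Num.min 1 (((h x).2 / K) ^+ 2)) <= 2 * M * e.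
    by rewrite ler_wpM2l// mulr_ge0.
  lra.
have kN : `|Rintegral PN setT (Fapx n) - Rintegral PN setT (fun x => F (Y x.1) x.2)| <= (1 + 4 * M) * e.
  apply: (key _ _ PN id) => //.
    by rewrite (Rintegral_prod_fst P N (mA n) (bA n)).
  by rewrite (@Rintegral_prod_snd _ _ _ _ _ P N (fun y => Num.min 1 ((y / K) ^+ 2)) 1)//; exact: mmin.
move/cvgrPdist_le : cS => /(_ e e1) hS.
near=> eps.
have eps0 : 0 < eps by near: eps; exact: nbhs_right_gt.
have kP : `|E_ (fun w => Fapx n (w, Z eps w)) - E_ (fun w => F (Y w) (Z eps w))| <= (1 + 4 * M) * e.
  apply: (key _ _ P (fun w => (w, Z eps w))) => //.
    by apply: measurable_fun_pair => //; exact: mZ.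
  apply: (@le_trans _ _ (E_ (fun w => Num.min 1 ((Z eps w / K1) ^+ 2)))); last by near: eps.
  apply: le_Rintegral => //.
  - apply: (@integrable_bounded _ _ _ P _ 1) => [|x]; last exact: bmin.
    by apply: mmin; exact: mZ.
  - apply: (@integrable_bounded _ _ _ P _ 1) => [|x]; last exact: bmin.
    by apply: mmin; exact: mZ.
  - by move=> w _; exact: minK.
have kS : `|Rintegral PN setT (Fapx n) - E_ (fun w => Fapx n (w, Z eps w))| <= e by near: eps.
have -> : e0 = (3 + 8 * M) * e by rewrite /e mulrC divfK ?gt_eqF.
rewrite (_ : _ - _ = - (Rintegral PN setT (Fapx n) - Rintegral PN setT (fun x => F (Y x.1) x.2)) +
  (Rintegral PN setT (Fapx n) - E_ (fun w => Fapx n (w, Z eps w))) +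
  (E_ (fun w => Fapx n (w, Z eps w)) - E_ (fun w => F (Y w) (Z eps w)))); last by ring.
apply: (le_trans (ler_normD _ _)); apply: (le_trans (lerD (ler_normD _ _) (lexx _))).
rewrite normrN (_ : (3 + 8 * M) * e = (1 + 4 * M) * e + e + (1 + 4 * M) * e); last by ring.
exact: lerD (lerD kN kS) kP.
Unshelve. all: by end_near. Qed.

End CharacteristicToLaw.

(** * Riemann and Toeplitz sums *)

Section IntegrableRealFunctions.
Context d (T : measurableType d) (R : realType) (mu : {measure set T -> \bar R}).
Context (D : set T) (mD : measurable D) (f g : T -> R).
Hypotheses (i_f : mu.-integrable D (EFin \o f)) (i_g : mu.-integrable D (EFin \o g)).

Lemma integrableB_fun : mu.-integrable D (EFin \o (fun x => f x - g x)).
Proof. by have := integrableB mD i_f i_g; exact: eq_integrable. Qed.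

Lemma integrableZl_fun (c : R) : mu.-integrable D (EFin \o (fun x => c * f x)).
Proof. by have := integrableZl mD c i_f; exact: eq_integrable. Qed.

End IntegrableRealFunctions.

Section RiemannSums.
Context (R : realType).
Notation mu := (@lebesgue_measure R).
Implicit Types (f F : R -> R) (N : R).

Lemma segment_integrable f (a b : R) : {within `[a, b], continuous f} ->
  mu.-integrable `[a, b] (EFin \o f).
Proof. by move=> cf; apply: continuous_compact_integrable => //; exact: segment_compact. Qed.

Lemma Rintegral_oc_cst (a b c : R) : a <= b ->
  Rintegral mu `]a, b] (fun=> c) = c * (b - a).
Proof.
move=> ab; rewrite Rintegral_cst//= (_ : fine _ = b - a)//.
rewrite -[X in fine X]/(lebesgue_measure `]a, b]) lebesgue_measure_itv/= lte_fin.
by move: ab; rewrite le_eqVlt => /predU1P[->|->]//; rewrite ltxx subrr.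
Qed.

Lemma integrable_oc_cst (a b c : R) : mu.-integrable `]a, b] (EFin \o (fun=> c)).
Proof.
have i : mu.-integrable `[a, b] (EFin \o (fun=> c)).
  by apply: segment_integrable; apply: continuous_subspaceT; exact: cst_continuous.
by apply: integrableS i => //; apply: subset_itvr; rewrite bnd_simp.
Qed.

Lemma riemann_sum_dev f N (e d : R) (n : nat) : 0 < N -> (0 < n)%N ->
  {within `[0, N], continuous f} ->
  (forall x y, 0 <= x <= N -> 0 <= y <= N -> `|x - y| < d -> `|f x - f y| <= e) ->
  N / n%:R < d ->
  `|Rintegral mu `[0, N] f - N / n%:R * \sum_(k < n) f (N * k%:R / n%:R)| <= N * e.
Proof.
move=> N0 n0 cf df hd; set h := N / n%:R.
have nR : 0 < n%:R :> R by rewrite ltr0n.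
have h0 : 0 < h by rewrite divr_gt0.
have node k : N * k%:R / n%:R = h * k%:R by rewrite /h mulrAC.
have hn : h * n%:R = N by rewrite /h divfK ?gt_eqF.
have int_f := segment_integrable cf.
have intS (D : set R) : measurable D -> D `<=` `[0, N] -> mu.-integrable D (EFin \o f).
  by move=> mD DN; exact: integrableS int_f.
(* Induction over the initial segments; each cell of length [h] contributes an error of at most
   [h * e]. *)
suff H k : (k <= n)%N ->
    `|Rintegral mu `[0, h * k%:R] f - h * \sum_(j < k) f (h * j%:R)| <= h * k%:R * e.
  rewrite (eq_bigr (fun k : 'I_n => f (h * k%:R))); last by move=> k _; rewrite node.
  by have := H n (leqnn n); rewrite hn.
elim: k => [_|k IH kn].
  by rewrite big_ord0 !mulr0 mul0r subr0 set_itv1 Rintegral_set1 normr0.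
have a0 : 0 <= h * k%:R by rewrite mulr_ge0// ltW.
have ab : h * k%:R <= h * k.+1%:R by rewrite ler_wpM2l ?(ltW h0)// ler_nat.
have bN : h * k.+1%:R <= N by rewrite -hn ler_wpM2l ?(ltW h0)// ler_nat.
have sub : `]h * k%:R, h * k.+1%:R] `<=` `[0, N].
  move=> x /=; rewrite !in_itv/= => /andP[x1 x2].
  by rewrite (le_trans a0 (ltW x1)) (le_trans x2 bN).
have int1 : mu.-integrable `]h * k%:R, h * k.+1%:R] (EFin \o f) by exact: intS.
have int2 := integrable_oc_cst (h * k%:R) (h * k.+1%:R) (f (h * k%:R)).
have int3 := integrable_oc_cst (h * k%:R) (h * k.+1%:R) e.
have hk : h * k.+1%:R - h * k%:R = h by rewrite -mulrBr -natrB ?leqnSn// subSnn mulr1.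
have -> : Rintegral mu `[0, h * k.+1%:R] f =
    Rintegral mu `[0, h * k%:R] f + Rintegral mu `]h * k%:R, h * k.+1%:R] f.
  rewrite -(@Rintegral_itvB _ f (BLeft 0) (BRight (h * k.+1%:R)) (h * k%:R)) ?bnd_simp//.
    by rewrite addrC subrK.
  apply: intS => // x /=; rewrite !in_itv/= => /andP[-> x2].
  by rewrite (le_trans x2 bN).
rewrite big_ord_recr/=.
set I1 := Rintegral mu `[0, _] f; set I2 := Rintegral mu _ f; set S := \sum_(_ < _) _.
have h2 : `|I2 - h * f (h * k%:R)| <= h * e.
  have -> : I2 - h * f (h * k%:R) =
      Rintegral mu `]h * k%:R, h * k.+1%:R] (fun x => f x - f (h * k%:R)).
    by rewrite RintegralB// Rintegral_oc_cst// hk [_ * h]mulrC.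
  have -> : h * e = Rintegral mu `]h * k%:R, h * k.+1%:R] (fun=> e).
    by rewrite Rintegral_oc_cst// hk mulrC.
  apply: le_Rintegral_abs => //.
    by apply: integrableB_fun.
  move=> x xI; have /sub := xI; rewrite /= in_itv/= => xN.
  apply: df => //; first by rewrite a0 (le_trans ab bN).
  move: xI; rewrite /= in_itv/= => /andP[x1 x2].
  rewrite ger0_norm ?subr_ge0 ?(ltW x1)//; apply: le_lt_trans hd.
  by rewrite lerBlDr (le_trans x2)// -lerBlDr hk.
have -> : I1 + I2 - h * (S + f (h * k%:R)) = (I1 - h * S) + (I2 - h * f (h * k%:R)) by ring.
apply: (le_trans (ler_normD _ _)).
rewrite -[k.+1]addn1 natrD mulrDr mulr1 mulrDl; apply: lerD h2.
by apply: IH; exact: ltnW.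
Qed.

Lemma riemann_cvg f N : 0 < N -> {within `[0, N], continuous f} ->
  N / n%:R * \sum_(k < n) f (N * k%:R / n%:R) @[n --> \oo] --> Rintegral mu `[0, N] f.
Proof.
move=> N0 cf; apply/cvgrPdist_le => e e0.
have eN : 0 < e / N by rewrite divr_gt0.
have [d d0 df] := segment_unif_continuous cf eN.
near=> n.
have n0 : (0 < n)%N by near: n; exact: nbhs_infty_gt.
have -> : e = N * (e / N) by rewrite mulrC divfK ?gt_eqF.
apply: (riemann_sum_dev N0 n0 cf df).
rewrite ltr_pdivrMr ?ltr0n// mulrC -ltr_pdivrMr//.
by near: n; exact: nbhs_infty_gtr.
Unshelve. all: by end_near. Qed.

Lemma Rintegral_FTC f F N : 0 <= N -> {within `[0, N], continuous f} ->
  (forall x : R, 0 <= x -> is_derive x 1 F (f x)) ->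
  Rintegral mu `[0, N] f = F N - F 0.
Proof.
rewrite le_eqVlt => /predU1P[<- _ _|N0 cf dF].
  by rewrite set_itv1 Rintegral_set1 subrr.
have cF x : 0 <= x -> {for x, continuous F}.
  by move=> /dF h; apply/differentiable_continuous/derivable1_diffP; exact: ex_derive.
rewrite /Rintegral (@continuous_FTC2 _ f F)//.
- split => /=.
  + by move=> x; rewrite in_itv/= => /andP[x0 _]; have := dF x (ltW x0) => h; exact: ex_derive.
  + by apply: cvg_at_right_filter; exact: cF.
  + by apply: cvg_at_left_filter; apply: cF; exact: ltW.
- move=> x; rewrite in_itv/= => /andP[x0 _]; rewrite derive1E.
  by have := dF x (ltW x0) => h; exact: derive_val.
Qed.

End RiemannSums.

(** * Double sums of a function of the distance *)

Section ToeplitzSums.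
Context (R : realType).
Implicit Types f : nat -> R.

(** One of the two truncated differences vanishes, so this is |k - l|. *)
Definition ndist (k l : nat) : nat := (k - l + (l - k))%N.

Lemma ndistC k l : ndist k l = ndist l k.
Proof. by rewrite /ndist addnC. Qed.

Lemma ndist_row f n : \sum_(l < n) f (ndist n l) = \sum_(j < n) f j.+1.
Proof.
rewrite [LHS](reindex_inj rev_ord_inj)/=; apply: eq_bigr => j _; congr f.
by rewrite /ndist; have := ltn_ord j; lia.
Qed.

(** Distance j occurs n - j times on each side of the diagonal; the diagonal itself occurs only
    once, hence the subtraction. *)
Lemma toeplitz_sum f n :
  \sum_(k < n) \sum_(l < n) f (ndist k l) =
  2 * \sum_(j < n) (n%:R - j%:R) * f j - n%:R * f 0%N.
Proof.
elim: n => [|n IH]; first by rewrite !big_ord0 mulr0 mul0r subrr.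
rewrite big_ord_recr/=.
under eq_bigr do rewrite big_ord_recr/=.
rewrite big_split/= IH big_ord_recr/= /(ndist n n) !subnn addn0.
rewrite [\sum_(i < n) f (ndist i n)](eq_bigr (fun l : 'I_n => f (ndist n l))); last by move=> l _; rewrite ndistC.
rewrite ndist_row.
have -> : \sum_(j < n.+1) (n.+1%:R - j%:R) * f j =
    \sum_(j < n) (n%:R - j%:R) * f j + (\sum_(j < n) f j.+1 + f 0%N).
  rewrite [\sum_(j < n) f _ + _]addrC -(big_ord_recl n (fun j => f (nat_of_ord j))).
  rewrite [X in _ = _ + X]big_ord_recr/= big_ord_recr/= addrA -big_split/=.
  congr (_ + _); last by rewrite -[n.+1]addn1 natrD addrAC subrr add0r mul1r.
  by apply: eq_bigr => j _; rewrite -[n.+1]addn1 natrD; ring.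
by rewrite -[n.+1]addn1 natrD; ring.
Qed.

(** Within one row every distance occurs at most twice. *)
Lemma toeplitz_row_le f n k : (forall j, 0 <= f j) -> (k < n)%N ->
  \sum_(l < n) f (ndist k l) <= 2 * \sum_(j < n) f j.
Proof.
move=> f0 kn.
have le_sum (m : nat) : (m <= n)%N -> \sum_(j < m) f j <= \sum_(j < n) f j.
  move=> mn; rewrite -(subnKC mn) big_split_ord/= lerDl.
  by apply: sumr_ge0 => *; exact: f0.
have -> : \sum_(l < n) f (ndist k l) =
    \sum_(l < k) f (ndist k l) + \sum_(j < n - k) f j.
  have split m : n = (k + m)%N -> \sum_(l < n) f (ndist k l) =
      \sum_(l < k) f (ndist k l) + \sum_(j < m) f j.
    move=> ->; rewrite big_split_ord/=; congr (_ + _).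
    by apply: eq_bigr => j _; congr f; rewrite /ndist; lia.
  by apply: split; rewrite subnKC// ltnW.
rewrite mulr_natl mulr2n; apply: lerD; last by rewrite le_sum// leq_subr.
rewrite ndist_row; apply: le_trans (le_sum k.+1 kn).
by rewrite big_ord_recl lerDr.
Qed.

End ToeplitzSums.

Section ToeplitzCovariance.
Context (R : realType) (H : R) (delta : nat -> seq (R * R)) (n : nat) (s c : R) (g : nat -> R).
Hypothesis cov_delta : forall k l, lcov H (delta k) (delta l) = c * g (ndist k l).

Lemma zvar_toeplitz : zvar H delta n s =
  (s * c) ^+ 2 * (2 * \sum_(j < n) (n%:R - j%:R) * g j ^+ 2 - n%:R * g 0%N ^+ 2).
Proof.
rewrite /zvar -(toeplitz_sum (fun j => g j ^+ 2)) exprMn -[RHS]mulrA; congr (_ * _).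
rewrite [RHS]mulr_sumr; apply: eq_bigr => k _.
by rewrite [RHS]mulr_sumr; apply: eq_bigr => l _; rewrite cov_delta exprMn.
Qed.

(** Of the four kernels in the cycle, two opposite ones are bounded by half the sum of their
    squares. The resulting sums [S] and [S'] are equal by symmetry, and in each the two remaining
    kernels are summed along rows, giving a factor [A] each. *)
Lemma zcontr_toeplitz_le : zcontr H delta n s <=
  (s * c) ^+ 2 * (2 * \sum_(j < n) `|g j|) ^+ 2 * zvar H delta n s.
Proof.
pose G k l := `|g (ndist k l)|.
have G0 k l : 0 <= G k l by exact: normr_ge0.
have GC k l : G k l = G l k by rewrite /G ndistC.
pose S := \sum_(k < n) \sum_(l < n) \sum_(p < n) \sum_(q < n) G k l * G p q * G k p ^+ 2.
pose S' := \sum_(k < n) \sum_(l < n) \sum_(p < n) \sum_(q < n) G k l * G p q * G l q ^+ 2.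
pose A := 2 * \sum_(j < n) `|g j|.
have A0 : 0 <= A by rewrite mulr_ge0// sumr_ge0.
have rowG (k : 'I_n) : \sum_(l < n) G k l <= A.
  by apply: (toeplitz_row_le (f := fun j => `|g j|)).
have SS' : S' = S.
  rewrite /S' exchange_big/=; apply: eq_bigr => k _; apply: eq_bigr => l _.
  rewrite exchange_big/=; apply: eq_bigr => p _; apply: eq_bigr => q _.
  by rewrite [G l k]GC [G q p]GC.
have hS : S <= A ^+ 2 * \sum_(k < n) \sum_(p < n) G k p ^+ 2.
  rewrite /S [leRHS]mulr_sumr; apply: ler_sum => k _.
  apply: (@le_trans _ _ (\sum_(l < n) G k l * (A * \sum_(p < n) G k p ^+ 2))).
    apply: ler_sum => l _; rewrite mulr_sumr mulr_sumr; apply: ler_sum => p _.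
    rewrite (eq_bigr (fun q : 'I_n => G k l * G k p ^+ 2 * G p q)); last by move=> q _; ring.
    rewrite -mulr_sumr -mulrA ler_wpM2l// [leRHS]mulrC ler_wpM2l ?sqr_ge0//.
  rewrite -mulr_suml expr2 -[leRHS]mulrA ler_wpM2r//.
  by rewrite mulr_ge0// sumr_ge0// => p _; exact: sqr_ge0.
have -> : zvar H delta n s = (s * c) ^+ 2 * \sum_(k < n) \sum_(p < n) G k p ^+ 2.
  rewrite /zvar exprMn -[RHS]mulrA; congr (_ * _).
  rewrite [RHS]mulr_sumr; apply: eq_bigr => k _; rewrite [RHS]mulr_sumr; apply: eq_bigr => p _.
  by rewrite cov_delta exprMn /G real_normK// num_real.
have -> : (s * c) ^+ 2 * A ^+ 2 * ((s * c) ^+ 2 * \sum_(k < n) \sum_(p < n) G k p ^+ 2) =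
    (s * c) ^+ 4 * (A ^+ 2 * \sum_(k < n) \sum_(p < n) G k p ^+ 2) by ring.
have sc0 : 0 <= (s * c) ^+ 4 by exact: exprn_even_ge0.
apply: le_trans (ler_wpM2l sc0 hS).
have -> : S = 2^-1 * (S + S') by rewrite SS'; field.
rewrite /zcontr exprMn -[leRHS]mulrA ler_wpM2l ?exprn_even_ge0//.
rewrite /S /S' -big_split/= mulr_sumr mulr_sumr; apply: ler_sum => k _.
rewrite -big_split/= mulr_sumr mulr_sumr; apply: ler_sum => l _.
rewrite -big_split/= mulr_sumr mulr_sumr; apply: ler_sum => p _.
rewrite -big_split/= mulr_sumr mulr_sumr; apply: ler_sum => q _.
rewrite !cov_delta.
set x := g (ndist k l); set y := g (ndist p q); set z := g (ndist k p); set t := g (ndist l q).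
have -> : c * x * (c * y) * (c * z * (c * t)) = c ^+ 4 * (x * y * (z * t)) by ring.
rewrite ler_wpM2l ?exprn_even_ge0// /G -mulrDr.
apply: (le_trans (ler_norm _)); rewrite !normrM.
rewrite [leRHS]mulrCA ler_wpM2l ?mulr_ge0//.
rewrite -/z -/t; have := sqr_ge0 (`|z| - `|t|); rewrite sqrrB; lra.
Qed.

End ToeplitzCovariance.

(** * Correlation of fractional Gaussian noise *)

Section FractionalNoiseCorrelation.
Context (R : realType).
Notation mu := (@lebesgue_measure R).

Lemma continuous_norm_powR (p : R) : 0 < p -> continuous (fun x : R => `|x| `^ p).
Proof.
move=> p0 x; have [->|x0] := eqVneq x 0.
  apply/cvgrPdist_lt => e e0; rewrite normr0 powR0 ?gt_eqF//.
  have d0 : 0 < e `^ p^-1 by exact: powR_gt0.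
  near=> y; rewrite sub0r normrN ger0_norm ?powR_ge0//.
  have -> : e = (e `^ p^-1) `^ p by rewrite -powRrM mulVf ?gt_eqF// powRr1// ltW.
  have yd : `|y| < e `^ p^-1; last by apply: gt0_ltr_powR; rewrite ?nnegrE ?powR_ge0.
  by near: y; apply/nbhs_ballP; exists (e `^ p^-1) => //= y; rewrite /ball/= sub0r normrN.
have nx0 : 0 < `|x| by rewrite normr_gt0.
apply: (@continuous_comp _ _ _ (fun x : R => `|x|) (fun y => y `^ p)).
  exact: norm_continuous.
have h := is_derive1_powR p nx0.
by apply/differentiable_continuous/derivable1_diffP; exact: ex_derive.
Unshelve. all: by end_near. Qed.

Definition rho (H x : R) : R :=
  2^-1 * (`|x + 1| `^ (2 * H) + `|x - 1| `^ (2 * H) - 2 * `|x| `^ (2 * H)).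

Lemma continuous_rho (H : R) : 0 < H -> continuous (rho H).
Proof.
move=> H0 x; have p0 : 0 < 2 * H by rewrite mulr_gt0.
have cp (c : R) : {for x, continuous (fun y : R => `|y + c| `^ (2 * H))}.
  apply: (@continuous_comp _ _ _ (fun y : R => y + c) (fun y => `|y| `^ (2 * H))).
    by apply: continuousD; [exact: cvg_id|exact: cst_continuous].
  exact: continuous_norm_powR.
rewrite /continuous_at /rho; apply: cvgM; first exact: cvg_cst.
apply: cvgB; first by apply: cvgD; exact: cp.
by apply: cvgM; [exact: cvg_cst|exact: continuous_norm_powR].
Qed.

Lemma rhoN (H x : R) : rho H (- x) = rho H x.
Proof.
rewrite /rho (_ : - x + 1 = - (x - 1)) 1?(_ : - x - 1 = - (x + 1)) ?normrN; [|ring|ring].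
by rewrite [`|x - 1| `^ _ + _]addrC.
Qed.

Lemma rho0 (H : R) : 0 < H -> rho H 0 = 1.
Proof.
move=> H0; rewrite /rho add0r sub0r normrN normr1 normr0 powR1 powR0; last first.
  by rewrite mulf_neq0// ?gt_eqF.
by field.
Qed.

(** The linear form B(t + eps) - B(t) at the Riemann node t = T k / n. Its length is [eps] and not
    the mesh, so increments overlap as [n] grows. *)
Definition increment (eps T : R) (n k : nat) : seq (R * R) :=
  [:: (1, T * k%:R / n%:R + eps); (-1, T * k%:R / n%:R)].

Lemma increment_valid (eps T : R) (n k : nat) : 0 <= eps -> 0 <= T -> lvalid (increment eps T n k).
Proof. by move=> e0 T0; rewrite /lvalid/= andbT addr_ge0 ?divr_ge0 ?mulr_ge0. Qed.

Lemma lcov_increment (H eps T : R) (n k l : nat) : 0 < eps ->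
  lcov H (increment eps T n k) (increment eps T n l) =
  eps `^ (2 * H) * rho H (T / eps * (ndist k l)%:R / n%:R).
Proof.
move=> e0; have ne : eps != 0 by rewrite gt_eqF.
rewrite /lcov !big_cons !big_nil/=.
set a := T * k%:R / n%:R; set b := T * l%:R / n%:R.
set x := (b - a) / eps.
have xE : b - a = eps * x by rewrite /x mulrC divfK.
have -> : rho H (T / eps * (ndist k l)%:R / n%:R) = rho H x.
  rewrite /x /a /b -mulrBl -mulrBr; case: (leqP k l) => kl.
    rewrite /ndist (eqP kl) add0n natrB//; congr (rho H _); ring.
  rewrite -rhoN /ndist (eqP (ltnW kl)) addn0 natrB ?(ltnW kl)//; congr (rho H _); ring.
rewrite /fBm_cov /rho.
have sc (y : R) : `|eps * y| `^ (2 * H) = eps `^ (2 * H) * `|y| `^ (2 * H).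
  by rewrite normrM powRM// gtr0_norm.
have -> : b + eps - (a + eps) = eps * x by rewrite -xE; ring.
have -> : b - (a + eps) = eps * (x - 1) by rewrite mulrBr -xE; ring.
have -> : b + eps - a = eps * (x + 1) by rewrite mulrDr -xE; ring.
by rewrite xE !sc; field.
Qed.

End FractionalNoiseCorrelation.

(** * Decay of the correlation *)

Section CorrelationAsymptotics.
Context (R : realType).
Implicit Types (H x a : R).

Lemma is_derive_shift_powR (p c t : R) : 0 < t + c ->
  is_derive t 1 (fun s : R => (s + c) `^ p) (p * (t + c) `^ (p - 1)).
Proof.
move=> tc; have h := is_derive1_powR p tc.
have hs : is_derive t (1 : R) (fun s : R => s + c) 1.
  by apply: is_derive_eq; rewrite addr0.
have := @is_derive1_comp R (fun y : R => y `^ p) (fun s : R => s + c) t _ _ h hs.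
by rewrite mulr1.
Qed.

(* Applying the mean value theorem to t |-> (x+t)^p - (x+t-1)^p on [0,1] and then to the derivative. *)
Lemma rho_mean_value H x : 2 <= x -> exists2 y : R, x - 1 < y < x + 1 &
  rho H x = H * (2 * H - 1) * y `^ (2 * H - 2).
Proof.
move=> x2; set p := 2 * H.
pose g (t : R) := (t + x) `^ p - (t + (x - 1)) `^ p.
pose g1 (t : R) := p * (t + x) `^ (p - 1) - p * (t + (x - 1)) `^ (p - 1).
have dg (t : R) : 0 <= t -> is_derive t 1 g (g1 t).
  by move=> t0; apply: is_deriveB; apply: is_derive_shift_powR; lra.
have cont (f : R -> R) (f' : R -> R) (a b : R) : (forall t : R, a <= t -> is_derive t 1 f (f' t)) ->
    {within `[a, b], continuous f}.
  move=> df; apply: derivable_within_continuous => t; rewrite in_itv/= => /andP[t0 _].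
  by have h := df t t0; exact: ex_derive.
have [c] := MVT ltr01 (fun t ht => dg t (ltW (proj1 (andP ht)))) (cont _ _ _ _ dg).
rewrite in_itv/= => /andP[c0 c1] hc.
pose k (t : R) := p * (t + 0) `^ (p - 1).
have dk (t : R) : c + (x - 1) <= t -> is_derive t 1 k (p * ((p - 1) * (t + 0) `^ (p - 1 - 1))).
  move=> ct; apply: (is_derive_eq (is_deriveZ p (is_derive_shift_powR (p - 1) _)))=> //; lra.
have cx : c + (x - 1) < c + x by lra.
have ctn := cont _ _ _ (c + x) dk.
have [y] := MVT cx (fun t ht => dk t (ltW (proj1 (andP ht)))) ctn.
rewrite in_itv/= => /andP[y0 y1] hy.
exists y; first by apply/andP; split; lra.
have -> : rho H x = 2^-1 * (g 1 - g 0).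
  rewrite /rho /g !ger0_norm; try lra.
  by rewrite !add0r (_ : 1 + (x - 1) = x) 1?[1 + x]addrC; [ring|lra].
rewrite hc /g1 (_ : p * (c + x) `^ (p - 1) - p * (c + (x - 1)) `^ (p - 1) = k (c + x) - k (c + (x - 1))).
  by rewrite hy addr0 (_ : p - 1 - 1 = p - 2) /p; [field|ring].
by rewrite /k !addr0.
Qed.

Lemma rho_le9 H x : 0 < H -> H < 1 -> 0 <= x <= 2 -> `|rho H x| <= 9.
Proof.
move=> H0 H1 /andP[x0 x2].
have pow_le (y c : R) : 0 <= y <= c -> 1 <= c -> 0 <= y `^ (2 * H) <= c ^+ 2.
  move=> /andP[y0 yc] c1; rewrite powR_ge0/=.
  apply: (@le_trans _ _ (c `^ (2 * H))).
    by apply: ge0_ler_powR; rewrite ?nnegrE//; lra.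
  by rewrite -powR_mulrn ?ler_powR//; lra.
have /andP[a0 a1] : 0 <= `|x + 1| `^ (2 * H) <= 3 ^+ 2.
  by apply: pow_le; rewrite ?normr_ge0/= ?ger0_norm; lra.
have /andP[b0 b1] : 0 <= `|x - 1| `^ (2 * H) <= 1 ^+ 2.
  by apply: pow_le; rewrite ?normr_ge0//= ler_norml; lra.
have /andP[c0 c1] : 0 <= `|x| `^ (2 * H) <= 2 ^+ 2.
  by apply: pow_le; rewrite ?normr_ge0/= ?ger0_norm; lra.
by rewrite /rho ler_norml; apply/andP; split; lra.
Qed.

Lemma rho_le_powR H x a : 0 < H -> H < 1 -> 0 <= a -> a <= 1 -> a <= 2 - 2 * H -> 0 <= x ->
  `|rho H x| <= 27 * (1 + x) `^ (- a).
Proof.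
move=> H0 H1 a0 a1 aH x0.
have x1 : 1 <= 1 + x by lra.
have [x2|x2] := leP x 2.
  apply: (@le_trans _ _ 9); first by apply: rho_le9; rewrite ?x0.
  have : 3^-1 <= (1 + x) `^ (- a).
    rewrite powRN lef_pV2 ?posrE ?powR_gt0//; last by lra.
    by apply: le_trans (ler1_powR x1 a1) _; lra.
  lra.
have [y /andP[y1 y2] ->] := rho_mean_value H (ltW x2).
have y0 : 0 < y by lra.
rewrite normrM [`|y `^ _|]ger0_norm ?powR_ge0//.
have hH : `|H * (2 * H - 1)| <= 1.
  by rewrite ler_norml; apply/andP; split; nra.
apply: (@le_trans _ _ (1 * y `^ (2 * H - 2))); first by rewrite ler_wpM2r ?powR_ge0.
rewrite mul1r.
have e1 : (1 + x) `^ (2 * H - 2) <= (1 + x) `^ (- a) by apply: ler_powR => //; lra.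
suff : y `^ (2 * H - 2) <= 9 * (1 + x) `^ (2 * H - 2).
  by have := powR_ge0 (1 + x) (2 * H - 2); lra.
have -> : 2 * H - 2 = - (2 - 2 * H) by ring.
have t3 : (3 : R) `^ (2 - 2 * H) <= 9.
  have -> : (9 : R) = 3 `^ 2%:R by rewrite powR_mulrn//; ring.
  by apply: ler_powR; lra.
have t0 : 0 < (3 : R) `^ (2 - 2 * H) by apply: powR_gt0.
rewrite !powRN.
have hy : (1 + x) `^ (2 - 2 * H) <= 3 `^ (2 - 2 * H) * y `^ (2 - 2 * H).
  rewrite -powRM//; last by lra.
  by apply: ge0_ler_powR; rewrite ?nnegrE; lra.
have hx0 : 0 < (1 + x) `^ (2 - 2 * H) by apply: powR_gt0; lra.
have hy0 : 0 < y `^ (2 - 2 * H) by exact: powR_gt0.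
rewrite -[leLHS]mul1r ler_pdivrMr// mulrAC ler_pdivlMr// mul1r.
by apply: (le_trans hy); rewrite ler_wpM2r// ltW.
Qed.

(** At H = 3/4 the constant H (2H - 1) is 3/8 and the exponent 2H - 2 is -1/2, so [rho ^+ 2] is
    exactly 9/64 over the mean value point, which differs from 1 + x by at most 2. For x <= 2 the
    left side is below 82 and the inverse square at least 1/9: hence 738 = 82 * 9. *)
Lemma rho34_sqr x : 0 <= x ->
  `|rho (3 / 4) x ^+ 2 - 9 / 64 * (1 + x)^-1| <= 738 * ((1 + x) ^+ 2)^-1.
Proof.
move=> x0; have x1 : 0 < 1 + x by lra.
have [x2|x2] := leP x 2.
  have h9 : `|rho (3 / 4) x| <= 9 by apply: rho_le9; rewrite ?x0//; lra.
  have h81 : rho (3 / 4) x ^+ 2 <= 81.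
    rewrite -real_normK ?num_real// (_ : 81 = 9 ^+ 2); last by ring.
    by apply: lerXn2r; rewrite ?nnegrE.
  have i0 : 0 < (1 + x)^-1 by rewrite invr_gt0.
  have i1 : (1 + x)^-1 <= 1 by rewrite invf_le1//; lra.
  have i2 : 9^-1 <= ((1 + x) ^+ 2)^-1.
    rewrite lef_pV2 ?posrE ?exprn_gt0//; nra.
  have r0 := sqr_ge0 (rho (3 / 4) x).
  by rewrite ler_norml; apply/andP; split; lra.
have [y /andP[y1 y2] ->] := rho_mean_value (3 / 4) (ltW x2).
have y0 : 0 < y by lra.
have -> : (3 / 4 * (2 * (3 / 4) - 1) * y `^ (2 * (3 / 4) - 2)) ^+ 2 = 9 / 64 * y^-1.
  rewrite exprMn (_ : (y `^ _) ^+ 2 = y^-1); first by field; rewrite gt_eqF.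
  rewrite -powR_mulrn ?powR_ge0// -powRrM (_ : (2 * (3 / 4) - 2) * 2%:R = -1); last by field.
  by rewrite powR_inv1// ltW.
have hy : y^-1 - (1 + x)^-1 = (1 + x - y) / (y * (1 + x)) by field; rewrite !gt_eqF.
rewrite -mulrBr hy normrM !ger0_norm; last 2 first.
- by rewrite divr_ge0 ?mulr_ge0//; lra.
- lra.
rewrite mulrA ler_pdivrMr ?mulr_gt0// expr2 invfM.
rewrite (_ : 738 * _ * _ = 738 * y / (1 + x)); last by field; rewrite gt_eqF.
rewrite ler_pdivlMr//; nra.
Qed.

End CorrelationAsymptotics.

(** * Integrals of the correlation and of its square *)

Section CorrelationIntegrals.
Context (R : realType).
Notation mu := (@lebesgue_measure R).
Implicit Types (H N a : R).

Definition corr_l1 H N : R := Rintegral mu `[0, N] (fun x => `|rho H x|).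
(** Half of the double integral of rho(x - y)^2 over [0, N]^2. *)
Definition corr_l2 H N : R := Rintegral mu `[0, N] (fun x => (N - x) * rho H x ^+ 2).

Lemma continuous_rho_norm H : 0 < H -> continuous (fun x : R => `|rho H x|).
Proof.
move=> H0 x; apply: (@continuous_comp _ _ _ (rho H) (fun y : R => `|y|)).
  exact: continuous_rho.
exact: norm_continuous.
Qed.

Lemma continuous_rho_sqr H : 0 < H -> continuous (fun x : R => rho H x ^+ 2).
Proof.
move=> H0 x; apply: (@continuous_comp _ _ _ (rho H) (fun y : R => y ^+ 2)).
  exact: continuous_rho.
exact: exprn_continuous.
Qed.

Lemma continuous_corr_l2 H N : 0 < H -> continuous (fun x : R => (N - x) * rho H x ^+ 2).
Proof.
move=> H0 x; rewrite /continuous_at; apply: cvgM; last exact: continuous_rho_sqr.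
by apply: cvgB; [exact: cvg_cst|exact: cvg_id].
Qed.

Lemma is_derive_add1_powR (b x : R) : 0 <= x ->
  is_derive x 1 (fun t : R => (1 + t) `^ b) (b * (1 + x) `^ (b - 1)).
Proof.
move=> x0; rewrite (_ : (fun t => _) = fun t : R => (t + 1) `^ b).
  by rewrite [1 + x]addrC; apply: is_derive_shift_powR; lra.
by apply/funext => t; rewrite addrC.
Qed.

Lemma continuous_add1_powR (b N : R) : {within `[0, N], continuous (fun x : R => (1 + x) `^ b)}.
Proof.
apply: derivable_within_continuous => x; rewrite in_itv/= => /andP[x0 _].
by have h := is_derive_add1_powR b x0; exact: ex_derive.
Qed.

Lemma corr_l1_le H a N : 0 < H -> H < 1 -> 0 <= a -> a < 1 -> a <= 2 - 2 * H -> 0 <= N ->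
  corr_l1 H N <= 27 / (1 - a) * (1 + N) `^ (1 - a).
Proof.
move=> H0 H1 a0 a1 aH N0.
have b0 : 0 < 1 - a by lra.
have i1 : mu.-integrable `[0, N] (EFin \o (fun x => `|rho H x|)).
  by apply: segment_integrable; apply: continuous_subspaceT; exact: continuous_rho_norm.
have ci : {within `[0, N], continuous (fun x : R => 27 * (1 + x) `^ (- a))}.
  by move=> x; apply: cvgM; [exact: cvg_cst|exact: continuous_add1_powR].
apply: (@le_trans _ _ (Rintegral mu `[0, N] (fun x => 27 * (1 + x) `^ (- a)))).
  apply: le_Rintegral => //; first exact: segment_integrable.
  by move=> x /=; rewrite in_itv/= => /andP[x0 _]; apply: rho_le_powR => //; exact: ltW.
have dF (x : R) : 0 <= x -> is_derive x 1 (fun t : R => 27 / (1 - a) * (1 + t) `^ (1 - a))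
    (27 * (1 + x) `^ (- a)).
  move=> x0; have h := is_derive_add1_powR (1 - a) x0.
  apply: is_derive_eq; rewrite /GRing.scale/= (_ : 1 - a - 1 = - a); last by ring.
  by field; rewrite gt_eqF.
rewrite (Rintegral_FTC N0 ci dF).
by rewrite gerBl mulr_ge0 ?powR_ge0// mulr_ge0// invr_ge0 (ltW b0).
Qed.

(** [corr_l1] is of order at most N^(1-a), and eps (1/eps)^(2-2a) = eps^(2a-1). So the left side
    vanishes in the limit if a > 1/2 is allowed, and stays bounded at a = 1/2. *)
Lemma corr_l1_sqr_le H a (T : R) : 0 < H -> H < 1 -> 0 <= a -> a < 1 -> a <= 2 - 2 * H -> 0 < T ->
  exists2 C : R, 0 <= C & forall eps, 0 < eps -> eps <= T ->
    eps * (2 * corr_l1 H (T / eps)) ^+ 2 <= C * eps `^ (2 * a - 1).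
Proof.
move=> H0 H1 a0 a1 aH T0; have b0 : 0 < 1 - a by lra.
exists ((54 / (1 - a) * (2 * T) `^ (1 - a)) ^+ 2); first exact: sqr_ge0.
move=> eps e0 eT.
have N0 : 0 <= T / eps by rewrite divr_ge0// ltW.
have h := corr_l1_le H0 H1 a0 a1 aH N0.
have I0 : 0 <= corr_l1 H (T / eps) by apply: Rintegral_ge0.
have hN : 1 + T / eps <= 2 * T / eps.
  rewrite ler_pdivlMr// mulrDl divfK ?gt_eqF//; lra.
have hp : (1 + T / eps) `^ (1 - a) <= (2 * T) `^ (1 - a) * (eps `^ (1 - a))^-1.
  apply: (@le_trans _ _ ((2 * T / eps) `^ (1 - a))).
    by apply: ge0_ler_powR; rewrite ?nnegrE; lra.
  rewrite powRM ?invr_ge0//; try lra.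
  by rewrite -(powR_inv1 (ltW e0)) -powRrM mulN1r powRN.
have -> : eps `^ (2 * a - 1) = eps * (eps `^ (1 - a))^-1 ^+ 2.
  rewrite -powRN -powR_mulrn ?powR_ge0// -powRrM.
  rewrite -{2}[eps]powRr1 ?ltW// -powRD; last by rewrite (gt_eqF e0) implybT.
  by congr (_ `^ _); ring.
rewrite [leRHS]mulrCA ler_wpM2l ?(ltW e0)// -exprMn.
apply: lerXn2r; rewrite ?nnegrE ?mulr_ge0 ?invr_ge0 ?powR_ge0 ?(ltW b0)//.
have -> : 54 / (1 - a) = 2 * (27 / (1 - a)) by field; rewrite gt_eqF.
rewrite -!mulrA ler_wpM2l//; apply: (le_trans h).
by rewrite -mulrA ler_wpM2l// ?mulr_ge0// ler_wpM2l// invr_ge0 ltW.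
Qed.

Lemma powR_cvgy0 (b : R) : 0 < b -> (1 + x) `^ (- b) @[x --> +oo%R] --> (0 : R).
Proof.
move=> b0; apply/cvgrPdist_le => e e0; near=> x.
have x0 : e `^ (- b^-1) <= x by near: x; exact: nbhs_pinfty_ge.
have p0 := powR_gt0 (- b^-1) e0.
have x1 : 0 < 1 + x by lra.
rewrite sub0r normrN ger0_norm ?powR_ge0//.
have -> : e = (e `^ (- b^-1)) `^ (- b).
  by rewrite -powRrM mulrNN mulVf ?gt_eqF// powRr1// ltW.
move: (e `^ (- b^-1)) x0 p0 => y x0 p0.
rewrite !powRN lef_pV2 ?posrE ?powR_gt0//.
by apply: ge0_ler_powR; rewrite ?nnegrE; lra.
Unshelve. all: by end_near. Qed.

(** Below 3/4 the decay exponent [a] can be taken above 1/2, so [rho ^+ 2] is dominated by the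
    integrable power with exponent -2a. *)
Lemma rho_sqr_integrable H : 0 < H -> H < 3 / 4 ->
  mu.-integrable `[0, +oo[ (EFin \o (fun x => rho H x ^+ 2)).
Proof.
move=> H0 H34.
have [a [a0 a1 aH]] : exists a : R, [/\ 1 / 2 < a, a <= 1 & a <= 2 - 2 * H].
  have [h|h] := leP H (1 / 2); first by exists 1; split; lra.
  by exists (2 - 2 * H); split; lra.
pose b := 2 * a - 1.
have b0 : 0 < b by rewrite /b; lra.
have [C [C0 CE]] : exists C : R, 0 <= C /\ C = 27 ^+ 2 by exists (27 ^+ 2); rewrite sqr_ge0.
pose f (x : R) := C * (1 + x) `^ (- (2 * a)).
pose F (x : R) := - (C / b) * (1 + x) `^ (- b).
have f0 (x : R) : 0 <= x -> 0 <= f x by move=> _; rewrite mulr_ge0 ?powR_ge0.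
have dF (x : R) : 0 <= x -> is_derive x 1 F (f x).
  move=> x0; have h := is_derive_add1_powR (- b) x0.
  apply: is_derive_eq; rewrite /GRing.scale/= /f (_ : - b - 1 = - (2 * a)); last by rewrite /b; ring.
  by field; rewrite gt_eqF.
have cf (x : R) : 0 <= x -> {for x, continuous f}.
  move=> x0; have h := is_derive_add1_powR (- (2 * a)) x0.
  have hc : {for x, continuous (fun t : R => (1 + t) `^ (- (2 * a)))}.
    by apply/differentiable_continuous/derivable1_diffP; exact: ex_derive.
  by apply: cvgM; [exact: cvg_cst|exact: hc].
have cF (x : R) : 0 <= x -> {for x, continuous F}.
  by move=> x0; have h := dF x x0; apply/differentiable_continuous/derivable1_diffP; exact: ex_derive.
have wcf : {within `[0, +oo[, continuous f}.
  apply/continuous_within_itvcyP; split.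
    by move=> x; rewrite in_itv/= andbT => /ltW; exact: cf.
  by apply: cvg_at_right_filter; exact: cf.
have int_f : mu.-integrable `[0, +oo[ (EFin \o f).
  apply/integrableP; split.
    by apply/measurable_EFinP; apply: subspace_continuous_measurable_fun.
  have -> : (\int[mu]_(x in `[0%R, +oo[) `|(EFin \o f) x| = \int[mu]_(x in `[0%R, +oo[) (f x)%:E)%E.
    apply: eq_integral => x; rewrite inE/= in_itv/= andbT => x0.
    by rewrite ger0_norm ?f0.
  have Fl : F x @[x --> +oo] --> (0 : R).
    by rewrite -(mulr0 (- (C / b))); apply: cvgM; [exact: cvg_cst|exact: powR_cvgy0].
  have F0 : F x @[x --> 0^'+] --> F 0 by apply: cvg_at_right_filter; exact: cF.
  have dF' (x : R) : 0 < x -> derivable F x 1.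
    by move=> /ltW x0; have h := dF x x0; exact: ex_derive.
  have dFE : {in `]0, +oo[%R, F^`()%classic =1 f}.
    move=> x; rewrite in_itv/= andbT => /ltW x0; rewrite derive1E.
    by have h := dF x x0; exact: derive_val.
  by rewrite (ge0_continuous_FTC2y f0 wcf Fl dF' F0 dFE) -EFinB ltry.
apply: (integrable_le _ _ int_f) => //.
  by apply: measurable_funTS; apply: continuous_measurable_fun; exact: continuous_rho_sqr.
move=> x /=; rewrite in_itv/= andbT => x0.
rewrite normrX /f CE.
rewrite (_ : (1 + x) `^ (- (2 * a)) = ((1 + x) `^ (- a)) ^+ 2); last first.
  by rewrite -powR_mulrn ?powR_ge0// -powRrM; congr (_ `^ _); ring.
rewrite -exprMn; apply: lerXn2r; rewrite ?nnegrE ?mulr_ge0 ?powR_ge0//.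
by apply: rho_le_powR => //; lra.
Qed.

Lemma sigmaH2_rho H : 0 < H -> sigmaH2 H = 2 * Rintegral mu `[0, +oo[ (fun x => rho H x ^+ 2).
Proof.
move=> H0; rewrite /sigmaH2.
rewrite (_ : (fun x : R => _) = fun x => 4 * rho H x ^+ 2); last first.
  by apply/funext => x; rewrite /rho; field.
have E : (\int[mu]_x (4 * rho H x ^+ 2)%:E = 4%:E * \int[mu]_x (rho H x ^+ 2)%:E)%E.
  under eq_integral do rewrite EFinM.
  rewrite ge0_integralZl//; last by move=> x _; rewrite lee_fin sqr_ge0.
  apply/measurable_EFinP; apply: continuous_measurable_fun; exact: continuous_rho_sqr.
rewrite /Rintegral E ge0_symfun_integralT; last 3 first.
- by move=> x; exact: sqr_ge0.
- exact: continuous_rho_sqr.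
- by move=> x /=; rewrite rhoN.
rewrite (_ : [set x | 0 <= x] = `[0, +oo[%classic); last by rewrite set_itvcy.
rewrite muleA -EFinM; set I := (\int[mu]_(x in _) _)%E.
have [I_fin|I_nfin] := boolP (I \is a fin_num).
  by rewrite fineM//=; field.
(* If the integral diverges, both sides are 0, the default value of [fine] at infinity. *)
have -> : I = +oo%E.
  apply/eqP; move: I_nfin; rewrite fin_numE negb_and !negbK => /orP[/eqP I_oo|//].
  have : (0 <= I)%E by apply: integral_ge0 => x _; rewrite lee_fin sqr_ge0.
  by rewrite I_oo.
by rewrite gt0_muley ?lte_fin//= !mulr0.
Qed.

(** [rho] is continuous with value 1 at 0, so its square stays above 1/2 near 0. Positivity matters
    because [normal_prob] at standard deviation 0 is not a point mass. *)
Lemma sigmaH2_gt0 H : 0 < H -> H < 3 / 4 -> 0 < sigmaH2 H.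
Proof.
move=> H0 H34; rewrite sigmaH2_rho// mulr_gt0//.
have crho : {for 0, continuous (fun x : R => rho H x ^+ 2)} by exact: continuous_rho_sqr.
have /cvgrPdist_le/(_ 2^-1)[|d /= d0 hd] := crho; first by rewrite invr_gt0.
have i1 := rho_sqr_integrable H0 H34.
have ioc : mu.-integrable `[0, d / 2] (EFin \o (fun x => rho H x ^+ 2)).
  by apply: segment_integrable; apply: continuous_subspaceT; exact: continuous_rho_sqr.
have d2 : (BRight (d / 2) <= +oo%O)%O by [].
have := @Rintegral_itvB _ (fun x => rho H x ^+ 2) (BLeft 0) +oo%O (d / 2) i1.
rewrite bnd_simp => /(_ _ isT) hB.
apply: (@lt_le_trans _ _ (Rintegral mu `[0, d / 2] (fun x => rho H x ^+ 2))); last first.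
  by rewrite -subr_ge0 hB ?divr_ge0 ?(ltW d0)//; apply: Rintegral_ge0 => x _; exact: sqr_ge0.
have ic : mu.-integrable `[0, d / 2] (EFin \o (fun=> 2^-1)).
  by apply: segment_integrable; apply: continuous_subspaceT; exact: cst_continuous.
apply: (@lt_le_trans _ _ (Rintegral mu `[0, d / 2] (fun=> 2^-1))).
  rewrite -Rintegral_itv_obnd_cbnd; last exact: integrable_oc_cst.
  by rewrite Rintegral_oc_cst; lra.
apply: le_Rintegral => // x /=; rewrite in_itv/= => /andP[x0 xd].
have /= := hd x; rewrite sub0r normrN ger0_norm// rho0// expr1n.
by rewrite ler_norml => /(_ _)/andP[]; lra.
Qed.

End CorrelationIntegrals.

(** * Limits of the variance integrals *)

Section CorrelationLimits.
Context (R : realType).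
Notation mu := (@lebesgue_measure R).
Implicit Types (H T eps : R).

(** The moving endpoint is traded for a cutoff factor between 0 and 1 on a fixed half-line, the form
    in which dominated convergence applies. *)
Lemma corr_l2_scale H T eps : 0 < H -> 0 < T -> 0 < eps ->
  eps * (2 * corr_l2 H (T / eps)) =
  2 * T * Rintegral mu `[0, +oo[ (fun x => Num.max 0 (1 - x * (eps / T)) * rho H x ^+ 2).
Proof.
move=> H0 T0 e0; set N := T / eps.
have N0 : 0 < N by rewrite divr_gt0.
have -> : eps / T = N^-1 by rewrite /N invf_div.
have eN : eps * N = T by rewrite /N mulrC divfK ?gt_eqF.
have -> : corr_l2 H N = N * Rintegral mu `[0, N] (fun x => (1 - x * N^-1) * rho H x ^+ 2).
  rewrite -RintegralZl//.
    apply: eq_Rintegral => x _; rewrite [RHS]mulrA; congr (_ * _).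
    by rewrite mulrBr mulr1 mulrCA divff ?mulr1// gt_eqF.
  apply: segment_integrable; apply: continuous_subspaceT => x.
  rewrite /continuous_at; apply: cvgM; last exact: continuous_rho_sqr.
  apply: cvgB; first exact: cvg_cst.
  by apply: cvgM; [exact: cvg_id|exact: cvg_cst].
set I := Rintegral _ _ _.
rewrite (_ : eps * (2 * (N * I)) = 2 * (eps * N) * I); last by ring.
rewrite eN; congr (_ * _).
rewrite /I [LHS]Rintegral_mkcond [RHS]Rintegral_mkcond; congr Rintegral.
apply/funext => x; rewrite /patch !mem_setE !in_itv/= andbT.
have [x0|//] := boolP (0 <= x); have [xN|xN] /= := leP x N.
  by rewrite max_r// subr_ge0 ler_pdivrMr// mul1r.
by rewrite max_l ?mul0r// subr_le0 ler_pdivlMr// mul1r ltW.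
Qed.

Lemma corr_l2_cvg H T : 0 < H -> H < 3 / 4 -> 0 < T ->
  eps * (2 * corr_l2 H (T / eps)) @[eps --> 0^'+] --> T * sigmaH2 H.
Proof.
move=> H0 H34 T0; apply/cvg_at_rightP => u [u0 cu].
rewrite sigmaH2_rho//.
pose f_ (n : nat) (x : R) := Num.max 0 (1 - x * (u n / T)) * rho H x ^+ 2.
rewrite (_ : (fun n => _) = fun n => 2 * T * Rintegral mu `[0, +oo[ (f_ n)); last first.
  by apply/funext => n; rewrite corr_l2_scale.
rewrite mulrCA mulrA; apply: cvgM; first exact: cvg_cst.
have mx : measurable_fun setT (fun x : R => rho H x ^+ 2).
  by apply: continuous_measurable_fun; exact: continuous_rho_sqr.
have mD : measurable (`[0, +oo[ : set (measurableTypeR R)) by exact: measurable_itv.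
have [] // := @Rintegral_dct _ _ R mu _ mD f_ (fun x => rho H x ^+ 2) (fun x => rho H x ^+ 2) _ _
  (rho_sqr_integrable H0 H34).
- move=> n; apply: measurable_funTS; apply: measurable_funM => //.
  apply: measurable_maxr; first exact: measurable_cst.
  by apply: measurable_funB => //; apply: measurable_funM.
- move=> x _; rewrite -[X in _ --> X]mul1r; apply: cvgM; last exact: cvg_cst.
  have hu : 1 - x * (u n / T) @[n --> \oo] --> 1 - x * (0 / T).
    apply: cvgB; first exact: cvg_cst.
    by apply: cvgM; [exact: cvg_cst|apply: cvgM; [exact: cu|exact: cvg_cst]].
  rewrite mul0r mulr0 subr0 in hu.
  have c1 : {for 1, continuous (fun y : R => Num.max 0 y)}.
    by apply: (@continuous_max _ _ (fun=> 0) id); [exact: cvg_cst|exact: cvg_id].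
  rewrite -[X in _ --> X](max_r (@ler01 R)).
  exact: (continuous_cvg _ c1 hu).
- move=> n x; rewrite /= in_itv/= andbT => x0.
  rewrite normrM [`|_ ^+ 2|]ger0_norm ?sqr_ge0// ler_piMl ?sqr_ge0//.
  rewrite ger0_norm ?le_max ?lexx// ge_max ler01/= gerBl mulr_ge0// divr_ge0//; exact: ltW.
Qed.

(** [rho ^+ 2] is replaced by [9 / 64 * (1 + x)^-1], whose weighted integral is explicit. The
    remainder is at most 738 N times the integral of (1 + x)^(-2), hence linear in N and of lower
    order than N ln N. *)
Lemma corr_l2_34 (N : R) : 0 <= N ->
  `|corr_l2 (3 / 4) N - 9 / 64 * ((N + 1) * ln (1 + N) - N)| <= 738 * N.
Proof.
move=> N0; have H0 : 0 < 3 / 4 :> R by [].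
pose f (x : R) := (N - x) * (9 / 64 * (1 + x)^-1).
pose F (x : R) := 9 / 64 * ((N + 1) * ln (1 + x) - x).
pose h (x : R) := 738 * N * ((1 + x) ^+ 2)^-1.
pose G (x : R) := - (738 * N) * (1 + x)^-1.
have d1 (x : R) : is_derive x (1 : R) (fun t : R => 1 + t) 1.
  rewrite (_ : (fun t => 1 + t) = fun t : R => t + 1); last by apply/funext => t; rewrite addrC.
  by apply: is_derive_eq; rewrite addr0.
have dF (x : R) : 0 <= x -> is_derive x 1 F (f x).
  move=> x0; have x1 : 0 < 1 + x by lra.
  have dl := @is_derive1_comp R (@ln R) (fun t : R => 1 + t) x _ _ (is_derive1_ln x1) (d1 x).
  apply: is_derive_eq; rewrite /GRing.scale/= /f; field; rewrite gt_eqF//.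
have dV (x : R) : 0 <= x -> is_derive x 1 (fun t : R => (1 + t)^-1) (- ((1 + x) ^+ 2)^-1).
  move=> x0; have x1 : 1 + x != 0 by rewrite gt_eqF//; lra.
  apply: (is_derive_eq (is_deriveV x1 (d1 x))).
  by rewrite /GRing.scale/= mulr1.
have dG (x : R) : 0 <= x -> is_derive x 1 G (h x).
  move=> x0; have hV := dV x x0.
  by apply: is_derive_eq; rewrite /GRing.scale/= /h; ring.
have cV (x : R) : 0 <= x -> {for x, continuous (fun t : R => (1 + t)^-1)}.
  by move=> x0; have hV := dV x x0; apply/differentiable_continuous/derivable1_diffP; exact: ex_derive.
have wc (g : R -> R) : (forall x : R, 0 <= x -> {for x, continuous g}) -> {within `[0, N], continuous g}.
  by move=> cg; apply: continuous_in_subspaceT => x; rewrite inE/= in_itv/= => /andP[x0 _]; exact: cg.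
have cf : {within `[0, N], continuous f}.
  apply: wc => x x0; rewrite /continuous_at; apply: cvgM.
    by apply: cvgB; [exact: cvg_cst|exact: cvg_id].
  by apply: cvgM; [exact: cvg_cst|exact: cV].
have ch : {within `[0, N], continuous h}.
  apply: wc => x x0; rewrite /continuous_at; apply: cvgM; first exact: cvg_cst.
  rewrite (_ : (fun _ => _) = fun t : R => (1 + t)^-1 * (1 + t)^-1); last first.
    by apply/funext => t; rewrite expr2 invfM.
  by rewrite expr2 invfM; apply: cvgM; exact: cV.
have c2 : {within `[0, N], continuous (fun x : R => (N - x) * rho (3 / 4) x ^+ 2)}.
  by apply: continuous_subspaceT; exact: continuous_corr_l2.
have -> : 9 / 64 * ((N + 1) * ln (1 + N) - N) = Rintegral mu `[0, N] f.
  by rewrite (Rintegral_FTC N0 cf dF) /F addr0 ln1 mulr0 subrr mulr0 subr0.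
have i2 := segment_integrable c2; have i_f := segment_integrable cf.
have ih := segment_integrable ch.
rewrite /corr_l2 -RintegralB//.
apply: (@le_trans _ _ (Rintegral mu `[0, N] h)).
  apply: le_Rintegral_abs => //; first exact: integrableB_fun.
  move=> x /=; rewrite in_itv/= => /andP[x0 xN].
  rewrite /f -mulrBr normrM ger0_norm ?subr_ge0// /h.
  rewrite (_ : 738 * N * _ = N * (738 * ((1 + x) ^+ 2)^-1)); last by ring.
  apply: ler_pM; [by rewrite subr_ge0|exact: normr_ge0|by rewrite gerBl|exact: rho34_sqr].
rewrite (Rintegral_FTC N0 ch dG) /G addr0 invr1.
have : 0 <= (1 + N)^-1 by rewrite invr_ge0; lra.
have K0 : 0 <= 738 :> R by lra.
by move=> i0; have := mulr_ge0 (mulr_ge0 K0 N0) i0; lra.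
Qed.

Lemma lnV_cvg : (ln (1 / eps))^-1 @[eps --> 0^'+] --> (0 : R).
Proof.
apply/cvgrPdist_le => e e0; near=> eps.
have e1 : 0 < eps by near: eps; exact: nbhs_right_gt.
have e2 : eps < expR (- e^-1) by near: eps; apply: nbhs_right_lt; exact: expR_gt0.
have h : e^-1 <= ln (1 / eps).
  rewrite mul1r lnV ?posrE// lerNr -[leRHS](expRK (- e^-1)).
  by rewrite ler_ln ?posrE ?expR_gt0// ltW.
have i0 : 0 < e^-1 by rewrite invr_gt0.
have l0 : 0 < ln (1 / eps) by exact: lt_le_trans h.
by rewrite sub0r normrN ger0_norm ?invr_ge0 ?(ltW l0)// -[leRHS]invrK lef_pV2 ?posrE.
Unshelve. all: by end_near. Qed.

(** With L = ln(1/eps) and N = T/eps, ln(1 + N) = ln(T + eps) + L. The coefficient of L gives 9 (T +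
    eps) / 32, and everything else is bounded by the constant [K] over L. *)
Lemma corr_l2_34_cvg T : 0 < T ->
  eps / ln (1 / eps) * (2 * corr_l2 (3 / 4) (T / eps)) @[eps --> 0^'+] --> 9 * T / 32.
Proof.
move=> T0.
pose K := 2 * 738 * T + 9 / 32 * ((T + 1) * (`|ln T| + `|ln (T + 1)|) + T).
have cK : 9 / 32 * eps + K * (ln (1 / eps))^-1 @[eps --> 0^'+] --> (9 / 32 * 0 + K * 0).
  apply: cvgD.
    by apply: cvgM; [exact: cvg_cst|apply: cvg_at_right_filter; exact: cvg_id].
  by apply: cvgM; [exact: cvg_cst|exact: lnV_cvg].
apply/cvgrPdist_le => e e0.
move: cK; rewrite !mulr0 addr0 => /cvgrPdist_le/(_ e e0) hK.
near=> eps.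
have e1 : 0 < eps by near: eps; exact: nbhs_right_gt.
have e2 : eps < 1 by near: eps; exact: nbhs_right_lt.
have l0 : 0 < ln (1 / eps) by rewrite ln_gt0// mul1r invf_gt1.
have hk : `|0 - (9 / 32 * eps + K / ln (1 / eps))| <= e by near: eps.
set L := ln (1 / eps) in l0 hk *.
set N := T / eps.
have N0 : 0 <= N by rewrite divr_ge0// ltW.
have eN : eps * N = T by rewrite /N mulrC divfK ?gt_eqF.
have lnN : ln (1 + N) = ln (T + eps) + L.
  rewrite /L -lnM ?posrE ?divr_gt0//; last by rewrite addr_gt0.
  by congr ln; rewrite mul1r mulrDl divff ?gt_eqF// addrC.
have hl : `|ln (T + eps)| <= `|ln T| + `|ln (T + 1)|.
  have a1 : ln T <= ln (T + eps) by rewrite ler_ln ?posrE//; lra.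
  have a2 : ln (T + eps) <= ln (T + 1) by rewrite ler_ln ?posrE//; lra.
  have := ler_norm (ln (T + 1)); have := ler_norm (- ln T); rewrite normrN => b1 b2.
  have := normr_ge0 (ln T); have := normr_ge0 (ln (T + 1)) => c1 c2.
  by rewrite ler_norml; apply/andP; split; lra.
have h := corr_l2_34 N0.
set I := corr_l2 _ _ in h *.
apply: le_trans hk; rewrite sub0r normrN; apply: le_trans (ler_norm _).
have -> : 9 * T / 32 - eps / L * (2 * I) =
    - (9 / 32 * eps) - (2 * eps * (I - 9 / 64 * ((N + 1) * ln (1 + N) - N)) +
    9 / 32 * ((T + eps) * ln (T + eps) - T)) * L^-1.
  by rewrite lnN -eN; field; rewrite gt_eqF.
apply: (le_trans (ler_normB _ _)).
rewrite normrN ger0_norm; last by rewrite mulr_ge0// ltW.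
rewrite lerD2l normrM [`|L^-1|]ger0_norm ?invr_ge0 ?(ltW l0)//.
rewrite ler_wpM2r ?invr_ge0 ?(ltW l0)//.
apply: (le_trans (ler_normD _ _)); apply: lerD.
  rewrite normrM ger0_norm ?mulr_ge0 ?(ltW e1)// -eN.
  rewrite (_ : 2 * 738 * (eps * N) = 2 * eps * (738 * N)); last by ring.
  by rewrite ler_wpM2l// mulr_ge0// ltW.
rewrite normrM ger0_norm// ler_wpM2l//.
apply: (le_trans (ler_normB _ _)); rewrite [`|T|]gtr0_norm// lerD2r normrM.
rewrite ger0_norm; last by rewrite addr_ge0// ltW.
by apply: ler_pM => //; [rewrite addr_ge0// ltW|lra].
Unshelve. all: by end_near. Qed.

End CorrelationLimits.

(** * The limit theorem *)

Section CovarianceLimits.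
Context (R : realType) (H T : R).
Hypotheses (H0 : 0 < H) (T0 : 0 < T).
Implicit Types (c eps : R).

Definition rstep c eps (n : nat) : R := c / eps ^+ 2 * (T / n%:R).

Notation zvar_ c eps n := (zvar H (increment eps T n) n (rstep c eps n)).
Notation zcontr_ c eps n := (zcontr H (increment eps T n) n (rstep c eps n)).

(** The factor w of the overview, as a function of the normalisation [c]: it is c^2 eps^(4H-2), the
    scale of the squared covariances of the normalised difference quotients. *)
Definition zweight c eps : R := (c / eps * eps `^ (2 * H)) ^+ 2.

Lemma rstepE c eps n : 0 < eps ->
  (rstep c eps n * eps `^ (2 * H)) ^+ 2 = zweight c eps * (T / eps / n%:R) ^+ 2.
Proof.
move=> e0; rewrite /rstep /zweight -exprMn; congr (_ ^+ 2).
by rewrite expr2 invfM; ring.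
Qed.

(** The Toeplitz sum is a Riemann sum of (N - x) rho(x)^2 on [0, N] with N = T/eps; the correction
    for the diagonal is N^2/n and disappears. *)
Lemma zvar_increment_cvg c eps : 0 < eps ->
  zvar_ c eps n @[n --> \oo] --> zweight c eps * (2 * corr_l2 H (T / eps)).
Proof.
move=> e0; set N := T / eps; set W := zweight c eps.
have N0 : 0 < N by rewrite divr_gt0.
have E n : zvar_ c eps n = W * (2 * (N / n%:R *
    \sum_(k < n) (N - N * k%:R / n%:R) * rho H (N * k%:R / n%:R) ^+ 2) - N ^+ 2 * n%:R^-1).
  rewrite (@zvar_toeplitz _ _ _ _ _ (eps `^ (2 * H)) (fun j => rho H (N * j%:R / n%:R))); last first.
    by move=> k l; rewrite lcov_increment.
  rewrite rstepE// -/N -/W -mulrA mulr0 mul0r rho0// expr1n mulr1.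
  case: n => [|n]; first by rewrite !big_ord0 invr0 !mulr0 subrr mulr0 mulr0.
  have n0 : n.+1%:R != 0 :> R by rewrite pnatr_eq0.
  move: (n.+1%:R : R) n0 => m m0.
  congr (_ * _); rewrite mulrBr; congr (_ - _); last by field.
  rewrite mulrCA; congr (_ * _); rewrite [LHS]mulr_sumr [RHS]mulr_sumr.
  by apply: eq_bigr => k _; field.
rewrite (_ : (fun n => _) = fun n => W * (2 * (N / n%:R *
    \sum_(k < n) (N - N * k%:R / n%:R) * rho H (N * k%:R / n%:R) ^+ 2) - N ^+ 2 * n%:R^-1)); last first.
  by apply/funext => n; exact: E.
apply: cvgM; first exact: cvg_cst.
rewrite -[X in _ --> X]subr0; apply: cvgB.
  apply: cvgM; first exact: cvg_cst.
  apply: (@riemann_cvg _ (fun x => (N - x) * rho H x ^+ 2)) => //.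
  by apply: continuous_subspaceT; exact: continuous_corr_l2.
rewrite -(mulr0 (N ^+ 2)); apply: cvgM; first exact: cvg_cst.
apply/cvgrPdist_le => e e1; near=> n.
have n0 : 0 < n%:R :> R by rewrite ltr0n; near: n; exact: nbhs_infty_gt.
rewrite sub0r normrN ger0_norm ?invr_ge0 ?(ltW n0)// -[leRHS]invrK lef_pV2 ?posrE ?invr_gt0//.
by near: n; exact: nbhs_infty_ger.
Unshelve. all: by end_near. Qed.

Lemma zcontr_increment_le c eps n : 0 < eps ->
  zcontr_ c eps n <= zweight c eps *
    (2 * (T / eps / n%:R * \sum_(k < n) `|rho H (T / eps * k%:R / n%:R)|)) ^+ 2 * zvar_ c eps n.
Proof.
move=> e0.
have := @zcontr_toeplitz_le _ H (increment eps T n) n (rstep c eps n) (eps `^ (2 * H))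
  (fun j => rho H (T / eps * j%:R / n%:R)) (fun k l => lcov_increment H T n k l e0).
rewrite rstepE//; set S := \sum_(_ < _) _; set X := T / eps / n%:R.
by rewrite (_ : zweight c eps * X ^+ 2 * (2 * S) ^+ 2 = zweight c eps * (2 * (X * S)) ^+ 2); last by ring.
Qed.

(** How fine the Riemann sum must be depends on [eps], hence the nested neighbourhoods. The
    contraction bound tends to 0 * v. [W] is a closed form of the weight required only near 0, since
    [ln (1 / eps)] is positive only for [eps < 1]. *)
Lemma zvar_zcontr_near (c W : R -> R) (v tau : R) : 0 <= v -> 0 < tau ->
  (\forall eps \near 0^'+, zweight (c eps) eps = W eps) ->
  W eps * (2 * corr_l2 H (T / eps)) @[eps --> 0^'+] --> v ->
  W eps * (2 * corr_l1 H (T / eps)) ^+ 2 @[eps --> 0^'+] --> (0 : R) ->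
  \forall eps \near 0^'+, \forall n \near \oo,
    `|zvar_ (c eps) eps n - v| <= tau /\ zcontr_ (c eps) eps n <= tau.
Proof.
move=> v0 tau0 hW cA cB.
have tau2 : 0 < tau / 2 by rewrite divr_gt0.
have cBA : W eps * (2 * corr_l1 H (T / eps)) ^+ 2 * (W eps * (2 * corr_l2 H (T / eps)))
    @[eps --> 0^'+] --> (0 : R) by rewrite -[X in _ --> X](mul0r v); exact: cvgM cB cA.
move/cvgrPdist_lt/(_ _ tau2) : cBA => hBA.
move/cvgrPdist_lt/(_ _ tau2) : cA => hA.
near=> eps.
have e0 : 0 < eps by near: eps; exact: nbhs_right_gt.
have WE : zweight (c eps) eps = W eps by near: eps.
have hA' : `|v - W eps * (2 * corr_l2 H (T / eps))| < tau / 2 by near: eps.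
have hB' : `|0 - W eps * (2 * corr_l1 H (T / eps)) ^+ 2 * (W eps * (2 * corr_l2 H (T / eps)))|
  < tau / 2 by near: eps.
have c1 := @zvar_increment_cvg (c eps) eps e0; rewrite WE in c1.
have N0 : 0 < T / eps by rewrite divr_gt0.
have c2 : W eps * (2 * (T / eps / n%:R * \sum_(k < n) `|rho H (T / eps * k%:R / n%:R)|)) ^+ 2 *
    zvar_ (c eps) eps n @[n --> \oo] -->
    W eps * (2 * corr_l1 H (T / eps)) ^+ 2 * (W eps * (2 * corr_l2 H (T / eps))).
  apply: cvgM c1; apply: cvgM; first exact: cvg_cst.
  have c3 : 2 * (T / eps / n%:R * \sum_(k < n) `|rho H (T / eps * k%:R / n%:R)|) @[n --> \oo] -->
      2 * corr_l1 H (T / eps).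
    apply: cvgM; first exact: cvg_cst.
    apply: (@riemann_cvg _ (fun x => `|rho H x|)) => //.
    by apply: continuous_subspaceT; exact: continuous_rho_norm.
  exact: (cvgM c3 c3).
move/cvgrPdist_lt/(_ _ tau2) : c1 => h1.
move/cvgrPdist_lt/(_ _ tau2) : c2 => h2.
near=> n.
have h1' : `|W eps * (2 * corr_l2 H (T / eps)) - zvar_ (c eps) eps n| < tau / 2 by near: n.
have h2' := @zcontr_increment_le (c eps) eps n e0; rewrite WE in h2'.
have h3' : `|W eps * (2 * corr_l1 H (T / eps)) ^+ 2 * (W eps * (2 * corr_l2 H (T / eps))) -
   W eps * (2 * (T / eps / n%:R * \sum_(k < n) `|rho H (T / eps * k%:R / n%:R)|)) ^+ 2 *
   zvar_ (c eps) eps n| < tau / 2 by near: n.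
set X := W eps * _ ^+ 2 * zvar_ (c eps) eps n in h2' h3'.
move: hA' hB' h1' h3'; rewrite sub0r normrN !ltr_norml.
move=> /andP[a1 a2] /andP[b1 b2] /andP[d1 d2] /andP[f1 f2].
by split; [rewrite ler_norml; apply/andP; split; lra|apply: (le_trans h2'); lra].
Unshelve. all: by end_near. Qed.

End CovarianceLimits.

(** * Riemann sums along each path *)

Section PathwiseRiemannSums.
Context d (Om : measurableType d) (R : realType) (P : probability Om R).
Variables (T H : R) (B1 B2 : R -> Om -> R).
Hypotheses (T0 : 0 < T) (fB1 : is_fBm P H B1) (fB2 : is_fBm P H B2).
Implicit Types (B : R -> Om -> R) (c eps : R) (w : Om).

Lemma increment_quotient_continuous B eps w : 0 < eps ->
  {within `[0, +oo[, continuous (B ^~ w)} ->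
  {within `[0, T], continuous (fun u => (B (u + eps) w - B u w) / eps)}.
Proof.
move=> e0 cB.
have sub : `[0, T] `<=` (`[0, +oo[ : set R) by move=> x /=; rewrite !in_itv/= => /andP[->].
have c1 : {within `[0, T], continuous (fun u : R => B (u + eps) w)}.
  apply: continuous_in_subspaceT => x; rewrite inE/= in_itv/= => /andP[x0 _].
  move/continuous_within_itvcyP : cB => [cB _].
  apply: (@continuous_comp _ _ _ (fun u : R => u + eps) (B ^~ w)).
    by apply: cvgD; [exact: cvg_id|exact: cvg_cst].
  by apply: cB; rewrite in_itv/= andbT ltr_wpDl.
have c2 := continuous_subspaceW sub cB.
by move=> x; apply: cvgM; [apply: cvgB; [exact: c1|exact: c2]|exact: cvg_cst].
Qed.

Lemma zsum_Ghat_cvg c eps w : 0 < eps ->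
  zsum B1 B2 (increment eps T n) n (rstep T c eps n) w @[n --> \oo] --> c * Ghat B1 B2 T eps w.
Proof.
move=> e0.
have [_ cB1 _] := fB1; have [_ cB2 _] := fB2.
pose f (u : R) := (B1 (u + eps) w - B1 u w) / eps * ((B2 (u + eps) w - B2 u w) / eps).
rewrite (_ : (fun n => _) = fun n => c * (T / n%:R * \sum_(k < n) f (T * k%:R / n%:R))).
  apply: cvgM; first exact: cvg_cst.
  apply: riemann_cvg => //.
  have k1 := increment_quotient_continuous e0 (cB1 w).
  have k2 := increment_quotient_continuous e0 (cB2 w).
  by move=> x; apply: cvgM; [exact: k1|exact: k2].
apply/funext => n; rewrite /zsum [RHS]mulrA [RHS]mulr_sumr; apply: eq_bigr => k _.
rewrite /lf /increment !big_cons !big_nil/= /f /rstep expr2 invfM; ring.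
Qed.

Lemma zsum_measurable c eps n : 0 < eps ->
  measurable_fun setT (zsum B1 B2 (increment eps T n) n (rstep T c eps n)).
Proof.
move=> e0; apply: measurable_sum => k; apply: measurable_funM => //.
by apply: measurable_funM; [apply: (lf_measurable fB1)|apply: (lf_measurable fB2)];
  apply: increment_valid; exact: ltW.
Qed.

(** As a pointwise limit of Riemann sums, which converge by continuity of the paths. *)
Lemma Ghat_measurable c eps : 0 < eps -> measurable_fun setT (fun w => c * Ghat B1 B2 T eps w).
Proof.
move=> e0; apply: (@measurable_fun_cvg _ _ _ _
  (fun n => zsum B1 B2 (increment eps T n) n (rstep T c eps n))).
  by move=> n; exact: zsum_measurable.
by move=> w _; exact: zsum_Ghat_cvg.
Qed.

End PathwiseRiemannSums.

Section LimitTheorem.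
Context d (Om : measurableType d) (R : realType) (P : probability Om R).
Variables (T H : R) (B1 B2 : R -> Om -> R).
Hypotheses (T0 : 0 < T) (H0 : 0 < H).
Hypotheses (fB1 : is_fBm P H B1) (fB2 : is_fBm P H B2) (B12 : indep_proc P B1 B2).
Local Notation E_ := (Rintegral P setT).

(** At fixed [eps] the estimates hold for all fine Riemann sums and pass to the integral by bounded
    convergence. This gives the trigonometric moments; tightness comes in the same way from Markov's
    bound with [E Z_n^2 <= v + 1]. *)
Lemma cvg_law_of_correlation (c W : R -> R) (v : R) : 0 < v ->
  (\forall eps \near 0^'+, zweight H (c eps) eps = W eps) ->
  W eps * (2 * corr_l2 H (T / eps)) @[eps --> 0^'+] --> v ->
  W eps * (2 * corr_l1 H (T / eps)) ^+ 2 @[eps --> 0^'+] --> (0 : R) ->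
  cvg_law_indep_normal P T (path2 B1 B2) (fun eps w => c eps * Ghat B1 B2 T eps w) v.
Proof.
move=> v0 hW cA cB F tF.
have [mB1 cB1 _] := fB1; have [mB2 cB2 _] := fB2.
pose Z eps w := c eps * Ghat B1 B2 T eps w.
pose Zn eps n := zsum B1 B2 (increment eps T n) n (rstep T (c eps) eps n).
have mZ eps : 0 < eps -> measurable_fun setT (Z eps) by move=> e0; exact: (Ghat_measurable T0 fB1 fB2 (c eps) e0).
have mZn eps n : 0 < eps -> measurable_fun setT (Zn eps n) by move=> e0; exact: (zsum_measurable T0 fB1 fB2 (c eps) n e0).
have cZ eps w : 0 < eps -> Zn eps n w @[n --> \oo] --> Z eps w.
  by move=> e0; exact: (zsum_Ghat_cvg T0 fB1 fB2 e0).
have hnear := zvar_zcontr_near H0 T0 (ltW v0) _ hW cA cB.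
have Ecvg eps (g : R -> Om -> R) (M : R) : 0 < eps ->
    (forall w, continuous (g ^~ w)) -> (forall x w, `|g x w| <= M) ->
    (forall X : Om -> R, measurable_fun setT X -> measurable_fun setT (fun w => g (X w) w)) ->
    E_ (fun w => g (Zn eps n w) w) @[n --> \oo] --> E_ (fun w => g (Z eps w) w).
  move=> e0 cg bg mg; apply: (@Rintegral_bdct _ _ _ P _ _ M).
  - by move=> n; apply: mg; exact: mZn.
  - by move=> w; apply: (continuous_cvg _ (cg w _)); exact: cZ.
  - by move=> n w; exact: bg.
apply: (law_cvg mB1 mB2 cB1 cB2 v0 mZ _ _ T0 tF).
- move=> a b lam beta va vb; apply/cvgrPdist_le => e e0.
  have [tau tau0 htau] := zsum_cos_cvg fB1 fB2 B12 lam beta va vb (ltW v0) e0.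
  near=> eps.
  have e1 : 0 < eps by near: eps; exact: nbhs_right_gt.
  have hn : \forall n \near \oo, `|zvar H (increment eps T n) n (rstep T (c eps) eps n) - v| <= tau /\
      zcontr H (increment eps T n) n (rstep T (c eps) eps n) <= tau.
    by near: eps; exact: hnear.
  have cn : E_ (fun w => cos (lf B1 a w + lf B2 b w + lam * Zn eps n w + beta)) @[n --> \oo] -->
      E_ (fun w => cos (lf B1 a w + lf B2 b w + lam * Z eps w + beta)).
    apply: (Ecvg eps (fun x w => cos (lf B1 a w + lf B2 b w + lam * x + beta)) 1) => //.
    + move=> w x; apply: (@continuous_comp _ _ _ (fun x : R => lf B1 a w + lf B2 b w + lam * x + beta) cos).
        apply: cvgD; last exact: cvg_cst.
        apply: cvgD; first exact: cvg_cst.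
        by apply: cvgM; [exact: cvg_cst|exact: cvg_id].
      exact: continuous_cos.
    + by move=> x w; rewrite ler_norml cos_geN1 cos_le1.
    + move=> X mX; apply: (measurableT_comp (continuous_measurable_fun (@continuous_cos R))).
      apply: measurable_funD => //; apply: measurable_funD; last exact: measurable_funM.
      apply: measurable_funD; first exact: (lf_measurable fB1).
      exact: (lf_measurable fB2).
  set l := E_ _ * _.
  have cl : `|l - E_ (fun w => cos (lf B1 a w + lf B2 b w + lam * Zn eps n w + beta))| @[n --> \oo] -->
      `|l - E_ (fun w => cos (lf B1 a w + lf B2 b w + lam * Z eps w + beta))|.
    by apply: cvg_norm; apply: cvgB cn; exact: cvg_cst.
  apply: (cvgr_to_le cl).
  near=> n; rewrite distrC; apply: htau.
  + by move=> k; apply: increment_valid; exact: ltW.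
  + by have [] : `|zvar H (increment eps T n) n (rstep T (c eps) eps n) - v| <= tau /\
      zcontr H (increment eps T n) n (rstep T (c eps) eps n) <= tau by near: n.
  + by have [] : `|zvar H (increment eps T n) n (rstep T (c eps) eps n) - v| <= tau /\
      zcontr H (increment eps T n) n (rstep T (c eps) eps n) <= tau by near: n.
- move=> e e0.
  (* Chosen so that [(v + 1) / K ^+ 2 = e]. *)
  pose K := Num.sqrt ((v + 1) / e).
  have ve0 : 0 < (v + 1) / e by rewrite divr_gt0//; lra.
  have K0 : 0 < K by rewrite sqrtr_gt0.
  have K2 : K ^+ 2 = (v + 1) / e by rewrite sqr_sqrtr// ltW.
  exists K => //; near=> eps.
  have e1 : 0 < eps by near: eps; exact: nbhs_right_gt.
  have hn : \forall n \near \oo, `|zvar H (increment eps T n) n (rstep T (c eps) eps n) - v| <= 1 /\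
      zcontr H (increment eps T n) n (rstep T (c eps) eps n) <= 1.
    by near: eps; exact: hnear.
  have cl : E_ (fun w => Num.min 1 ((Zn eps n w / K) ^+ 2)) @[n --> \oo] -->
      E_ (fun w => Num.min 1 ((Z eps w / K) ^+ 2)).
    apply: (Ecvg eps (fun x w => Num.min 1 ((x / K) ^+ 2)) 1) => //.
    + move=> w x.
      have c2 : {for x, continuous (fun y : R => (y / K) ^+ 2)}.
        apply: (@continuous_comp _ _ _ (fun y : R => y / K) (fun y => y ^+ 2)).
          by apply: cvgM; [exact: cvg_id|exact: cvg_cst].
        exact: exprn_continuous.
      exact: (@continuous_min _ _ (fun=> 1) (fun y : R => (y / K) ^+ 2) x (cvg_cst _) c2).
    + by move=> x w; have /andP[a1 a2] := min1_sqr K x; rewrite ger0_norm.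
    + move=> X mX; apply: measurable_minr => //; apply: measurable_funX.
      exact: measurable_funM.
  apply: (cvgr_to_le cl); near=> n.
  have [hv _] : `|zvar H (increment eps T n) n (rstep T (c eps) eps n) - v| <= 1 /\
      zcontr H (increment eps T n) n (rstep T (c eps) eps n) <= 1 by near: n.
  have vd k : lvalid (increment eps T n k) by apply: increment_valid; exact: ltW.
  have [i2 m2] := zsum_moment2 fB1 fB2 B12 n (rstep T (c eps) eps n) vd.
  have iK : P.-integrable setT (EFin \o (fun w => (K ^+ 2)^-1 * Zn eps n w ^+ 2)).
    exact: integrableZl_fun.
  apply: (@le_trans _ _ (E_ (fun w => (K ^+ 2)^-1 * Zn eps n w ^+ 2))).
    apply: le_Rintegral => //.
      apply: (@integrable_bounded _ _ _ P _ 1) => [|w]; last first.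
        by have /andP[a1 a2] := min1_sqr K (Zn eps n w); rewrite ger0_norm.
      apply: measurable_minr => //; apply: measurable_funX.
      by apply: measurable_funM => //; exact: mZn.
    by move=> w _; rewrite expr_div_n [_ / _]mulrC ge_min lexx orbT.
  rewrite RintegralZl// m2 K2 invf_div mulrAC ler_pdivrMr; last by lra.
  rewrite ler_wpM2l ?(ltW e0)//; move: hv; rewrite ler_norml => /andP[]; lra.
Unshelve. all: by end_near. Qed.

End LimitTheorem.

(** * Normalisations and vanishing contraction in the two regimes *)

Section Weights.
Context (R : realType).
Implicit Types (H T eps : R).

(** The exponents add up to 2 (3/2 - 2H - 1 + 2H) = 1 whatever [H] is. *)
Lemma zweight_below H eps : 0 < eps -> zweight H (eps `^ (3 / 2 - 2 * H)) eps = eps.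
Proof.
move=> e0; rewrite /zweight -(powR_inv1 (ltW e0)).
have ne r s : (r + s == 0 :> R) ==> (eps != 0) by rewrite (gt_eqF e0) implybT.
rewrite -!powRD// -powR_mulrn ?powR_ge0// -powRrM -[RHS]powRr1 ?(ltW e0)//.
by congr (_ `^ _); field.
Qed.

Lemma zweight_critical eps : 0 < eps -> eps < 1 ->
  zweight (3 / 4) (Num.sqrt (ln (1 / eps)))^-1 eps = eps / ln (1 / eps).
Proof.
move=> e0 e1.
have l0 : 0 < ln (1 / eps) by rewrite ln_gt0// mul1r invf_gt1.
have ne r s : (r + s == 0 :> R) ==> (eps != 0) by rewrite (gt_eqF e0) implybT.
rewrite /zweight -mulrA exprMn exprVn sqr_sqrtr ?(ltW l0)// mulrC; congr (_ * _).
rewrite -(powR_inv1 (ltW e0)) -powRD// -powR_mulrn ?powR_ge0// -powRrM.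
rewrite -[RHS]powRr1 ?(ltW e0)//.
by congr (_ `^ _); field.
Qed.

Lemma corr_l1_cvg_below H T : 0 < H -> H < 3 / 4 -> 0 < T ->
  eps * (2 * corr_l1 H (T / eps)) ^+ 2 @[eps --> 0^'+] --> (0 : R).
Proof.
move=> H0 H34 T0; have H1 : H < 1 by lra.
(* [a > 1/2] makes the bound vanish and [a < 1] is required by [corr_l1_sqr_le]. Up to H = 5/8 the
   value 3/4 is admissible; beyond, 2 - 2H itself lies between 1/2 and 3/4. *)
have [a [a0 a1 aH]] : exists a : R, [/\ 1 / 2 < a, a < 1 & a <= 2 - 2 * H].
  have [h|h] := leP H (5 / 8); first by exists (3 / 4); split; lra.
  by exists (2 - 2 * H); split; lra.
have a0' : 0 <= a by lra.
have [C C0 hC] := corr_l1_sqr_le H0 H1 a0' a1 aH T0.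
have c0 : C * eps `^ (2 * a - 1) @[eps --> 0^'+] --> (0 : R).
  rewrite -[X in _ --> X](mulr0 C); apply: cvgM; first exact: cvg_cst.
  by apply: powR_cvg0; lra.
apply: (squeeze_cvgr _ (cvg_cst 0) c0).
near=> eps.
have e0 : 0 < eps by near: eps; exact: nbhs_right_gt.
have eT : eps <= T by near: eps; exact: nbhs_right_le.
by rewrite mulr_ge0 ?sqr_ge0 ?(ltW e0)//= hC.
Unshelve. all: by end_near. Qed.

(** Here 2 - 2H = 1/2 is the largest admissible exponent and [corr_l1_sqr_le] gives mere
    boundedness; the logarithm in the normalisation makes the product vanish. *)
Lemma corr_l1_cvg_critical T : 0 < T ->
  eps / ln (1 / eps) * (2 * corr_l1 (3 / 4) (T / eps)) ^+ 2 @[eps --> 0^'+] --> (0 : R).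
Proof.
move=> T0.
have [H0 H1 a0 a1 aH] : [/\ 0 < 3 / 4 :> R, 3 / 4 < 1 :> R, 0 <= 1 / 2 :> R, 1 / 2 < 1 :> R &
  1 / 2 <= 2 - 2 * (3 / 4) :> R] by split; lra.
have [C C0 hC] := corr_l1_sqr_le H0 H1 a0 a1 aH T0.
have c0 : C * (ln (1 / eps))^-1 @[eps --> 0^'+] --> (0 : R).
  rewrite -[X in _ --> X](mulr0 C); apply: cvgM; first exact: cvg_cst.
  exact: lnV_cvg.
apply: (squeeze_cvgr _ (cvg_cst 0) c0).
near=> eps.
have e0 : 0 < eps by near: eps; exact: nbhs_right_gt.
have eT : eps <= T by near: eps; exact: nbhs_right_le.
have e1 : eps < 1 by near: eps; exact: nbhs_right_lt.
have l0 : 0 < ln (1 / eps) by rewrite ln_gt0// mul1r invf_gt1.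
rewrite mulrAC divr_ge0 ?(ltW l0) ?(mulr_ge0 (ltW e0) (sqr_ge0 _))//=.
rewrite ler_wpM2r ?invr_ge0 ?(ltW l0)//; apply: (le_trans (hC eps e0 eT)).
by rewrite (_ : 2 * (1 / 2) - 1 = 0) ?powRr0 ?mulr1//; field.
Unshelve. all: by end_near. Qed.

End Weights.

Unset Implicit Arguments.
Set Strict Implicit.
Set Printing Implicit Defensive.

Theorem theorem6p3 (d : measure_display) (Omega : measurableType d)
  (R : realType) (P : probability Omega R) (T H : R) (B1 B2 : R -> Omega -> R) :
  0 < T -> 0 < H -> H < 1 ->
  is_fBm P H B1 -> is_fBm P H B2 -> indep_proc P B1 B2 ->
  (H < 3 / 4 ->
     cvg_law_indep_normal P T (path2 B1 B2)
       (fun eps w => eps `^ (3 / 2 - 2 * H) * Ghat B1 B2 T eps w)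
       (T * sigmaH2 H)) /\
  (H = 3 / 4 ->
     cvg_law_indep_normal P T (path2 B1 B2)
       (fun eps w => Ghat B1 B2 T eps w / Num.sqrt (ln (1 / eps)))
       (9 * T / 32)).
Proof.
move=> T0 H0 H1 fB1 fB2 B12; split => [H34|HE].
  apply: (cvg_law_of_correlation T0 H0 fB1 fB2 B12
    (c := fun eps => eps `^ (3 / 2 - 2 * H)) (W := id)).
  - by rewrite mulr_gt0// sigmaH2_gt0.
  - near=> eps; apply: zweight_below; near: eps; exact: nbhs_right_gt.
  - exact: corr_l2_cvg.
  - exact: corr_l1_cvg_below.
rewrite (_ : (fun eps w => _) = fun eps w => (Num.sqrt (ln (1 / eps)))^-1 * Ghat B1 B2 T eps w); last first.
  by apply/funext => eps; apply/funext => w; rewrite mulrC.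
apply: (cvg_law_of_correlation T0 H0 fB1 fB2 B12
  (c := fun eps => (Num.sqrt (ln (1 / eps)))^-1) (W := fun eps => eps / ln (1 / eps))).
- by rewrite divr_gt0// mulr_gt0.
- rewrite HE; near=> eps; apply: zweight_critical; near: eps.
    exact: nbhs_right_gt.
  exact: nbhs_right_lt.
- rewrite HE; exact: corr_l2_34_cvg.
- rewrite HE; exact: corr_l1_cvg_critical.
Unshelve. all: by end_near. Qed.
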